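(* Let $\varepsilon>0$, $\eta>0$, and let $\mathcal F:H^2_{\rm per}(\Omega)\to\mathbb{R}$ be the functionalized Cahn–Hilliard energy $$\mathcal F(\phi)=\frac{\varepsilon^{-2}}{2}\int_\Omega(\phi^3-\phi-\varepsilon^2\Delta\phi)^2\,d\mathbf x-\eta\int_\Omega\left\{\tfrac14\phi^4-\tfrac12\phi^2+\tfrac{\varepsilon^2}{2}|\nabla\phi|^2\right\}d\mathbf x.$$ Then $\mathcal F$ possesses a convex splitting over $H^2_{\rm per}(\Omega)$. In particular, $\mathcal F(\phi)=\mathcal F_c(\phi)-\mathcal F_e(\phi)$ with $$\mathcal F_c(\phi)=\int_\Omega\Big\{\tfrac{\varepsilon^{-2}}{2}\phi^6+\big(\tfrac{\varepsilon^{-2}}{2}+\tfrac{\eta}{2}\big)\phi^2+\tfrac{\varepsilon^2}{2}(\Delta\phi)^2+A(\phi^4+|\nabla\phi|^4)+3\phi^2|\nabla\phi|^2\Big\}d\mathbf x,$$ $$\mathcal F_e(\phi)=\int_\Omega\Big\{\big(\varepsilon^{-2}+\tfrac{\eta}{4}\big)\phi^4+\big(1+\tfrac{\eta\varepsilon^2}{2}\big)|\nabla\phi|^2+A(\phi^4+|\nabla\phi|^4)\Big\}d\mathbf x,$$ where both $\mathcal F_c,\mathcal F_e:H^2_{\rm per}(\Omega)\to\mathbb{R}$ are strictly convex provided $A\ge1$.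
   Context: $\Omega\subset\mathbb{R}^D$, $D=2$ or $3$, is a rectangular box, and $H^2_{\rm per}(\Omega)$ is the Sobolev space of real-valued $\Omega$-periodic functions. A convex splitting of a functional is a representation of it as a difference of two convex functionals. *)

(* Defs.v *)
From HB Require Import structures.
From mathcomp Require Import all_boot all_order all_algebra.
From mathcomp Require Import all_classical all_reals all_analysis.

Set Implicit Arguments.
Unset Strict Implicit.
Unset Printing Implicit Defensive.

Import Order.TTheory GRing.Theory Num.Theory.
Import numFieldNormedType.Exports.

Local Open Scope classical_set_scope.
Local Open Scope ring_scope.

(* Matrices carry the product sigma-algebra, generated by the preimages of
   measurable sets under the entry maps. *)
Definition mx_cylinder d (T : sigmaRingType d) (m n : nat) :
    set (set 'M[T]_(m, n)) :=
  [set C | exists i j, exists2 B : set T, measurable B &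
             C = (fun M : 'M[T]_(m, n) => M i j) @^-1` B].

Definition measure_mx_display : measure_display -> measure_display.
Proof. exact. Qed.

HB.instance Definition _ d (T : sigmaRingType d) (m n : nat) :=
  @isMeasurable.Build (measure_mx_display d) 'M[T]_(m, n)
    <<s @mx_cylinder d T m n >>
    (@sigma_algebra0 _ setT _) (@sigma_algebraC _ _)
    (@sigma_algebra_bigcup _ setT _).

Section measurable_mx.
Context d (T : measurableType d) d' (S : measurableType d').

Lemma measurable_mx_entry m n (i : 'I_m) (j : 'I_n) :
  measurable_fun [set: 'M[T]_(m, n)] (fun M : 'M[T]_(m, n) => M i j).
Proof.
move=> _ B mB; rewrite setTI; apply: sub_sigma_algebra.
by exists i, j, B.
Qed.

Lemma measurable_fun_mxP m n (f : S -> 'M[T]_(m, n)) :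
  (forall i j, measurable_fun setT (fun s => f s i j)) ->
  measurable_fun setT f.
Proof.
move=> mf; apply: (@measurability _ _ _ _ _ _ (@mx_cylinder d T m n)) => //.
move=> _ [C [i [j [B mB ->]]] <-]; rewrite setTI.
by have := mf i j measurableT _ mB; rewrite setTI.
Qed.

End measurable_mx.

Section lebesgue_rV.
Context {R : realType}.

Definition rV_cons n (p : measurableTypeR R * 'rV[R]_n) : 'rV[R]_n.+1 :=
  row_mx (p.1)%:M p.2 : 'rV[R]_(1 + n).

Definition rV_uncons n (v : 'rV[R]_n.+1) : measurableTypeR R * 'rV[R]_n :=
  (v ord0 ord0, rsubmx (v : 'rV[R]_(1 + n))).

Lemma rV_unconsK n : cancel (@rV_uncons n) (@rV_cons n).
Proof.
move=> v; rewrite /rV_cons /rV_uncons/=.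
rewrite -[RHS](@hsubmxK _ 1 1 n v); congr (@row_mx R 1 1 n _ _).
apply/matrixP => i j; rewrite !ord1 !mxE eqxx mulr1n; congr (v _ _).
exact/val_inj.
Qed.

Lemma rV_consK n : cancel (@rV_cons n) (@rV_uncons n).
Proof.
move=> [x v]; rewrite /rV_cons /rV_uncons/=; congr pair.
  transitivity ((x%:M : 'M[R]_1) ord0 ord0); last by rewrite mxE eqxx mulr1n.
  rewrite -[RHS](row_mxEl _ v); congr (fun_of_matrix _ _ _).
  exact/val_inj.
exact: row_mxKr.
Qed.

Lemma rV_consE0 n x v : @rV_cons n (x, v) ord0 ord0 = x.
Proof. exact: (congr1 fst (rV_consK (x, v))). Qed.

Lemma rV_consES n x v i : @rV_cons n (x, v) ord0 (lift ord0 i) =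
  (v : 'rV[R]_n) ord0 i.
Proof.
rewrite -[v in RHS](congr1 snd (rV_consK (x, v))) [RHS]mxE.
by congr (fun_of_matrix _ _ _); exact: val_inj.
Qed.

Lemma measurable_rV_cons n : measurable_fun setT (@rV_cons n).
Proof.
apply: measurable_fun_mxP => i j; rewrite /rV_cons.
rewrite -[j]/(j : 'I_(1 + n)); case: (@split_ordP 1 n j) => k ->.
  apply: (eq_measurable_fun fst); last exact: measurable_fst.
  move=> p _; apply/esym/(etrans (row_mxEl _ _ _ _)).
  by rewrite !ord1 mxE eqxx mulr1n.
apply: (eq_measurable_fun ((fun v : 'rV[R]_n => v i k) \o snd)); last first.
  apply: measurableT_comp; first exact: measurable_mx_entry.
  exact: measurable_snd.
by move=> p _; apply/esym/(etrans (row_mxEr _ _ _ _)).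
Qed.

Lemma measurable_rV_uncons n : measurable_fun setT (@rV_uncons n).
Proof.
apply/measurable_fun_pairP; split; first exact: measurable_mx_entry.
apply: measurable_fun_mxP => i j.
under eq_fun do rewrite /= mxE.
exact: measurable_mx_entry.
Qed.

Section lebesgue_cons.
Context n (nu : {sigma_finite_measure set 'rV[R]_n -> \bar R}).

Definition lebesgue_cons : set 'rV[R]_n.+1 -> \bar R :=
  pushforward (lebesgue_measure \x nu)%E (@rV_cons n).

HB.instance Definition _ := Measure.copy lebesgue_cons
  (measure_function_pushforward__canonical__measure_function_Measure
     (lebesgue_measure \x nu)%E (@measurable_rV_cons n)).

Let lebesgue_cons_sigma_finite : sigma_finite setT lebesgue_cons.
Proof.
have /sigma_finiteP[F [TF ndF Foo]] := sigma_finiteT (@lebesgue_measure R).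
have /sigma_finiteP[G [TG ndG Goo]] := sigma_finiteT nu.
exists (fun k => @rV_uncons n @^-1` (F k `*` G k)).
  rewrite -preimage_bigcup; apply/esym/seteqP; split => // v _.
  have [i _ Fi] : (\bigcup_i F i) (rV_uncons v).1 by rewrite -TF.
  have [j _ Gj] : (\bigcup_i G i) (rV_uncons v).2 by rewrite -TG.
  exists (maxn i j) => //; split.
  - by move: Fi; exact/subsetPset/ndF/leq_maxl.
  - by move: Gj; exact/subsetPset/ndG/leq_maxr.
move=> k; have [mF Fk] := Foo k; have [mG Gk] := Goo k; split.
  by rewrite -[X in measurable X]setTI; apply: measurable_rV_uncons => //;
     exact: measurableX.
rewrite /lebesgue_cons /pushforward -comp_preimage.
rewrite (_ : _ @^-1` _ = F k `*` G k); last first.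
  by apply/funext => p; rewrite /preimage /mkset [X in setX _ _ X]rV_consK.
by rewrite product_measure1E// lte_mul_pinfty// ge0_fin_numE.
Qed.

HB.instance Definition _ := Measure_isSigmaFinite.Build _ _ _ lebesgue_cons
  lebesgue_cons_sigma_finite.

End lebesgue_cons.

(* On 'rV_0, a one-point space, Lebesgue measure is the unit mass; on
   'rV_n.+1 it is the product of the Lebesgue measures on R and on 'rV_n. *)
Fixpoint lebesgue_rV n : {sigma_finite_measure set 'rV[R]_n -> \bar R} :=
  if n is n'.+1 then @lebesgue_cons n' (lebesgue_rV n') else \d_(0 : 'rV[R]_0).

End lebesgue_rV.
Arguments lebesgue_rV : clear implicits.

Lemma lebesgue_rV_prod (R : realType) n (A : 'I_n -> set R) :
  (forall i, measurable (A i)) ->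
  lebesgue_rV R n [set x | forall i, A i (x ord0 i)] =
  (\prod_(i < n) lebesgue_measure (A i))%E.
Proof.
elim: n A => [|n IH] A mA.
  rewrite big_ord0 /= diracE mem_set//=; by case.
rewrite big_ord_recl -IH; last by move=> i; exact: mA.
set B := [set x : 'rV[R]_n | forall i : 'I_n, A (lift ord0 i) (x ord0 i)].
have mB : measurable B.
  rewrite (_ : B = \bigcap_(i in [set: 'I_n])
      (fun x : 'rV[R]_n => x ord0 i) @^-1` A (lift ord0 i)); last first.
    by apply/seteqP; split => x Bx i; [move=> _; exact: Bx|exact: (Bx i I)].
  apply: fin_bigcap_measurable; first exact: finite_finset.
  move=> i _; rewrite -[X in measurable X]setTI.
  exact: measurable_mx_entry.
rewrite -product_measure1E//; last exact: mA.
rewrite /= /lebesgue_cons /pushforward; congr (product_measure1 _ _ _).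
apply/seteqP; split => -[x v] /=.
- move=> H; split => [|i] /=; first by have := H ord0; rewrite rV_consE0.
  by have := H (lift ord0 i); rewrite rV_consES.
- move=> [Hx Hv] i; have [j|] := unliftP ord0 i => ->.
    by rewrite rV_consES.
  by rewrite rV_consE0.
Qed.

Section periodic_sobolev.
Context {R : realType} {D : nat}.
Variables a b : 'rV[R]_D.
Implicit Types f g phi zeta : 'rV[R]_D -> R.

Definition box : set 'rV[R]_D :=
  [set x | forall i, x ord0 i \in `]a ord0 i, b ord0 i[].

Definition box_integrable f :=
  (lebesgue_rV R D).-integrable box (EFin \o f).

Definition box_periodic f :=
  forall i x, f (x + (b ord0 i - a ord0 i) *: delta_mx ord0 i) = f x.

Definition partial (i : 'I_D) f : 'rV[R]_D -> R := 'D_(delta_mx ord0 i) f.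

Definition iter_partial (s : seq 'I_D) f := foldr partial f s.

Definition smooth f :=
  forall s, continuous (iter_partial s f) /\
    forall i x, derivable (iter_partial s f) x (delta_mx ord0 i).

Definition L2per f :=
  [/\ measurable_fun setT f, box_periodic f & box_integrable (fun x => f x ^+ 2)].

(* g is the i-th distributional partial derivative of f on the flat torus
   obtained by identifying opposite faces of the box *)
Definition is_weak_partial (i : 'I_D) f g :=
  forall zeta, smooth zeta -> box_periodic zeta ->
    \int[lebesgue_rV R D]_(x in box) (f x * partial i zeta x) =
    - \int[lebesgue_rV R D]_(x in box) (g x * zeta x).

(* Elements are representatives: two of them denote the same element of the
   Sobolev space when they are equal almost everywhere. *)
Fixpoint Hper (k : nat) f : Prop :=
  if k is k'.+1 then
    L2per f /\ forall i, exists2 g, is_weak_partial i f g & Hper k' g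
  else L2per f.

Definition H2per : set ('rV[R]_D -> R^o) := [set phi | Hper 2 phi].

(* a version of the weak partial derivative when there is one in L2per, and 0
   otherwise *)
Definition weak_partial (i : 'I_D) f : 'rV[R]_D -> R :=
  xget (fun=> 0) [set g | L2per g /\ is_weak_partial i f g].

Definition grad_sq f : 'rV[R]_D -> R :=
  fun x => \sum_(i < D) weak_partial i f x ^+ 2.

Definition laplacian f : 'rV[R]_D -> R :=
  fun x => \sum_(i < D) weak_partial i (weak_partial i f) x.

Local Notation E := (convex_lmodType ('rV[R]_D -> R^o)).
Implicit Type J : E -> R^o.

Local Open Scope convex_scope.

(* J descends to almost-everywhere classes, i.e. is a functional on the
   Sobolev space itself *)
Definition H2_functional J :=
  forall phi psi, H2per phi -> H2per psi ->
    phi = psi %[ae (lebesgue_rV R D) in box] -> J phi = J psi.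

Definition H2_convex J := H2_functional J /\ convex_function H2per J.

Definition H2_strictly_convex J :=
  H2_functional J /\
  forall (t : {i01 R}) (phi psi : E), 0 < t%:num < 1 ->
    H2per phi -> H2per psi ->
    ~ (phi = psi %[ae (lebesgue_rV R D) in box]) ->
    J (phi <| t |> psi) < J phi <| t |> J psi.

Definition convex_splitting J :=
  exists Jc Je : E -> R^o, [/\ H2_convex Jc, H2_convex Je &
    forall phi, H2per phi -> J phi = Jc phi - Je phi].

Variables eps eta : R.

Definition fch_square phi x :=
  (phi x ^+ 3 - phi x - eps ^+ 2 * laplacian phi x) ^+ 2.

Definition fch_cahn_hilliard phi x :=
  4^-1 * phi x ^+ 4 - 2^-1 * phi x ^+ 2 + eps ^+ 2 / 2 * grad_sq phi x.

Definition fch_energy phi : R :=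
  eps ^- 2 / 2 * \int[lebesgue_rV R D]_(x in box) fch_square phi x
  - eta * \int[lebesgue_rV R D]_(x in box) fch_cahn_hilliard phi x.

(* |grad phi|^4 is the square of grad_sq. *)
Definition contractive_density (A : R) phi x :=
  eps ^- 2 / 2 * phi x ^+ 6 + (eps ^- 2 / 2 + eta / 2) * phi x ^+ 2
  + eps ^+ 2 / 2 * laplacian phi x ^+ 2
  + A * (phi x ^+ 4 + grad_sq phi x ^+ 2)
  + 3 * phi x ^+ 2 * grad_sq phi x.

Definition expansive_density (A : R) phi x :=
  (eps ^- 2 + eta / 4) * phi x ^+ 4 + (1 + eta * eps ^+ 2 / 2) * grad_sq phi x
  + A * (phi x ^+ 4 + grad_sq phi x ^+ 2).

Definition contractive_energy (A : R) phi : R :=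
  \int[lebesgue_rV R D]_(x in box) contractive_density A phi x.

Definition expansive_energy (A : R) phi : R :=
  \int[lebesgue_rV R D]_(x in box) expansive_density A phi x.

End periodic_sobolev.

(* Main.v *)
(* Integrating by parts, int phi lap phi = - int |grad phi|^2 and
   int phi^3 lap phi = - 3 int phi^2 |grad phi|^2, which turns the cross terms of
   the square in F into the terms of F_c and F_e. In dimension 2 or 3, H^1 embeds
   into L^4 (Ladyzhenskaya's argument along coordinate lines); applied to phi, to
   phi^2 and to the first derivatives of phi it makes every term integrable.
   Convexity holds pointwise in (phi, grad phi, lap phi): the only mixed term,
   3 phi^2 |grad phi|^2, is compensated by phi^4 + |grad phi|^4 as soon as A >= 1,
   and the remaining phi^2 and phi^4 terms make it strict. Weak derivatives are
   handled through translations: f(x + s e_i) - f(x) is the integral of the i-th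
   weak derivative along the segment, by testing against smooth periodic
   functions, which separate L^1 because the indicators of half-boxes are pointwise
   limits of trigonometric polynomials. *)
Require Import Defs.
From HB Require Import structures.
From mathcomp Require Import all_boot all_order all_algebra.
From mathcomp Require Import all_classical all_reals all_analysis.
From mathcomp Require Import measurable_realfun ring lra.

Set Implicit Arguments.
Unset Strict Implicit.
Unset Printing Implicit Defensive.

Import Order.TTheory GRing.Theory Num.Theory.
Import numFieldNormedType.Exports.

Local Open Scope classical_set_scope.
Local Open Scope ring_scope.

(** * Fubini on domains and Lebesgue measure on row vectors *)

(** No Sobolev function is ever approximated by smooth ones: facts on weak derivatives are reduced
    to the invariance of box integrals of periodic functions under translation. The delicate
    identity is integration by parts between two functions that are merely in H^1, such as phi^3 and
    a first derivative of phi. It comes from integrating the discrete product rule for a translation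
    by s, where every error is of order s^2; the product rule for weak derivatives then follows from
    it. The embedding is applied to phi^2 because phi^8, not only phi^6, is needed: it puts phi^2
    d_i phi in L^2, so that phi^3 is in H^1. In dimension 3 the planar estimate is applied on slices
    and summed; this works because that estimate is linear in the squared gradient once the L^2
    norms of the slices have a common bound. Two encodings cost work. A real-valued integral that
    diverges takes a default value, so Fubini arguments pass through extended reals and identities
    between inner integrals hold only almost everywhere. [weak_partial] picks an arbitrary version,
    so it too is linear only almost everywhere. *)

Lemma measurable_patch d (T : measurableType d) (R : realType) (D : set T)
    (f : T -> \bar R) :
  measurable D -> measurable_fun setT f -> measurable_fun setT (f \_ D).
Proof.
by move=> mD mf; apply/(measurable_restrictT f mD)/measurable_funTS.
Qed.

Section fubini_domain.
Local Open Scope ereal_scope.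
Context d1 d2 (T1 : measurableType d1) (T2 : measurableType d2) (R : realType).
Variables (m1 : {sigma_finite_measure set T1 -> \bar R})
  (m2 : {sigma_finite_measure set T2 -> \bar R}).
Variables (A : set T1) (B : set T2).
Hypotheses (mA : measurable A) (mB : measurable B).

(** Extending the integrand by zero outside [A]*[B] turns the domain versions of Fubini and Tonelli
    into those on the whole product. *)
Lemma integral12_patch (f : T1 * T2 -> \bar R) :
  \int[m1]_(x in A) \int[m2]_(y in B) f (x, y) =
  \int[m1]_x \int[m2]_y (f \_ (A `*` B)) (x, y).
Proof.
rewrite integral_mkcond; apply: eq_integral => x _; rewrite patchE.
case: ifPn => xA; last first.
  by rewrite integral0_eq// => y _; rewrite patchE in_setX (negbTE xA).
rewrite integral_mkcond; apply: eq_integral => y _.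
by rewrite !patchE in_setX xA.
Qed.

Lemma integral21_patch (f : T1 * T2 -> \bar R) :
  \int[m2]_(y in B) \int[m1]_(x in A) f (x, y) =
  \int[m2]_y \int[m1]_x (f \_ (A `*` B)) (x, y).
Proof.
rewrite integral_mkcond; apply: eq_integral => y _; rewrite patchE.
case: ifPn => yB; last first.
  by rewrite integral0_eq// => x _; rewrite patchE in_setX (negbTE yB) andbF.
rewrite integral_mkcond; apply: eq_integral => x _.
by rewrite !patchE in_setX yB andbT.
Qed.

Lemma fubini_tonelli_in (f : T1 * T2 -> \bar R) :
  measurable_fun setT f -> (forall z, 0 <= f z) ->
  \int[m1]_(x in A) \int[m2]_(y in B) f (x, y) =
  \int[m2]_(y in B) \int[m1]_(x in A) f (x, y).
Proof.
move=> mf f0; rewrite integral12_patch integral21_patch fubini_tonelli//.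
- by apply: measurable_patch => //; exact: measurableX.
- by move=> z; rewrite patchE; case: ifPn.
Qed.

Lemma fubini_in (f : T1 * T2 -> R) : measurable_fun setT f ->
  \int[m1]_(x in A) \int[m2]_(y in B) `|f (x, y)|%:E < +oo ->
  \int[m1]_(x in A) \int[m2]_(y in B) (f (x, y))%:E =
  \int[m2]_(y in B) \int[m1]_(x in A) (f (x, y))%:E.
Proof.
move=> mf foo.
rewrite (integral12_patch (EFin \o f)) (integral21_patch (EFin \o f)).
have mF : measurable_fun setT ((EFin \o f) \_ (A `*` B)).
  by apply: measurable_patch; [exact: measurableX|exact/measurable_EFinP].
rewrite (@Fubini _ _ _ _ _ _ _ ((EFin \o f) \_ (A `*` B)))//.
have E : \int[m1]_x \int[m2]_y `|((EFin \o f) \_ (A `*` B)) (x, y)| =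
    \int[m1]_(x in A) \int[m2]_(y in B) `|f (x, y)|%:E.
  rewrite (integral12_patch (fun z => `|f z|%:E)).
  apply: eq_integral => x _; apply: eq_integral => y _.
  by rewrite !patchE; case: ifPn => //=; rewrite normr0.
by apply/(@integrable12ltyP _ _ _ _ _ m1 m2 _ mF); rewrite E.
Qed.

Lemma measurable_integral_in1 (f : T1 * T2 -> \bar R) :
  measurable_fun setT f -> (forall z, 0 <= f z) ->
  measurable_fun setT (fun x => \int[m2]_(y in B) f (x, y)).
Proof.
move=> mf f0.
rewrite (_ : (fun x => _) = fubini_F m2 (f \_ (setT `*` B))); last first.
  apply/funext => x /=; rewrite /fubini_F [LHS]integral_mkcond.
  by apply: eq_integral => y _; rewrite !patchE in_setX in_setT.
apply: measurable_fun_fubini_tonelli_F.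
  by apply: measurable_patch => //; exact: measurableX.
by move=> z; rewrite patchE; case: ifPn.
Qed.

End fubini_domain.

Section box.
Context {R : realType}.

Lemma measurable_box D (a b : 'rV[R]_D) : measurable (box a b).
Proof.
rewrite (_ : box a b = \bigcap_(i in [set: 'I_D])
   (fun x : 'rV[R]_D => x ord0 i) @^-1` `]a ord0 i, b ord0 i[); last first.
  by apply/seteqP; split => x Bx i; [move=> _; exact: Bx|exact: (Bx i I)].
apply: fin_bigcap_measurable; first exact: finite_finset.
move=> i _; rewrite -[X in measurable X]setTI.
exact: measurable_mx_entry.
Qed.

Lemma lebesgue_rV_box D (a b : 'rV[R]_D) : (forall i, a ord0 i < b ord0 i) ->
  lebesgue_rV R D (box a b) = (\prod_(i < D) (b ord0 i - a ord0 i))%:E.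
Proof.
move=> ab.
rewrite (lebesgue_rV_prod (A := fun i => `]a ord0 i, b ord0 i[%classic))//.
rewrite -prodEFin; apply: eq_bigr => i _.
by rewrite lebesgue_measure_itv/= lte_fin ab EFinB.
Qed.

Lemma rV_uncons2E n (c : 'rV[R]_n.+1) i :
  (rV_uncons c).2 ord0 i = c ord0 (lift ord0 i).
Proof. by rewrite -[in RHS](rV_unconsK c) rV_consES. Qed.

Lemma box_cons n (a b : 'rV[R]_n.+1) x v :
  box a b (rV_cons (x, v)) <->
  `]a ord0 ord0, b ord0 ord0[%classic x /\ box (rV_uncons a).2 (rV_uncons b).2 v.
Proof.
split => [Bx|[xab Bv] i].
  split; first by have := Bx ord0; rewrite rV_consE0.
  by move=> i; have := Bx (lift ord0 i); rewrite rV_consES !rV_uncons2E.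
have [j|] := unliftP ord0 i => ->; last by rewrite rV_consE0.
by rewrite rV_consES -!rV_uncons2E; exact: Bv.
Qed.

(** [lebesgue_rV R n.+1] is the image of a product measure under [rV_cons], and the preimage of a
    box is an interval times a box. Arguments in dimension [n.+1] peel off the first coordinate
    through this identity. *)
Lemma integral_rV_cons n (a b : 'rV[R]_n.+1) (f : 'rV[R]_n.+1 -> \bar R) :
  measurable_fun setT f -> (forall x, 0 <= f x)%E ->
  (\int[lebesgue_rV R n.+1]_(x in box a b) f x =
   \int[lebesgue_measure]_(y in `]a ord0 ord0, b ord0 ord0[)
     \int[lebesgue_rV R n]_(v in box (rV_uncons a).2 (rV_uncons b).2)
       f (rV_cons (y, v)))%E.
Proof.
move=> mf f0.
rewrite (integral12_patch _ _ _ _ (f \o @rV_cons R n)).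
rewrite /= ge0_integral_pushforward//; last 3 first.
- exact: measurable_rV_cons.
- exact: measurable_box.
- exact: measurable_funTS.
rewrite (_ : @rV_cons R n @^-1` box a b = `]a ord0 ord0, b ord0 ord0[ `*`
    box (rV_uncons a).2 (rV_uncons b).2); last first.
  by apply/seteqP; split => -[x v] /= /box_cons.
rewrite integral_mkcond; apply: fubini_tonelli1.
  apply: measurable_patch.
    by apply: measurableX => //; exact: measurable_box.
  by apply: measurableT_comp => //; exact: measurable_rV_cons.
by move=> x; rewrite patchE; case: ifPn => // _; exact: f0.
Qed.

End box.

(** * Translations *)

Section translation_R.
Context {R : realType}.
Local Notation mu := (@lebesgue_measure R).

Lemma periodicZ (T : Type) (f : R -> T) (L : R) :
  (forall x, f (x + L) = f x) -> forall (k : int) x, f (x + k%:~R * L) = f x.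
Proof.
move=> fL; have fn (n : nat) x : f (x + n%:R * L) = f x.
  by elim: n x => [|n IH] x; [rewrite mul0r addr0|rewrite -natr1 mulrDl mul1r addrA fL].
case=> n x; first exact: fn.
by rewrite -[LHS](fn n.+1) NegzE mulrNz -addrA mulNr addNr addr0.
Qed.

(** By uniqueness of Lebesgue measure it is enough to compare lengths of half-open intervals. *)
Lemma lebesgue_measure_shift (s : R) (A : set R) : measurable A ->
  pushforward mu ((fun x => x + s) : _ -> measurableTypeR R) A = mu A.
Proof.
move=> mA; apply/esym/lebesgue_measure_unique => //=.
  exact: measurable_funD.
move=> _ _ [[a b]] _ <-; rewrite /pushforward.
rewrite (_ : _ @^-1` _ = `]a - s, b - s]%classic); last first.
  by apply/seteqP; split => x /=; rewrite !in_itv/=; lra.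
rewrite !lebesgue_measure_itv/= !lte_fin.
by rewrite ltrD2r; case: ifPn => // _; rewrite -!EFinB; congr EFin; lra.
Qed.

Lemma ge0_integral_shift (f : R -> \bar R) (s c d : R) :
  measurable_fun setT f -> (forall x, 0 <= f x)%E ->
  (\int[mu]_(x in `]c, d]) f (x + s)%R = \int[mu]_(x in `](c + s)%R, (d + s)%R]) f x)%E.
Proof.
move=> mf f0.
have ms : measurable_fun setT
    ((fun x : measurableTypeR R => x + s) : _ -> measurableTypeR R).
  exact: measurable_funD.
rewrite (_ : `]c, d]%classic =
  ((fun x => x + s) : _ -> measurableTypeR R) @^-1` `]c + s, d + s]); last first.
  by apply/seteqP; split => x /=; rewrite !in_itv/=; lra.
rewrite -(@ge0_integral_pushforward _ _ (measurableTypeR R) (measurableTypeR R)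
  R _ ms mu `]c + s, d + s]%classic f)//=.
- apply: (@eq_measure_integral _ _ _ _ mu
    (measure_function_pushforward__canonical__measure_function_Measure mu ms)).
  by move=> A mA _; exact: lebesgue_measure_shift.
- exact: measurable_funTS.
Qed.

(** The shift [s] is first reduced modulo the period to [t] in [0, b - a). The window ]a + t, b + t]
    is then ]a + t, b] followed by ]b, b + t], and the second piece is a translate by one period of
    the missing ]a, a + t]. Half-open intervals make the pieces fit together exactly. *)
Lemma ge0_integral_periodic (f : R -> \bar R) (a b s : R) : a < b ->
  measurable_fun setT f -> (forall x, 0 <= f x)%E ->
  (forall x, f (x + (b - a)) = f x) ->
  (\int[mu]_(x in `]a, b[) f (x + s)%R = \int[mu]_(x in `]a, b[) f x)%E.
Proof.
move=> ab mf f0 fL.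
have L0 : 0 < b - a by lra.
pose k := Num.floor (s / (b - a)); pose t := s - k%:~R * (b - a).
have t0 : 0 <= t.
  by rewrite subr_ge0 -ler_pdivlMr// floor_le.
have tL : t < b - a.
  have := floorD1_gt (s / (b - a)); rewrite -/k intrD ltr_pdivrMr// mulrDl.
  by rewrite /t mul1r; lra.
transitivity (\int[mu]_(x in `]a, b[) f (x + t)%R)%E.
  by apply: eq_integral => x _; rewrite -[RHS](periodicZ fL k) -addrA subrK.
rewrite !integral_itv_bndo_bndc; last 2 first.
- exact: measurable_funTS.
- apply: measurable_funTS; apply: (measurableT_comp mf).
  exact: measurable_funD.
rewrite ge0_integral_shift//.
have dj (u v w : R) : [disjoint `]u, v] & `]v, w]]%classic.
  by apply/disj_setPS => x []/=; rewrite !in_itv/=; lra.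
have split u v w : u <= v -> v <= w -> (\int[mu]_(x in `]u, w]) f x =
    \int[mu]_(x in `]u, v]) f x + \int[mu]_(x in `]v, w]) f x)%E.
  move=> uv vw; rewrite -ge0_integral_setU//; last exact: measurable_funTS.
  congr (integral _ _ _); apply/seteqP; split => x /=; rewrite !in_itv/=.
    by case: (leP x v) => xv; [left|right]; lra.
  by case; lra.
rewrite (split (a + t) b); [|lra|lra].
rewrite [RHS](split a (a + t)); [|lra|lra].
rewrite addeC; congr adde.
have -> : `]b, b + t]%classic = `]a + (b - a), a + t + (b - a)]%classic.
  have -> : a + t + (b - a) = b + t by lra.
  by have -> : a + (b - a) = b by lra.
by rewrite -ge0_integral_shift//; apply: eq_integral => x _; exact: fL.
Qed.

End translation_R.

Section translation_rV.
Context {R : realType}.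

Lemma rV_shiftE D (x : 'rV[R]_D) s i j :
  (x + s *: delta_mx ord0 i) ord0 j = x ord0 j + s * (j == i)%:R.
Proof. by rewrite !mxE. Qed.

Lemma rV_cons_shift0 n (y s : R) (v : 'rV[R]_n) :
  rV_cons (y, v) + s *: delta_mx ord0 ord0 = rV_cons (y + s, v).
Proof.
apply/rowP => i; rewrite rV_shiftE; have [j|] := unliftP ord0 i => ->.
  by rewrite !rV_consES mulr0 addr0.
by rewrite !rV_consE0 mulr1.
Qed.

Lemma rV_cons_shiftS n (y s : R) (v : 'rV[R]_n) i :
  rV_cons (y, v) + s *: delta_mx ord0 (lift ord0 i) =
  rV_cons (y, v + s *: delta_mx ord0 i).
Proof.
apply/rowP => j; rewrite rV_shiftE; have [k|] := unliftP ord0 j => ->.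
  by rewrite !rV_consES rV_shiftE (inj_eq lift_inj).
by rewrite !rV_consE0 mulr0 addr0.
Qed.

Lemma measurable_shift2 D i :
  measurable_fun setT (fun p : 'rV[R]_D * measurableTypeR R =>
    p.1 + p.2 *: delta_mx ord0 i).
Proof.
apply: measurable_fun_mxP => k j; under eq_fun do rewrite !mxE.
apply: measurable_funD.
  apply: (@measurableT_comp _ _ _ _ _ _ (fun M : 'rV[R]_D => M k j)) => //.
  exact: measurable_mx_entry.
by apply: measurable_funM.
Qed.

Lemma measurable_shift D i (s : R) :
  measurable_fun setT (fun x : 'rV[R]_D => x + s *: delta_mx ord0 i).
Proof.
apply: (@measurableT_comp _ _ _ _ _ _
  (fun p : 'rV[R]_D * measurableTypeR R => p.1 + p.2 *: delta_mx ord0 i) _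
  (fun x => (x, s))).
  exact: measurable_shift2.
by apply/measurable_fun_pairP; split; [exact: measurable_id|exact: measurable_cst].
Qed.

(** Induction on the dimension. A shift in a later coordinate acts inside the slices, where the
    induction hypothesis applies. A shift in the first coordinate is handled after exchanging the
    integrals, so that the one-dimensional statement applies to the inner one. *)
Lemma integral_rV_translation D (a b : 'rV[R]_D) (f : 'rV[R]_D -> \bar R) i
    (s : R) :
  a ord0 i < b ord0 i ->
  measurable_fun setT f -> (forall x, 0 <= f x)%E ->
  (forall x, f (x + (b ord0 i - a ord0 i) *: delta_mx ord0 i) = f x) ->
  (\int[lebesgue_rV R D]_(x in box a b) f (x + s *: delta_mx ord0 i)%R =
   \int[lebesgue_rV R D]_(x in box a b) f x)%E.
Proof.
elim: D a b f i => [a b f []//|n IH] a b f i.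
move=> ab mf f0 fL.
have mfc : measurable_fun setT (f \o @rV_cons R n).
  by apply: measurableT_comp => //; exact: measurable_rV_cons.
pose fs (x : 'rV[R]_n.+1) := f (x + s *: delta_mx ord0 i).
have mfs : measurable_fun setT fs.
  exact: (measurableT_comp mf (measurable_shift i s)).
have mfsc : measurable_fun setT (fs \o @rV_cons R n).
  by apply: measurableT_comp => //; exact: measurable_rV_cons.
rewrite (integral_rV_cons a b mfs (fun x => f0 _)) (integral_rV_cons a b mf f0).
have [j|] := unliftP ord0 i => ij; rewrite /fs {fs i}ij in ab fL mfs mfsc *.
  apply: eq_integral => y _; under eq_integral do rewrite rV_cons_shiftS.
  rewrite (IH _ _ (fun v => f (rV_cons (y, v))))//.
  - by rewrite !rV_uncons2E.
  - exact: (measurableT_comp mfc (measurable_pair1 y)).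
  - by move=> v; rewrite -[RHS]fL !rV_uncons2E rV_cons_shiftS.
have fub := fubini_tonelli_in lebesgue_measure (lebesgue_rV R n)
  (measurable_itv `]a ord0 ord0, b ord0 ord0[)
  (measurable_box (rV_uncons a).2 (rV_uncons b).2).
rewrite [RHS](fub _ mfc (fun x => f0 _)) [LHS](fub _ mfsc (fun x => f0 _)).
apply: eq_integral => v _; under eq_integral do rewrite /= rV_cons_shift0.
apply: (ge0_integral_periodic _ (f := fun y => f (rV_cons (y, v)))) => //.
- exact: (measurableT_comp mfc (measurable_pair2 v)).
- by move=> y; rewrite -[RHS]fL rV_cons_shift0.
Qed.

End translation_rV.

(** * Smooth functions and integrals over the box *)

Section smooth_functions.
Context {R : realType} {D : nat}.
Implicit Types (f g zeta : 'rV[R]_D -> R) (i j : 'I_D).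

Lemma iter_partial_rcons s i f :
  iter_partial (rcons s i) f = iter_partial s (partial i f).
Proof. by rewrite /iter_partial -cats1 foldr_cat. Qed.

Lemma smooth_continuous f : smooth f -> continuous f.
Proof. by move=> /(_ [::]) []. Qed.

Lemma smooth_derivable f i x : smooth f -> derivable f x (delta_mx ord0 i).
Proof. by move=> /(_ [::]) []. Qed.

Lemma smooth_partial i f : smooth f -> smooth (partial i f).
Proof. by move=> sf s; rewrite -iter_partial_rcons; exact: sf. Qed.

Lemma shift_quotient (v : 'rV[R]_D) f c x :
  (fun h : R => h^-1 *: (((fun y => f (y + c)) \o shift x) (h *: v) - f (x + c))) =
  (fun h : R => h^-1 *: ((f \o shift (x + c)) (h *: v) - f (x + c))).
Proof. by apply/funext => h /=; rewrite addrA. Qed.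

Lemma iter_partial_shift s f c :
  iter_partial s (fun x => f (x + c)) = (fun x => iter_partial s f (x + c)).
Proof.
elim: s => //= i s IH; apply/funext => x.
by rewrite [in LHS]/partial IH /derive shift_quotient.
Qed.

Lemma smooth_shift c f : smooth f -> smooth (fun x => f (x + c)).
Proof.
move=> sf s; rewrite iter_partial_shift; have [cf df] := sf s.
split=> [x|i x].
  apply: (@continuous_comp 'rV[R]_D 'rV[R]_D R (fun y => y + c) (iter_partial s f) x);
    last exact: cf.
  by apply: (@continuousD _ 'rV[R]_D _ id (cst c)); [exact: cvg_id|exact: cst_continuous].
by rewrite /derivable shift_quotient; exact: df.
Qed.

Lemma partial_shift i f c :
  partial i (fun x => f (x + c)) = (fun x => partial i f (x + c)).
Proof. exact: (iter_partial_shift [:: i]). Qed.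

Lemma is_derive_coord (phi : R -> R) (dphi : R) i j (x : 'rV[R]_D) :
  is_derive (x ord0 j) 1 phi dphi ->
  is_derive x (delta_mx ord0 i) (fun y => phi (y ord0 j)) (dphi * (j == i)%:R).
Proof.
move=> [dp vp].
have E : (fun h : R => h^-1 *:
     (((fun y : 'rV[R]_D => phi (y ord0 j)) \o shift x) (h *: delta_mx ord0 i) -
       phi (x ord0 j))) =
    (fun h : R => h^-1 *: ((phi \o shift (x ord0 j)) (h *: ((j == i)%:R : R)) -
       phi (x ord0 j))).
  by apply/funext => h /=; rewrite (addrC (h *: _)) rV_shiftE (addrC (h *: _)).
have [ij|ij] := eqVneq j i; rewrite ?mulr1 ?mulr0; last first.
  have E0 : (fun h : R => h^-1 *:
     (((fun y : 'rV[R]_D => phi (y ord0 j)) \o shift x) (h *: delta_mx ord0 i) -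
       phi (x ord0 j))) = cst 0.
    rewrite E (negbTE ij); apply/funext => h /=.
    by rewrite scaler0 add0r subrr scaler0.
  split; first by rewrite /derivable E0; exact: is_cvg_cst.
  by rewrite /derive E0; exact: lim_cst.
move: dp vp E; rewrite ij eqxx mulr1n => dp vp E.
by split; [rewrite /derivable E|rewrite /derive E]; [exact: dp|exact: vp].
Qed.

(* Closure of the smooth functions and the functions [cos (w x_i + c)] under
   the ring operations: a class stable under partial derivatives. *)
Inductive smooth_ring : ('rV[R]_D -> R) -> Prop :=
| smooth_ring_smooth f : smooth f -> smooth_ring f
| smooth_ring_cst c : smooth_ring (cst c)
| smooth_ring_cos w c i : smooth_ring (fun x => cos (w * x ord0 i + c))
| smooth_ring_add f g : smooth_ring f -> smooth_ring g -> smooth_ring (f + g)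
| smooth_ring_mul f g : smooth_ring f -> smooth_ring g -> smooth_ring (f * g).

(** Writing - sin as a cosine of shifted phase keeps the derivative within the generators of
    [smooth_ring], so no separate sine generator is needed. *)
Lemma is_derive_cos_affine w c i j (x : 'rV[R]_D) :
  is_derive x (delta_mx ord0 i) (fun y => cos (w * y ord0 j + c))
    (w * (j == i)%:R * cos (w * x ord0 j + (c + pi / 2))).
Proof.
apply: (is_derive_eq (f' := (- sin (w * x ord0 j + c) * w) * (j == i)%:R)).
  apply: (@is_derive_coord (fun r => cos (w * r + c))).
  apply: (@is_derive1_comp _ cos (fun r => w * r + c)).
  apply: (is_derive_eq (is_deriveD (is_deriveZ w (is_derive_id (x ord0 j) (1 : R)))
    (is_derive_cst c (x ord0 j) (1 : R)))).
  by rewrite addr0 [LHS]mulr1.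
by rewrite addrA cosDpihalf; ring.
Qed.

Lemma smooth_ring_step f : smooth_ring f -> continuous f /\
  forall i, (forall x, derivable f x (delta_mx ord0 i)) /\
    smooth_ring (partial i f).
Proof.
elim => {f} [f sf|c|w c j|f g rf [cf df] rg [cg dg]|f g rf [cf df] rg [cg dg]].
- split; first exact: smooth_continuous.
  move=> i; split; first by move=> x; exact: smooth_derivable.
  exact/smooth_ring_smooth/smooth_partial.
- split; first exact: cst_continuous.
  move=> i; split; first by move=> x; exact: derivable_cst.
  rewrite (_ : partial i _ = cst 0); first exact: smooth_ring_cst.
  by apply/funext => x; rewrite /partial derive_cst.
- split.
    move=> x; apply: (@continuous_comp _ _ _ (fun y : 'rV[R]_D => w * y ord0 j + c) cos).
      apply: (@continuousD _ R^o _ (fun y : 'rV[R]_D => w * y ord0 j) (cst c));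
        last exact: cst_continuous.
      apply: (@continuousM _ _ (cst w) (fun y : 'rV[R]_D => y ord0 j));
        [exact: cst_continuous|exact: coord_continuous].
    exact: continuous_cos.
  move=> i; split=> [x|].
    by have [] := is_derive_cos_affine w c i j x.
  rewrite (_ : partial i _ =
      cst (w * (j == i)%:R) * (fun x => cos (w * x ord0 j + (c + pi / 2)))).
    by apply: smooth_ring_mul; [exact: smooth_ring_cst|exact: smooth_ring_cos].
  by apply/funext => x; have [_] := is_derive_cos_affine w c i j x.
- split; first by move=> x; apply: (@continuousD _ R^o _ f g x); [exact: cf|exact: cg].
  move=> i; split=> [x|].
    by apply: derivableD; [exact: (df i).1|exact: (dg i).1].
  rewrite (_ : partial i _ = partial i f + partial i g).
    by apply: smooth_ring_add; [exact: (df i).2|exact: (dg i).2].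
  by apply/funext => x; apply: deriveD; [exact: (df i).1|exact: (dg i).1].
- split; first by move=> x; apply: (@continuousM _ _ f g x); [exact: cf|exact: cg].
  move=> i; split=> [x|].
    by apply: derivableM; [exact: (df i).1|exact: (dg i).1].
  rewrite (_ : partial i _ = f * partial i g + g * partial i f).
    apply: smooth_ring_add; apply: smooth_ring_mul => //; first exact: (dg i).2.
    exact: (df i).2.
  by apply/funext => x; apply: deriveM; [exact: (df i).1|exact: (dg i).1].
Qed.

(** [iter_partial] applies the last index of the list first. The induction therefore removes indices
    from the right end and passes to [partial i f], which is again in the class. *)
Lemma smooth_ringP f : smooth_ring f -> smooth f.
Proof.
move=> rf s; elim/last_ind: s f rf => [|s i IH] f rf.
  by have [cf df] := smooth_ring_step rf; split=> // i x; exact: (df i).1.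
by rewrite iter_partial_rcons; apply: IH; have [_ /(_ i)[]] := smooth_ring_step rf.
Qed.

Lemma smoothM f g : smooth f -> smooth g -> smooth (fun x => f x * g x).
Proof.
by move=> sf sg; apply: smooth_ringP; apply: smooth_ring_mul;
  exact: smooth_ring_smooth.
Qed.

Lemma partialM i f g : smooth f -> smooth g ->
  partial i (fun x => f x * g x) = (fun x => f x * partial i g x + partial i f x * g x).
Proof.
move=> sf sg; apply/funext => x; rewrite [RHS]addrC [_ * g x]mulrC addrC.
by apply: deriveM; exact: smooth_derivable.
Qed.

End smooth_functions.

(** * Measurability and boundedness of continuous functions of a row vector *)

Section continuous_rV.
Context {R : realType} {D : nat}.

Let grid (n : nat) (k : 'rV[int]_D) : 'rV[R]_D := \row_i ((k ord0 i)%:~R / n.+1%:R).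
Let cell (n : nat) (x : 'rV[R]_D) : 'rV[int]_D :=
  \row_i Num.floor (x ord0 i * n.+1%:R).

Let measurable_cell n k : measurable (cell n @^-1` [set k]).
Proof.
rewrite (_ : _ @^-1` _ = \bigcap_(i in [set: 'I_D])
    ((fun x : 'rV[R]_D => x ord0 i) @^-1`
      `[(k ord0 i)%:~R / n.+1%:R, (k ord0 i + 1)%:~R / n.+1%:R[)).
  apply: fin_bigcap_measurable; first exact: finite_finset.
  move=> i _; rewrite -[X in measurable X]setTI.
  exact: measurable_mx_entry.
apply/seteqP; split => x /=.
  move=> xk i _ /=; rewrite in_itv/= -xk mxE.
  by rewrite ler_pdivrMr// ltr_pdivlMr// floor_le floorD1_gt.
move=> xk; apply/rowP => i; rewrite mxE; apply: floor_def.
have := xk i I; rewrite /= in_itv/=.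
by rewrite ler_pdivrMr// ltr_pdivlMr.
Qed.

Let grid_cell_cvg x : grid n (cell n x) @[n --> \oo] --> x.
Proof.
apply/cvg_ballP => e e0; have := near_infty_natSinv_lt (PosNum e0).
apply: filterS => n /= ne; split=> // i j; rewrite ord1 /ball/= !mxE.
have n0 : 0 < n.+1%:R :> R by [].
have f1 := floor_le (x ord0 j * n.+1%:R).
have f2 := floorD1_gt (x ord0 j * n.+1%:R).
rewrite intrD in f2; apply: le_lt_trans ne.
set k := (Num.floor _)%:~R in f1 f2 *.
have -> : x ord0 j - k / n.+1%:R = (x ord0 j * n.+1%:R - k) / n.+1%:R.
  by rewrite mulrBl mulfK ?lt0r_neq0.
rewrite normrM [X in _ * X]gtr0_norm ?invr_gt0// ler_piMl ?invr_ge0//.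
by rewrite ger0_norm; lra.
Qed.

(** The sigma-algebra on row vectors is generated by the coordinates rather than by the open sets.
    So [f] is written as the limit of its values at the lower corners of the cells of a grid of mesh
    1/(n+1); these approximations are constant on countably many measurable cells. *)
Lemma continuous_rV_measurable (f : 'rV[R]_D -> R) :
  continuous f -> measurable_fun setT f.
Proof.
move=> cf; apply: (measurable_fun_cvg (h := fun n x => f (grid n (cell n x)))).
  move=> n _ B mB; rewrite setTI.
  rewrite (_ : _ @^-1` _ =
    \bigcup_k (cell n @^-1` [set k] `&` [set _ | B (f (grid n k))])).
    apply: countable_bigcupT_measurable; first exact: countableP.
    move=> k; case: (pselect (B (f (grid n k)))) => Bk.
      rewrite (_ : [set _ : 'rV[R]_D | B _] = setT); last by apply/seteqP; split.
      by rewrite setIT; exact: measurable_cell.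
    rewrite (_ : [set _ : 'rV[R]_D | B _] = set0); last by apply/seteqP; split.
    by rewrite setI0.
  apply/seteqP; split => x /=; first by move=> Bx; exists (cell n x).
  by move=> [k _ [<-]].
by move=> x _; apply: continuous_cvg; [exact: cf|exact: grid_cell_cvg].
Qed.

Lemma continuous_bounded_box (a b : 'rV[R]_D) (f : 'rV[R]_D -> R) :
  continuous f -> exists M, forall x, box a b x -> `|f x| <= M.
Proof.
move=> cf.
pose K := [set v : 'rV[R]_D | forall i, `[a ord0 i, b ord0 i]%classic (v ord0 i)].
have cK : compact K.
  apply: (@rV_compact R D (fun i => `[a ord0 i, b ord0 i]%classic)) => i.
  exact: segment_compact.
have /compact_bounded[M [_ HM]] : compact (f @` K).
  by apply: continuous_compact => //; exact: continuous_subspaceT.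
exists (M + 1) => x Bx; apply: (HM (M + 1)); first by rewrite ltrDl.
by exists x => // i; apply: subset_itv_oo_cc; exact: Bx.
Qed.

End continuous_rV.

(** * Calculus of integrals over the box *)

Section box_integrals.
Context {R : realType} {D : nat}.
Variables (a b : 'rV[R]_D).
Implicit Types (f g : 'rV[R]_D -> R).
Local Notation mu := (lebesgue_rV R D).
Local Notation I f := (\int[mu]_(x in box a b) f x).

Lemma box_integrableD f g : box_integrable a b f -> box_integrable a b g ->
  box_integrable a b (fun x => f x + g x).
Proof. exact: (integrableD (measurable_box a b)). Qed.

Lemma box_integrableB f g : box_integrable a b f -> box_integrable a b g ->
  box_integrable a b (fun x => f x - g x).
Proof. exact: (integrableB (measurable_box a b)). Qed.

Lemma box_integrableZ c f : box_integrable a b f ->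
  box_integrable a b (fun x => c * f x).
Proof. exact: (integrableZl (measurable_box a b) c). Qed.

Lemma box_integrable0 : box_integrable a b (fun=> 0).
Proof. exact: integrable0. Qed.

Lemma box_integrable_sum n (F : 'I_n -> 'rV[R]_D -> R) :
  (forall i, box_integrable a b (F i)) ->
  box_integrable a b (fun x => \sum_(i < n) F i x).
Proof.
move=> iF; rewrite (_ : (fun x => _) = \sum_(i < n) F i); last first.
  by apply/funext => x; rewrite fct_sumE.
elim/big_ind: _ => //; first exact: box_integrable0.
by move=> f g; exact: box_integrableD.
Qed.

Lemma le_box_integrable f g : measurable_fun setT f -> box_integrable a b g ->
  (forall x, box a b x -> `|f x| <= g x) -> box_integrable a b f.
Proof.
move=> mf ig fg; apply: le_integrable ig; first exact: measurable_box.
  by apply/measurable_EFinP; exact: measurable_funTS.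
by move=> x Bx; rewrite /= lee_fin (le_trans (fg x Bx))// ler_norm.
Qed.

Lemma box_integrable_norm f : box_integrable a b f ->
  box_integrable a b (fun x => `|f x|).
Proof. exact: integrable_norm. Qed.

Lemma box_integrable_cst c : (forall i, a ord0 i < b ord0 i) ->
  box_integrable a b (fun=> c).
Proof.
move=> ab; apply/integrableP; split; first exact: measurable_cst.
rewrite [ltLHS](_ : _ = `|c|%:E * mu (box a b))%E; last first.
  by rewrite -integral_cst//; exact: measurable_box.
by rewrite lebesgue_rV_box// -EFinM ltry.
Qed.

Lemma box_integrableM_bounded f g M : measurable_fun setT f ->
  measurable_fun setT g -> box_integrable a b f ->
  (forall x, box a b x -> `|g x| <= M) ->
  box_integrable a b (fun x => f x * g x).
Proof.
move=> mf mg jf gM.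
apply: (@le_box_integrable _ (fun x => M * `|f x|)).
- exact: measurable_funM.
- exact/box_integrableZ/box_integrable_norm.
- by move=> x Bx; rewrite normrM mulrC ler_wpM2r// gM.
Qed.

Lemma RintegralD_box f g : box_integrable a b f -> box_integrable a b g ->
  I (fun x => f x + g x) = I f + I g.
Proof. exact: (RintegralD (measurable_box a b)). Qed.

Lemma RintegralB_box f g : box_integrable a b f -> box_integrable a b g ->
  I (fun x => f x - g x) = I f - I g.
Proof. exact: (RintegralB (measurable_box a b)). Qed.

Lemma RintegralZ_box c f : box_integrable a b f ->
  I (fun x => c * f x) = c * I f.
Proof. exact: (RintegralZl c (measurable_box a b)). Qed.

Lemma Rintegral_sum_box n (F : 'I_n -> 'rV[R]_D -> R) :
  (forall i, box_integrable a b (F i)) ->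
  I (fun x => \sum_(i < n) F i x) = \sum_(i < n) I (F i).
Proof.
elim: n F => [|n IH] F iF.
  under eq_Rintegral do rewrite big_ord0.
  rewrite big_ord0 (Rintegral_cst _ (measurable_box a b)) mul0r//.
under eq_Rintegral do rewrite big_ord_recl.
rewrite big_ord_recl -IH; last by move=> i; exact: iF.
by rewrite RintegralD_box//; apply: box_integrable_sum => i; exact: iF.
Qed.

Lemma EFin_Rintegral_box f : box_integrable a b f ->
  (I f)%:E = (\int[mu]_(x in box a b) (f x)%:E)%E.
Proof.
move=> jf; rewrite /Rintegral fineK//.
exact: (integrable_fin_num (measurable_box a b)).
Qed.

Lemma Rintegral_dominated0 (F : nat -> 'rV[R]_D -> R) f g :
  (forall n, measurable_fun setT (F n)) -> measurable_fun setT f ->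
  box_integrable a b g ->
  (forall n x, box a b x -> `|F n x| <= g x) ->
  (forall x, box a b x -> F n x @[n --> \oo] --> f x) ->
  (forall n, I (F n) = 0) -> box_integrable a b f /\ I f = 0.
Proof.
move=> mF mf ig Fg Ff F0.
have iF n : box_integrable a b (F n).
  by apply: (le_box_integrable (mF n) ig) => x; exact: Fg.
have [|||||jf _ cf] := @dominated_convergence _ _ _ mu _ (measurable_box a b)
  (fun n => EFin \o F n) (EFin \o f) (EFin \o g).
- by move=> n; apply/measurable_EFinP; exact: measurable_funTS.
- by apply/measurable_EFinP; exact: measurable_funTS.
- apply/aeW => x Bx; apply: cvg_EFin; first exact: nearW.
  exact: Ff.
- exact: ig.
- by apply/aeW => x n Bx; rewrite /= lee_fin; exact: Fg.
split=> //; apply: EFin_inj; rewrite EFin_Rintegral_box//.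
apply: (cvg_unique (@ereal_hausdorff R) cf).
rewrite (_ : (fun n => _) = cst 0%E); first exact: cvg_cst.
by apply/funext => n /=; rewrite -EFin_Rintegral_box// F0.
Qed.

End box_integrals.

(** * Smooth periodic functions separate integrable functions *)

Section sign_iteration.
Context {R : realType}.

(* Polynomial whose iterates converge pointwise to the sign on [-1, 1]. *)
Definition sign_step (y : R) := (3 * y - y ^+ 3) / 2.

Lemma sign_stepN y : sign_step (- y) = - sign_step y.
Proof. by rewrite /sign_step; field. Qed.

Lemma iter_sign_stepN n y : iter n sign_step (- y) = - iter n sign_step y.
Proof. by elim: n => //= n ->; rewrite sign_stepN. Qed.

Lemma iter_sign_step_bound n y : 0 <= y <= 1 ->
  y <= iter n sign_step y <= 1 /\
  1 - iter n sign_step y <= (1 - y / 2) ^+ n.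
Proof.
move=> y01; elim: n => [|n [IHy IHn]] /=; first by rewrite expr0; lra.
set z := iter n sign_step y in IHy IHn *.
have E : 1 - sign_step z = (1 - z) * (1 - (z + z ^+ 2) / 2).
  by rewrite /sign_step; field.
have z0 : 0 <= z by lra.
have zz : z ^+ 2 <= z by rewrite expr2; nra.
split.
  apply/andP; split; last first.
    rewrite -subr_ge0 E; apply: mulr_ge0; [|]; lra.
  apply: (@le_trans _ _ z); first by lra.
  rewrite -subr_ge0 (_ : sign_step z - z = z * (1 - z ^+ 2) / 2).
    by apply: divr_ge0 => //; apply: mulr_ge0 => //; lra.
  by rewrite /sign_step; field.
rewrite E [(1 - y / 2) ^+ _]exprSr; apply: ler_pM => //; have : 0 <= z ^+ 2 by rewrite sqr_ge0.
- by lra.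
- by lra.
- by lra.
Qed.

Lemma iter_sign_step_norm n y : `|y| <= 1 -> `|iter n sign_step y| <= 1.
Proof.
have pos z : 0 <= z <= 1 -> `|iter n sign_step z| <= 1.
  by move=> z01; have [? _] := iter_sign_step_bound n z01; rewrite ger0_norm; lra.
move=> /ler_normlP[y1 y2]; have [y0|y0] := leP 0 y; first by apply: pos; lra.
by rewrite -[y]opprK iter_sign_stepN normrN; apply: pos; lra.
Qed.

Lemma iter_sign_step_cvg y : `|y| <= 1 -> iter n sign_step y @[n --> \oo] --> Num.sg y.
Proof.
have pos z : 0 < z <= 1 -> iter n sign_step z @[n --> \oo] --> (1 : R).
  move=> z01; apply/cvgrPdist_le => e e0.
  have /cvgrPdist_le/(_ e e0) : (1 - z / 2) ^+ n @[n --> \oo] --> (0 : R).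
    by apply: cvg_expr; rewrite ger0_norm; lra.
  apply: filterS => n; rewrite sub0r normrN ger0_norm; last first.
    by apply: exprn_ge0; lra.
  have z01' : 0 <= z <= 1 by lra.
  move=> ne; have [u1 u2] := iter_sign_step_bound n z01'.
  by rewrite ger0_norm; lra.
move=> /ler_normlP[y1 y2]; have [y0|y0|<-] := ltgtP 0 y.
- by rewrite gtr0_sg//; apply: pos; lra.
- rewrite ltr0_sg//; rewrite (_ : (fun n => _) = (fun n => - iter n sign_step (- y))).
    by apply: cvgN; apply: pos; lra.
  by apply/funext => n; rewrite iter_sign_stepN opprK.
- rewrite sgr0 (_ : (fun n => _) = cst 0); first exact: cvg_cst.
  by apply/funext; elim=> //= n ->; rewrite /sign_step mulr0 expr0n subr0 mul0r.
Qed.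

End sign_iteration.

Section uniqueness.
Context {R : realType} {D : nat}.
Variables (a b : 'rV[R]_D).
Hypothesis ab : forall i, a ord0 i < b ord0 i.
Implicit Types (f g h zeta : 'rV[R]_D -> R) (A : set 'rV[R]_D).
Local Notation mu := (lebesgue_rV R D).
Local Notation I f := (\int[mu]_(x in box a b) f x).

Definition annihilates_smooth h := [/\ measurable_fun setT h,
  box_integrable a b h &
  forall zeta, smooth zeta -> box_periodic a b zeta -> I (fun x => h x * zeta x) = 0].

(** The sets whose indicators may be absorbed by annihilators. Quantifying over all annihilators [h]
    makes closure under intersection immediate: the two indicators are absorbed one after the other.
    These sets form a sigma-algebra, so half-spaces suffice. *)
Let stable A := measurable A /\
  forall h, annihilates_smooth h -> annihilates_smooth (fun x => h x * \1_A x).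

Lemma smooth_bounded zeta : smooth zeta ->
  measurable_fun setT zeta /\ exists M, forall x, box a b x -> `|zeta x| <= M.
Proof.
move=> sz; have cz := smooth_continuous sz.
by split; [exact: continuous_rV_measurable|exact: continuous_bounded_box].
Qed.

(** Dominated convergence: a smooth [zeta] is bounded by some M on the box, and the multipliers by
    1, so M |h| is a majorant. *)
Let annihilates_smooth_cvg h (F : nat -> 'rV[R]_D -> R) f :
  annihilates_smooth h ->
  (forall n, measurable_fun setT (F n)) -> measurable_fun setT f ->
  (forall n x, `|F n x| <= 1) ->
  (forall x, box a b x -> F n x @[n --> \oo] --> f x) ->
  (forall n, annihilates_smooth (fun x => h x * F n x)) ->
  annihilates_smooth (fun x => h x * f x).
Proof.
move=> [mh ih h0] mF mf F1 Ff hF.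
have H zeta : smooth zeta -> box_periodic a b zeta ->
    box_integrable a b (fun x => h x * f x * zeta x) /\
    I (fun x => h x * f x * zeta x) = 0.
  move=> sz pz; have [mz [M zM]] := smooth_bounded sz.
  apply: (@Rintegral_dominated0 _ _ a b (fun n x => h x * F n x * zeta x) _
    (fun x => M * `|h x|)).
  - by move=> n; do 2 apply: measurable_funM => //.
  - by do 2 apply: measurable_funM => //.
  - exact/box_integrableZ/box_integrable_norm.
  - move=> n x Bx; rewrite !normrM mulrC ler_pM//; first exact: zM.
    by rewrite ler_piMr.
  - move=> x Bx; apply: cvgMl; apply: cvgMr; exact: Ff.
  - by move=> n; have [_ _] := hF n; exact.
split; first exact: measurable_funM.
  (* Integrability without a test function is the case of the constant test function 1. *)
  have [||+ _] := H (cst 1).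
  - exact/smooth_ringP/smooth_ring_cst.
  - by [].
  by congr (box_integrable a b _); apply/funext => x; rewrite mulr1.
by move=> zeta sz pz; exact: (H _ sz pz).2.
Qed.

Let annihilates_smoothM h g : smooth g -> box_periodic a b g ->
  annihilates_smooth h -> annihilates_smooth (fun x => h x * g x).
Proof.
move=> sg pg [mh ih h0]; have [mg [M gM]] := smooth_bounded sg.
split; first exact: measurable_funM.
  exact: (box_integrableM_bounded mh mg ih gM).
move=> zeta sz pz; under eq_Rintegral do rewrite -mulrA.
apply: (h0 (fun x => g x * zeta x)); first exact: smoothM.
by move=> i x; rewrite pg pz.
Qed.

Let annihilates_smoothB h g : annihilates_smooth h -> annihilates_smooth g ->
  annihilates_smooth (fun x => h x - g x).
Proof.
move=> [mh ih h0] [mg ig g0]; split; first exact: measurable_funB.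
  exact: box_integrableB.
move=> zeta sz pz; have [mz [M zM]] := smooth_bounded sz.
under eq_Rintegral do rewrite mulrBl.
rewrite RintegralB_box ?h0 ?g0 ?subrr//.
- exact: (box_integrableM_bounded mh mz ih zM).
- exact: (box_integrableM_bounded mg mz ig zM).
Qed.

Let eq_annihilates_smooth h g : (forall x, h x = g x) ->
  annihilates_smooth h -> annihilates_smooth g.
Proof. by move=> /funext ->. Qed.

(** All integrals are over the box, so only the trace of the set there matters. This allows
    replacing a half-space by a periodic set that coincides with it inside the box. *)
Let stable_eq_box A B : measurable B -> A `&` box a b = B `&` box a b ->
  stable A -> stable B.
Proof.
move=> mB AB [mA sA]; split=> // h ah; have [mh ih h0] := ah.
have E x : x \in box a b -> h x * \1_A x = h x * \1_B x.
  move=> Bx; rewrite !indicE; congr (_ * _%:R); congr nat_of_bool.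
  have : (x \in A `&` box a b) = (x \in B `&` box a b) by rewrite AB.
  by rewrite !in_setI Bx !andbT.
have [mhA ihA hA0] := sA h ah; split.
- by apply: measurable_funM => //; exact: measurable_indic.
- apply: (eq_integrable (measurable_box a b)) ihA.
  by move=> x Bx /=; rewrite E.
- move=> zeta sz pz; rewrite -[RHS](hA0 zeta sz pz).
  by apply: eq_Rintegral => x Bx; rewrite E.
Qed.

Let stableC A : stable A -> stable (~` A).
Proof.
move=> [mA sA]; split; first exact: measurableC.
move=> h ah; apply: (eq_annihilates_smooth _ (annihilates_smoothB ah (sA h ah))).
by move=> x; rewrite !indicE in_setC; case: (x \in A); rewrite /= ?mulr0 ?mulr1 ?subr0 ?subrr.
Qed.

Let stableI A B : stable A -> stable B -> stable (A `&` B).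
Proof.
move=> [mA sA] [mB sB]; split; first exact: measurableI.
move=> h ah; apply: (eq_annihilates_smooth _ (sB _ (sA h ah))) => x.
by rewrite -mulrA; congr (_ * _); rewrite indicI.
Qed.

Let stableU A B : stable A -> stable B -> stable (A `|` B).
Proof.
move=> sA sB; rewrite -[_ `|` _]setCK setCU.
by apply: stableC; apply: stableI; exact: stableC.
Qed.

Let stable0 : stable set0.
Proof.
split=> // h [mh ih h0].
apply: (@eq_annihilates_smooth (fun=> 0)).
  by move=> x; rewrite indic0 mulr0.
split; [exact: measurable_cst|exact: box_integrable0|].
move=> zeta _ _; under eq_Rintegral do rewrite mul0r.
by rewrite (Rintegral_cst _ (measurable_box a b)) mul0r.
Qed.

Let stable_bigcup (F : nat -> set 'rV[R]_D) : (forall n, stable (F n)) ->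
  stable (\bigcup_n F n).
Proof.
move=> sF; have mF : measurable (\bigcup_n F n).
  by apply: bigcupT_measurable => n; have [] := sF n.
pose G n := \big[setU/set0]_(k < n) F k.
have sG n : stable (G n).
  by rewrite /G; elim/big_ind: _ => //; exact: stableU.
split=> // h ah; apply: (annihilates_smooth_cvg (F := fun n => \1_(G n))).
- exact: ah.
- by move=> n; apply: measurable_indic; have [] := sG n.
- exact: measurable_indic.
- by move=> n x; rewrite indicE; case: (_ \in _); rewrite ?normr1 ?normr0.
- move=> x _; have [[k _ Fkx]|nF] := pselect ((\bigcup_n F n) x).
    apply: cvg_near_cst; exists k.+1 => // n /= kn.
    rewrite !indicE /G -bigcup_mkord.
    by rewrite (mem_set (A := \bigcup_(i < n) F i)) ?mem_set//; exists k.
  rewrite (_ : (fun n => _) = cst (\1_(\bigcup_n F n) x)); first exact: cvg_cst.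
  apply/funext => n /=; rewrite !indicE memNset ?memNset//.
  rewrite /G -bigcup_mkord => -[k _ Fkx]; apply: nF; exists k => //.
- by move=> n; have [_] := sG n; exact.
Qed.

(** The frequency for which one oscillation of the cosine in coordinate [i] is one side of the
    box. *)
Let w i := 2 * pi / (b ord0 i - a ord0 i).

Let box_periodic_cos i c (phi : R -> R) :
  box_periodic a b (fun x => phi (cos (w i * x ord0 i + c))).
Proof.
move=> j x; rewrite rV_shiftE; congr phi.
have [<-|ij] := eqVneq i j; last by rewrite mulr0 addr0.
have L0 : b ord0 i - a ord0 i != 0 by rewrite subr_eq0 gt_eqF.
rewrite (_ : _ + c = w i * x ord0 i + c + pi *+ 2); first exact: cosD2pi.
by rewrite /w mulr1 mulr2n; field.
Qed.

(** Iterating the polynomial [sign_step] on the cosine gives smooth periodic functions bounded by 1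
    that converge everywhere to its sign. *)
Let stable_halfspace_cos i c : stable [set x : 'rV[R]_D | 0 < cos (w i * x ord0 i + c)].
Proof.
pose u n (x : 'rV[R]_D) := iter n sign_step (cos (w i * x ord0 i + c)).
have su n : smooth (u n).
  apply: smooth_ringP; elim: n => [|n IH]; first exact: smooth_ring_cos.
  rewrite (_ : u n.+1 = cst (3 / 2) * u n + cst (- (1 / 2)) * (u n * (u n * u n))).
    apply: smooth_ring_add; apply: smooth_ring_mul; try exact: smooth_ring_cst.
      exact: IH.
    by do 2 apply: smooth_ring_mul => //.
  apply/funext => x; rewrite /u /= /sign_step !fctE.
  by field.
have pu n : box_periodic a b (u n) by exact: (box_periodic_cos i c (iter n sign_step)).
(* The polynomial u (1 + u) / 2 sends the limits 1, 0, -1 to 1, 0, 0. It therefore gives the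
   indicator exactly, also where the cosine vanishes, and it stays in [-1, 1]. *)
pose F n x := u n x * (2^-1 * (1 + u n x)).
have sF n : smooth (F n).
  apply: smoothM; first exact: su.
  apply: smooth_ringP; apply: (smooth_ring_mul (smooth_ring_cst 2^-1)).
  apply: (smooth_ring_add (smooth_ring_cst 1)); exact/smooth_ring_smooth/su.
have pF n : box_periodic a b (F n) by move=> j x; rewrite /F pu.
have u1 n x : `|u n x| <= 1.
  by apply: iter_sign_step_norm; rewrite ler_norml cos_geN1 cos_le1.
set H := [set x | _].
have mH : measurable H.
  have mc : measurable_fun setT (u 0%N).
    by apply: continuous_rV_measurable; apply: smooth_continuous; exact: su.
  rewrite (_ : H = u 0%N @^-1` `]0, +oo[); last first.
    by apply/seteqP; split => x /=; rewrite in_itv/= andbT.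
  by rewrite -[X in measurable X]setTI; exact: mc.
split=> // h ah; apply: (annihilates_smooth_cvg (F := F)).
- exact: ah.
- by move=> n; have [] := smooth_bounded (sF n).
- exact: measurable_indic.
- move=> n x; have := u1 n x; rewrite /F !ler_norml => /andP[u2 u3].
  by apply/andP; split; nra.
- move=> x _.
  have c1 : `|cos (w i * x ord0 i + c)| <= 1 by rewrite ler_norml cos_geN1 cos_le1.
  have cu := iter_sign_step_cvg c1.
  rewrite (_ : \1_H x = Num.sg (cos (w i * x ord0 i + c)) *
      (2^-1 * (1 + Num.sg (cos (w i * x ord0 i + c))))).
    apply: cvgM; first exact: cu.
    apply: cvgMr; apply: cvgD; first exact: cvg_cst.
    exact: cu.
  rewrite indicE /H; case: sgrP => [c0|c0|c0].
  + by rewrite memNset ?mul0r//= c0 ltxx.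
  + by rewrite mem_set//=; field.
  + by rewrite memNset ?subrr ?mulr0//= lt_gtF.
- by move=> n; exact: annihilates_smoothM.
Qed.

Let sin_gt0_itv (t : R) : - pi < t < pi -> (0 < sin t) = (0 < t).
Proof.
move=> tpi; have [t0|t0] := ltP 0 t; first by apply: sin_gt0_pi; lra.
apply/negbTE; rewrite -leNgt -oppr_ge0 -sinN.
have [->|tn0] := eqVneq t 0; first by rewrite oppr0 sin0.
by apply/ltW/sin_gt0_pi; move: t0; rewrite le_eqVlt (negbTE tn0)/=; lra.
Qed.

Let measurable_halfspace i d : measurable [set x : 'rV[R]_D | d < x ord0 i].
Proof.
rewrite (_ : [set _ | _] = (fun x : 'rV[R]_D => x ord0 i) @^-1` `]d, +oo[).
  by rewrite -[X in measurable X]setTI; exact: measurable_mx_entry.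
by apply/seteqP; split => x /=; rewrite in_itv/= andbT.
Qed.

(** The periodic set [S c], where sin (w (x_i - c)) is positive, agrees with the half-space x_i > c
    only within half a side of c. For the midpoint [m] this covers the box. For another level [d]
    inside, the half-space beyond [m] corrects the error: it is intersected with [S d] if [d] is at
    least [m], and joined to it otherwise. *)
Let stable_halfspace i d : stable [set x : 'rV[R]_D | d < x ord0 i].
Proof.
have [da|ad] := leP d (a ord0 i).
  apply: (@stable_eq_box setT) => //; last by rewrite -setC0; exact: stableC.
  apply/seteqP; split => x [] //= _ Bx; split=> //.
  by have := Bx i; rewrite in_itv/=; lra.
have [bd|db] := leP (b ord0 i) d.
  apply: (@stable_eq_box set0) => //.
  apply/seteqP; split => x [] //= xd Bx.
  by have := Bx i; rewrite in_itv/=; lra.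
pose m := (a ord0 i + b ord0 i) / 2.
have p0 := pi_gt0 R; have abi := ab i.
pose S c := [set x : 'rV[R]_D | 0 < cos (w i * x ord0 i + (- (w i * c) - pi / 2))].
have S_E c (x : 'rV[R]_D) : `|x ord0 i - c| < (b ord0 i - a ord0 i) / 2 ->
    S c x <-> c < x ord0 i.
  move=> /ltr_normlP[xc1 xc2]; rewrite /S/= addrA cosBpihalf -mulrBr.
  have w0 : 0 < w i by rewrite /w divr_gt0 ?mulr_gt0// subr_gt0.
  have wE : w i * ((b ord0 i - a ord0 i) / 2) = pi.
    by rewrite /w; field; rewrite subr_eq0 gt_eqF.
  have tpi : - pi < w i * (x ord0 i - c) < pi.
    by rewrite -wE -mulrN !ltr_pM2l//; lra.
  by rewrite (sin_gt0_itv tpi) pmulr_rgt0// subr_gt0.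
have sS c : stable (S c) by exact: stable_halfspace_cos.
have Bi (x : 'rV[R]_D) : box a b x -> a ord0 i < x ord0 i < b ord0 i.
  by move=> /(_ i); rewrite in_itv.
have sm : stable [set x : 'rV[R]_D | m < x ord0 i].
  apply: (@stable_eq_box (S m)) => //.
  apply/seteqP; split => x [] /= xS Bx; split=> //; move: xS; have := Bi x Bx => xi;
    by (apply S_E; rewrite ltr_norml /m; lra).
have [md|dm] := leP m d.
- apply: (@stable_eq_box ([set x : 'rV[R]_D | m < x ord0 i] `&` S d)) => //.
    apply/seteqP; split => x [] /=.
      move=> [xm xS] Bx; split=> //; move: xS; have := Bi x Bx => xi.
      by apply S_E; rewrite ltr_norml; rewrite /m in xm md; lra.
    move=> xd Bx; split=> //; have := Bi x Bx => xi; split; first by rewrite /=; lra.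
    by apply S_E => //; rewrite ltr_norml; rewrite /m in md; lra.
  exact: stableI.
- apply: (@stable_eq_box ([set x : 'rV[R]_D | m < x ord0 i] `|` S d)) => //.
    apply/seteqP; split => x [] /=.
      move=> xS Bx; split=> //; have := Bi x Bx => xi; move: xS.
      have [xm|xm] := ltP m (x ord0 i); first by move=> _; lra.
      case=> // ; apply S_E; rewrite ltr_norml; rewrite /m in xm dm; lra.
    move=> xd Bx; split=> //; have := Bi x Bx => xi.
    have [xm|xm] := ltP m (x ord0 i); [by left|right].
    by apply S_E => //; rewrite ltr_norml; rewrite /m in xm dm; lra.
  exact: stableU.
Qed.

(** Two nested generation arguments: the product sigma-algebra is generated by coordinate cylinders,
    and the Borel sets of the line by the rays ]d, +oo[, whose cylinders are half-spaces. *)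
Let stable_measurable A : measurable A -> stable A.
Proof.
apply: smallest_sub => //.
  split; [exact: stable0|move=> B sB; rewrite setTD; exact: stableC|].
  exact: stable_bigcup.
move=> _ [k [i [B mB ->]]]; rewrite ord1 => {k}.
move: mB; rewrite -[X in X -> _]/((@ocitv R).-sigma.-measurable B).
rewrite RGenOInfty.measurableE; move: B; apply: smallest_sub.
  split.
  - by rewrite preimage_set0; exact: stable0.
  - by move=> B sB; rewrite setTD preimage_setC; exact: stableC.
  - by move=> F sF; rewrite preimage_bigcup; exact: stable_bigcup.
move=> _ [d ->]; rewrite [X in stable X](_ : _ = [set x : 'rV[R]_D | d < x ord0 i]) //.
by apply/seteqP; split => x /=; rewrite in_itv/= andbT.
Qed.

(** Once an indicator has been absorbed, the test function 1 shows that the integral of [h] over any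
    measurable subset of the box vanishes. *)
Lemma annihilates_smooth_ae0 h : annihilates_smooth h ->
  h = (fun=> 0) %[ae mu in box a b].
Proof.
move=> ah; have [mh ih _] := ah.
have H : ae_eq mu (box a b) (EFin \o h) (cst 0%E).
  apply: (integral_ae_eq (measurable_box a b) ih); first exact: measurable_cst.
  move=> E EB mE; rewrite integral0.
  have [_ /(_ h ah)[_ ihE /(_ (cst 1))]] := stable_measurable mE.
  move=> /(_ (smooth_ringP (smooth_ring_cst 1)) (fun _ _ => erefl)) h0.
  transitivity ((I (fun x => h x * \1_E x))%:E); last first.
    by rewrite -[RHS]/(0%:E) -h0; congr EFin; apply: eq_Rintegral => x _; rewrite mulr1.
  rewrite (EFin_Rintegral_box ihE) integral_mkcond [RHS]integral_mkcond.
  apply: eq_integral => x _; rewrite !patchE indicE.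
  case: ifPn => xE; last by rewrite mulr0 if_same.
  by rewrite mem_set ?mulr1//; apply: EB; exact: set_mem.
by apply: filterS H => x /= hx Bx; have := hx Bx => -[].
Qed.

End uniqueness.

(** * Fubini for real-valued inner integrals, and exchange of almost-everywhere quantifiers *)

Section Rfubini.
Context d1 d2 (T1 : measurableType d1) (T2 : measurableType d2) (R : realType).
Variables (m1 : {sigma_finite_measure set T1 -> \bar R})
  (m2 : {sigma_finite_measure set T2 -> \bar R}).
Variables (A : set T1) (B : set T2).
Hypotheses (mA : measurable A) (mB : measurable B).

Lemma measurable_integral_slice (f : T1 * T2 -> R) : measurable_fun setT f ->
  measurable_fun setT (fun x => \int[m2]_(y in B) (f (x, y))%:E)%E.
Proof.
move=> mf; rewrite (_ : (fun x => _) = (fun x =>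
    \int[m2]_(y in B) ((EFin \o f)^\+ (x, y)) -
    \int[m2]_(y in B) ((EFin \o f)^\- (x, y)))%E); last first.
  apply/funext => x; rewrite [LHS]integralE.
  by congr (_ - _)%E; apply: eq_integral => y _; rewrite !(funeposE, funenegE).
have mF : measurable_fun setT (EFin \o f) by exact/measurable_EFinP.
apply: emeasurable_funB; apply: measurable_integral_in1 => //.
- exact: measurable_funepos.
- exact: measurable_funeneg.
Qed.

Lemma measurable_Rintegral1 (f : T1 * T2 -> R) : measurable_fun setT f ->
  measurable_fun setT (fun x => \int[m2]_(y in B) f (x, y)).
Proof.
move=> /measurable_integral_slice.
exact: (measurableT_comp (fine_measurable measurableT)).
Qed.

(** The real inner integral is [fine] of the extended one, hence different from it where the latter
    is infinite. The assumption makes the inner integral of |f| finite for almost every [x], and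
    there the two agree. *)
Lemma integrable_Rintegral1 (f : T1 * T2 -> R) : measurable_fun setT f ->
  (\int[m1]_(x in A) \int[m2]_(y in B) `|f (x, y)|%:E < +oo)%E ->
  m1.-integrable A (fun x => (\int[m2]_(y in B) f (x, y))%:E) /\
  (\int[m1]_(x in A) (\int[m2]_(y in B) f (x, y))%R%:E =
   \int[m1]_(x in A) \int[m2]_(y in B) (f (x, y))%:E)%E.
Proof.
move=> mf foo.
have mabs : measurable_fun setT (fun z => `|f z|%:E).
  by apply/measurable_EFinP; exact: measurableT_comp.
have mI : measurable_fun setT (fun x => \int[m2]_(y in B) `|f (x, y)|%:E)%E.
  by apply: (measurable_integral_in1 m2 mB mabs) => z; rewrite lee_fin.
have mR := measurable_Rintegral1 mf.
have mfx x : measurable_fun B (fun y => (f (x, y))%:E).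
  apply: measurable_funTS; apply/measurable_EFinP.
  exact: (measurableT_comp mf (measurable_pair1 x)).
have le_abs x : (`|\int[m2]_(y in B) (f (x, y))%:E| <=
    \int[m2]_(y in B) `|f (x, y)|%:E)%E.
  exact: (le_abse_integral m2 mB (mfx x)).
have le_fine (u : \bar R) : (`|(fine u)%:E| <= `|u|)%E.
  by case: u => //=; rewrite normr0 leey.
split.
  apply/integrableP; split; first by apply/measurable_EFinP; exact: measurable_funTS.
  apply: le_lt_trans foo; apply: ge0_le_integral => //.
  - by apply/measurable_funTS/measurableT_comp => //; exact/measurable_EFinP.
  - exact: measurable_funTS.
  - by move=> x _; apply: le_trans (le_fine _) (le_abs x).
have iI : m1.-integrable A (fun x => \int[m2]_(y in B) `|f (x, y)|%:E)%E.
  apply/integrableP; split; first exact: measurable_funTS.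
  rewrite (eq_integral (fun x => \int[m2]_(y in B) `|f (x, y)|%:E))%E// => x _.
  by rewrite gee0_abs//; apply: integral_ge0 => y _; rewrite lee_fin.
apply: ae_eq_integral => //.
- by apply/measurable_EFinP; exact: measurable_funTS.
- by apply: measurable_funTS; exact: measurable_integral_slice.
- apply: filterS (integrable_ae mA iI) => x /= fx Ax.
  rewrite fineK// fin_num_abs; apply: le_lt_trans (le_abs x) _.
  by have := fx Ax; rewrite ge0_fin_numE//; apply: integral_ge0 => y _; rewrite lee_fin.
Qed.

End Rfubini.

Lemma Rfubini_in d1 d2 (T1 : measurableType d1) (T2 : measurableType d2)
    (R : realType) (m1 : {sigma_finite_measure set T1 -> \bar R})
    (m2 : {sigma_finite_measure set T2 -> \bar R}) (A : set T1) (B : set T2)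
    (f : T1 * T2 -> R) : measurable A -> measurable B -> measurable_fun setT f ->
  (\int[m1]_(x in A) \int[m2]_(y in B) `|f (x, y)|%:E < +oo)%E ->
  \int[m1]_(x in A) \int[m2]_(y in B) f (x, y) =
  \int[m2]_(y in B) \int[m1]_(x in A) f (x, y).
Proof.
move=> mA mB mf foo.
have mabs : measurable_fun setT (fun z => `|f z|%:E).
  by apply/measurable_EFinP; exact: measurableT_comp.
have foo' : (\int[m2]_(y in B) \int[m1]_(x in A) `|f (x, y)|%:E < +oo)%E.
  have abs0 z : (0 <= `|f z|%:E)%E by rewrite lee_fin.
  by rewrite -(fubini_tonelli_in m1 m2 mA mB mabs abs0).
have mfs : measurable_fun setT (f \o (fun z : T2 * T1 => (z.2, z.1))).
  apply: (measurableT_comp mf); apply/measurable_fun_pairP.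
  by split; [exact: measurable_snd|exact: measurable_fst].
have [_ E1] := integrable_Rintegral1 mA mB mf foo.
have [_ E2] := integrable_Rintegral1 mB mA mfs foo'.
rewrite /Rintegral; congr fine.
apply: etrans E1 _; apply: etrans (esym E2).
exact: (fubini_in mA mB mf foo).
Qed.

(** Tonelli for the indicator of the complement of [P]: its double integral is zero in one order,
    hence in the other, and a nonnegative function of integral zero vanishes almost everywhere,
    first in [x] and then in [y]. *)
Lemma ae_slice_swap d1 d2 (T1 : measurableType d1) (T2 : measurableType d2)
    (R : realType) (m1 : {sigma_finite_measure set T1 -> \bar R})
    (m2 : {sigma_finite_measure set T2 -> \bar R}) (A : set T1) (B : set T2)
    (P : set (T1 * T2)) : measurable A -> measurable B -> measurable P ->
  (forall y, B y -> {ae m1, forall x, A x -> P (x, y)}) ->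
  {ae m1, forall x, A x -> {ae m2, forall y, B y -> P (x, y)}}.
Proof.
move=> mA mB mP hP.
pose N : T1 * T2 -> \bar R := fun z => (\1_(~` P) z)%:E.
have mN : measurable_fun setT N.
  by apply/measurable_EFinP; apply: measurable_indic; exact: measurableC.
have N0 z : (0 <= N z)%E by rewrite lee_fin.
have NP z : N z = 0%E <-> P z.
  rewrite /N indicE in_setC; have [zP|zP] := boolP (z \in P).
    by split=> // _; exact: set_mem.
  split; first by move=> [] /eqP; rewrite oner_eq0.
  by move/mem_set; rewrite (negbTE zP).
have mI : measurable_fun setT (fun x => \int[m2]_(y in B) N (x, y))%E.
  exact: (measurable_integral_in1 m2 mB mN).
have I0 : (\int[m1]_(x in A) \int[m2]_(y in B) N (x, y) = 0)%E.
  rewrite (fubini_tonelli_in m1 m2 mA mB mN N0); apply: integral0_eq => y By.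
  rewrite (@ae_eq_integral _ _ _ m1 A (cst 0%E))//; first exact: integral0.
    apply: measurable_funTS; exact: (measurableT_comp mN (measurable_pair2 y)).
  by apply: filterS (hP y By) => x Px Ax; apply/NP; exact: Px.
have : ae_eq m1 A (fun x => \int[m2]_(y in B) N (x, y))%E (cst 0%E).
  apply/ae_eq_integral_abs => //; first exact: measurable_funTS.
  rewrite -[RHS]I0; apply: eq_integral => x _.
  by rewrite gee0_abs//; exact: integral_ge0.
apply: filterS => x /= H Ax; have {}H := H Ax.
have : ae_eq m2 B (fun y => N (x, y)) (cst 0%E).
  apply/ae_eq_integral_abs => //.
    apply: measurable_funTS; exact: (measurableT_comp mN (measurable_pair1 x)).
  by rewrite -[RHS]H; apply: eq_integral => y _; rewrite gee0_abs.
by apply: filterS => y /= Ny By; apply/NP; exact: Ny.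
Qed.

(** * Periodic functions and weak derivatives *)

Section periodic_functions.
Context {R : realType} {D : nat}.
Variables (a b : 'rV[R]_D).
Hypothesis ab : forall i, a ord0 i < b ord0 i.
Implicit Types (f g p q u v : 'rV[R]_D -> R) (i : 'I_D) (s t : R).
Local Notation mu := (lebesgue_rV R D).
Local Notation I f := (\int[mu]_(x in box a b) f x).

Definition L1per f :=
  [/\ measurable_fun setT f, box_periodic a b f & box_integrable a b f].

Definition translate i s f : 'rV[R]_D -> R := fun x => f (x + s *: delta_mx ord0 i).

Lemma eq_Rintegral_ae f g : measurable_fun setT f -> measurable_fun setT g ->
  f = g %[ae mu in box a b] -> I f = I g.
Proof.
move=> mf mg fg; rewrite /Rintegral; congr fine.
apply: (ae_eq_integral _ _ (measurable_box a b)).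
- by apply/measurable_EFinP; exact: measurable_funTS.
- by apply/measurable_EFinP; exact: measurable_funTS.
- by apply: filterS fg => x /= fgx Bx; rewrite fgx.
Qed.

Lemma eq_box_integrable_ae f g : measurable_fun setT g ->
  f = g %[ae mu in box a b] -> box_integrable a b f -> box_integrable a b g.
Proof.
move=> mg fg jf; have mf := measurable_int mu jf.
have mge : measurable_fun (box a b) (EFin \o g).
  by apply/measurable_EFinP; exact: measurable_funTS.
apply/integrableP; split=> //.
have /integrableP[_] := jf; congr (_ < _)%E.
apply: (ae_eq_integral _ _ (measurable_box a b)).
- exact: measurableT_comp.
- exact: measurableT_comp.
- by apply: filterS fg => x /= fgx Bx; rewrite fgx.
Qed.

Lemma box_periodic_translate i s f :
  box_periodic a b f -> box_periodic a b (translate i s f).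
Proof. by move=> pf j x; rewrite /translate addrAC pf. Qed.

Lemma measurable_translate i s f :
  measurable_fun setT f -> measurable_fun setT (translate i s f).
Proof. by move=> mf; exact: (measurableT_comp mf (measurable_shift i s)). Qed.

Lemma ge0_integral_translate i s f : measurable_fun setT f ->
  box_periodic a b f -> (forall x, 0 <= f x) ->
  (\int[mu]_(x in box a b) (translate i s f x)%:E =
   \int[mu]_(x in box a b) (f x)%:E)%E.
Proof.
move=> mf pf f0.
apply: (@integral_rV_translation _ _ a b (EFin \o f) i s) => //.
- exact/measurable_EFinP.
- by move=> x; rewrite /= ?lee_fin ?pf.
Qed.

Lemma L1per_translate i s f : L1per f -> L1per (translate i s f).
Proof.
move=> [mf pf jf]; split.
- exact: measurable_translate.
- exact: box_periodic_translate.
apply/integrableP; split.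
  by apply/measurable_EFinP; apply: measurable_funTS; exact: measurable_translate.
have /integrableP[_] := jf; congr (_ < _)%E; apply/esym.
apply: (@ge0_integral_translate i s (fun x => `|f x|)) => //.
- exact: measurableT_comp.
- by move=> j x; rewrite pf.
Qed.

Lemma Rintegral_translate i s f : L1per f -> I (translate i s f) = I f.
Proof.
move=> [mf pf jf]; rewrite /Rintegral; congr fine.
rewrite [LHS]integralE [RHS]integralE; congr (_ - _)%E.
- transitivity (\int[mu]_(x in box a b)
      (translate i s (fun y => Num.max (f y) 0) x)%:E)%E.
    by apply: eq_integral => x _; rewrite funeposE -EFin_max.
  rewrite ge0_integral_translate.
  + by apply: eq_integral => x _; rewrite funeposE -EFin_max.
  + exact: measurable_maxr.
  + by move=> j x; rewrite pf.
  + by move=> x; rewrite le_max lexx orbT.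
- transitivity (\int[mu]_(x in box a b)
      (translate i s (fun y => Num.max (- f y) 0) x)%:E)%E.
    by apply: eq_integral => x _; rewrite funenegE -EFinN -EFin_max.
  rewrite ge0_integral_translate.
  + by apply: eq_integral => x _; rewrite funenegE -EFinN -EFin_max.
  + by apply: measurable_maxr => //; exact: measurable_funN.
  + by move=> j x; rewrite pf.
  + by move=> x; rewrite le_max lexx orbT.
Qed.

Lemma L1perZ c f : L1per f -> L1per (fun x => c * f x).
Proof.
move=> [mf pf jf]; split; [exact: measurable_funM| |exact: box_integrableZ].
by move=> i x; rewrite pf.
Qed.

Lemma L1perD f g : L1per f -> L1per g -> L1per (fun x => f x + g x).
Proof.
move=> [mf pf jf] [mg pg ig]; split; [exact: measurable_funD| |exact: box_integrableD].
by move=> i x; rewrite pf pg.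
Qed.

Lemma L1per_norm f : L1per f -> L1per (fun x => `|f x|).
Proof.
move=> [mf pf jf]; split; [exact: measurableT_comp| |exact: box_integrable_norm].
by move=> i x; rewrite pf.
Qed.

Lemma L1per_cst c : L1per (fun=> c).
Proof. by split; [exact: measurable_cst| |exact: box_integrable_cst]. Qed.

Lemma L1per_le f g : measurable_fun setT f -> box_periodic a b f ->
  L1per g -> (forall x, `|f x| <= g x) -> L1per f.
Proof.
move=> mf pf [mg pg ig] fg; split=> //.
by apply: (le_box_integrable mf ig) => x _; exact: fg.
Qed.

Lemma L2per_sqr f : L2per a b f -> L1per (fun x => f x ^+ 2).
Proof.
move=> [mf pf jf]; split=> //; first exact: measurable_funX.
by move=> i x; rewrite pf.
Qed.

Lemma L2perM_L1per f g : L2per a b f -> L2per a b g -> L1per (fun x => f x * g x).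
Proof.
move=> Lf Lg; have [mf pf _] := Lf; have [mg pg _] := Lg.
apply: (@L1per_le _ (fun x => f x ^+ 2 + g x ^+ 2)).
- exact: measurable_funM.
- by move=> i x; rewrite pf pg.
- by apply: L1perD; exact: L2per_sqr.
- move=> x; rewrite ler_norml; apply/andP; split.
    by have := sqr_ge0 (f x + g x); have := sqr_ge0 (f x); have := sqr_ge0 (g x); nra.
  by have := sqr_ge0 (f x - g x); have := sqr_ge0 (f x); have := sqr_ge0 (g x); nra.
Qed.

(** The box has finite measure, so constants are integrable and 1 + f^2 is a majorant of |f|. *)
Lemma L2per_L1per f : L2per a b f -> L1per f.
Proof.
move=> Lf; have [mf pf _] := Lf.
apply: (@L1per_le _ (fun x => 1 + f x ^+ 2)) => //.
  by apply: L1perD; [exact: L1per_cst|exact: L2per_sqr].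
move=> x; rewrite ler_norml; apply/andP; split.
  by have := sqr_ge0 (f x + 1); have := sqr_ge0 (f x); nra.
by have := sqr_ge0 (f x - 1); have := sqr_ge0 (f x); nra.
Qed.

Lemma L2perZ c f : L2per a b f -> L2per a b (fun x => c * f x).
Proof.
move=> [mf pf jf]; split; [exact: measurable_funM|by move=> i x; rewrite pf|].
under eq_fun do rewrite exprMn.
exact: box_integrableZ.
Qed.

Lemma L2perD f g : L2per a b f -> L2per a b g -> L2per a b (fun x => f x + g x).
Proof.
move=> Lf Lg; have [mf pf jf] := Lf; have [mg pg ig] := Lg.
split; [exact: measurable_funD|by move=> i x; rewrite pf pg|].
have [_ _ ifg] := L2perM_L1per Lf Lg.
under eq_fun do rewrite sqrrD.
apply: box_integrableD => //; apply: box_integrableD => //.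
under eq_fun do rewrite -mulr_natl.
exact: box_integrableZ.
Qed.

Lemma L2per_translate i s f : L2per a b f -> L2per a b (translate i s f).
Proof.
move=> Lf; have [mf pf jf] := Lf; split.
- exact: measurable_translate.
- exact: box_periodic_translate.
- by have [_ _] := L1per_translate i s (L2per_sqr Lf).
Qed.

Lemma L2perM_smooth f zeta : smooth zeta -> box_periodic a b zeta ->
  L2per a b f -> L2per a b (fun x => f x * zeta x).
Proof.
move=> sz pz [mf pf jf]; have [mz [M zM]] := smooth_bounded a b sz.
split; [exact: measurable_funM|by move=> i x; rewrite pf pz|].
under eq_fun do rewrite exprMn.
apply: (box_integrableM_bounded (M := M ^+ 2)).
- exact: measurable_funX.
- exact: measurable_funX.
- exact: jf.
- move=> x /zM; rewrite normrX; have := normr_ge0 (zeta x).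
  by move=> z0 zM'; rewrite lerXn2r// nnegrE (le_trans z0).
Qed.

Lemma L1perM_smooth f zeta : smooth zeta -> box_periodic a b zeta ->
  L1per f -> L1per (fun x => f x * zeta x).
Proof.
move=> sz pz [mf pf jf]; have [mz [M zM]] := smooth_bounded a b sz.
split; [exact: measurable_funM|by move=> i x; rewrite pf pz|].
exact: (box_integrableM_bounded mf mz jf zM).
Qed.

(** * Integrals along coordinate segments *)

Section lines.
Variables (i : 'I_D) (s : R).
Hypothesis s0 : 0 < s.
Local Notation lam := (@lebesgue_measure R).
Local Notation J := (`]0, s[%classic : set R).

Definition line_integral q : 'rV[R]_D -> R :=
  fun x => \int[lam]_(t in `]0, s[) q (x + t *: delta_mx ord0 i).

Let mJ : measurable (J : set (measurableTypeR R)).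
Proof. exact: measurable_itv. Qed.

Let measurable_line q : measurable_fun setT q ->
  measurable_fun setT (fun z : 'rV[R]_D * measurableTypeR R =>
    q (z.1 + z.2 *: delta_mx ord0 i)).
Proof. by move=> mq; exact: (measurableT_comp mq (measurable_shift2 i)). Qed.

Lemma measurable_line_integral q : measurable_fun setT q ->
  measurable_fun setT (line_integral q).
Proof.
by move=> mq; exact: (measurable_Rintegral1 lam mJ (measurable_line mq)).
Qed.

(** Majorants of this shape come from Young's inequality applied to a value at [x] times a value at
    the moved point. By translation invariance the second term has the same integral over the box
    for every [t]. *)
Lemma integral_line_majorant u v : L1per u -> L1per v ->
  (forall x, 0 <= u x) -> (forall x, 0 <= v x) ->
  (\int[mu]_(x in box a b) \int[lam]_(t in J)
     (u x + v (x + t *: delta_mx ord0 i)%R)%:E = (s * (I u + I v))%:E)%E.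
Proof.
move=> Lu Lv u0 v0; have [mu_ pu iu] := Lu; have [mv pv iv] := Lv.
have mF : measurable_fun setT (fun z : 'rV[R]_D * measurableTypeR R =>
    (u z.1 + v (z.1 + z.2 *: delta_mx ord0 i))%:E).
  apply/measurable_EFinP; apply: measurable_funD; last exact: measurable_line.
  exact: (measurableT_comp mu_ measurable_fst).
have F0 (z : 'rV[R]_D * measurableTypeR R) :
    (0 <= (u z.1 + v (z.1 + z.2 *: delta_mx ord0 i)%R)%:E)%E.
  by rewrite lee_fin addr_ge0.
have /= -> := fubini_tonelli_in mu lam (measurable_box a b) mJ mF F0.
transitivity (\int[lam]_(t in J) (cst (I u + I v)%:E t))%E.
  apply: eq_integral => t _ /=.
  have [_ _ ivt] := L1per_translate i t Lv.
  rewrite -(EFin_Rintegral_box (box_integrableD iu ivt)).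
  by rewrite (RintegralD_box iu ivt) Rintegral_translate.
have lJ : lam J = s%:E by rewrite lebesgue_measure_itv/= lte_fin s0 sube0.
transitivity ((I u + I v)%:E * lam J)%E; first exact: integral_cst.
by rewrite lJ -EFinM mulrC.
Qed.

Lemma line_majorant_lty (F : 'rV[R]_D * measurableTypeR R -> R) u v :
  measurable_fun setT F -> L1per u -> L1per v ->
  (forall x, 0 <= u x) -> (forall x, 0 <= v x) ->
  (forall x t, box a b x -> 0 < t < s ->
    `|F (x, t)| <= u x + v (x + t *: delta_mx ord0 i)) ->
  (\int[mu]_(x in box a b) \int[lam]_(t in J) `|F (x, t)|%:E <=
   (s * (I u + I v))%:E)%E.
Proof.
move=> mF Lu Lv u0 v0 FH; have [mu_ pu iu] := Lu; have [mv pv iv] := Lv.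
rewrite -(integral_line_majorant Lu Lv u0 v0).
have maF : measurable_fun setT (fun z => `|F z|%:E).
  by apply/measurable_EFinP; exact: measurableT_comp.
have mH : measurable_fun setT (fun z : 'rV[R]_D * measurableTypeR R =>
    (u z.1 + v (z.1 + z.2 *: delta_mx ord0 i))%:E).
  apply/measurable_EFinP; apply: measurable_funD; last exact: measurable_line.
  exact: (measurableT_comp mu_ measurable_fst).
have F0 z : (0 <= `|F z|%:E)%E by rewrite lee_fin.
have H0 (z : 'rV[R]_D * measurableTypeR R) :
    (0 <= (u z.1 + v (z.1 + z.2 *: delta_mx ord0 i)%R)%:E)%E.
  by rewrite lee_fin addr_ge0.
apply: (ge0_le_integral mu (measurable_box a b)).
- by move=> x Bx; apply: integral_ge0 => t _; exact: (F0 (x, t)).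
- apply: measurable_funTS; exact: (measurable_integral_in1 lam mJ maF F0).
- apply: measurable_funTS; exact: (measurable_integral_in1 lam mJ mH H0).
- move=> x Bx; apply: (ge0_le_integral lam mJ).
  + by move=> t _; exact: (F0 (x, t)).
  + apply: measurable_funTS; exact: (measurableT_comp maF (measurable_pair1 x)).
  + apply: measurable_funTS; exact: (measurableT_comp mH (measurable_pair1 x)).
  + by move=> t /=; rewrite in_itv/= lee_fin; exact: FH.
Qed.

(** Tonelli with the majorant |q| at the moved point. It ensures that [line_integral] is a genuine
    integral at almost every base point. *)
Lemma line_integrable_ae q : L1per q ->
  {ae mu, forall x, box a b x ->
    lam.-integrable J (fun t => (q (x + t *: delta_mx ord0 i))%:E)}.
Proof.
move=> Lq; have [mq pq iq] := Lq.
have ml := measurable_line mq.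
have mal : measurable_fun setT (fun z : 'rV[R]_D * measurableTypeR R =>
    `|q (z.1 + z.2 *: delta_mx ord0 i)|%:E).
  by apply/measurable_EFinP; exact: measurableT_comp.
have q0 (z : 'rV[R]_D * measurableTypeR R) :
   (0 <= `|q (z.1 + z.2 *: delta_mx ord0 i)%R|%:E)%E by rewrite lee_fin.
have fin := @line_majorant_lty _ (cst 0) (fun x => `|q x|) ml (L1per_cst 0)
  (L1per_norm Lq) (fun=> lexx _) (fun=> normr_ge0 _).
have {}fin := fin (fun x t _ _ => _).
have : mu.-integrable (box a b) (fun x => \int[lam]_(t in J)
    `|q (x + t *: delta_mx ord0 i)%R|%:E)%E.
  apply/integrableP; split.
    apply: measurable_funTS; exact: (measurable_integral_in1 lam mJ mal q0).
  apply: (@le_lt_trans _ _ (s * (I (cst 0) + I (fun x => `|q x|)))%:E);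
    last exact: ltry.
  apply: le_trans (fin _); last by move=> x t; rewrite /= add0r.
  rewrite le_eqVlt; apply/orP; left; apply/eqP; apply: eq_integral => x _.
  by rewrite gee0_abs//; apply: integral_ge0 => t _; rewrite lee_fin.
move=> /(integrable_ae (measurable_box a b)); apply: filterS => x /= fx Bx.
apply/integrableP; split.
  apply: measurable_funTS; apply/measurable_EFinP.
  exact: (measurableT_comp ml (measurable_pair1 x)).
have := fx Bx; rewrite ge0_fin_numE//.
by apply: integral_ge0 => t _; rewrite lee_fin.
Qed.

Lemma line_fubini p q u v : measurable_fun setT p -> L1per q ->
  L1per u -> L1per v -> (forall x, 0 <= u x) -> (forall x, 0 <= v x) ->
  (forall x t, box a b x -> 0 < t < s ->
    `|p x * q (x + t *: delta_mx ord0 i)| <= u x + v (x + t *: delta_mx ord0 i)) ->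
  [/\ box_integrable a b (fun x => p x * line_integral q x),
      lam.-integrable J (fun t => (I (fun x => p x * translate i t q x))%:E) &
      I (fun x => p x * line_integral q x) =
      \int[lam]_(t in J) I (fun x => p x * translate i t q x)].
Proof.
move=> mp Lq Lu Lv u0 v0 FH; have [mq pq iq] := Lq.
pose F (z : 'rV[R]_D * measurableTypeR R) :=
  p z.1 * q (z.1 + z.2 *: delta_mx ord0 i).
have mF : measurable_fun setT F.
  apply: measurable_funM; last exact: measurable_line.
  exact: (measurableT_comp mp measurable_fst).
have Foo : (\int[mu]_(x in box a b) \int[lam]_(t in J) `|F (x, t)|%:E < +oo)%E.
  exact: le_lt_trans (line_majorant_lty mF Lu Lv u0 v0 FH) (ltry _).
have mFs : measurable_fun setT (F \o (fun z => (z.2, z.1))).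
  apply: (measurableT_comp mF); apply/measurable_fun_pairP.
  by split; [exact: measurable_snd|exact: measurable_fst].
have Foo' : (\int[lam]_(t in J) \int[mu]_(x in box a b) `|F (x, t)|%:E < +oo)%E.
  have maF : measurable_fun setT (fun z => `|F z|%:E).
    by apply/measurable_EFinP; exact: measurableT_comp.
  have abs0 z : (0 <= `|F z|%:E)%E by rewrite lee_fin.
  by rewrite -(fubini_tonelli_in mu lam (measurable_box a b) mJ maF abs0).
have [iF _] := integrable_Rintegral1 (measurable_box a b) mJ mF Foo.
have [iF' _] := integrable_Rintegral1 mJ (measurable_box a b) mFs Foo'.
(* The factor [p x] leaves the inner integral only where the segment integral of [q] converges,
   hence almost everywhere. *)
have E : (fun x => \int[lam]_(t in J) F (x, t)) =
    (fun x => p x * line_integral q x) %[ae mu in box a b].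
  apply: filterS (line_integrable_ae Lq) => x /= jx Bx.
  by rewrite /F /= RintegralZl//; exact: jx.
have mG : measurable_fun setT (fun x => p x * line_integral q x).
  by apply: measurable_funM => //; exact: measurable_line_integral.
split.
- exact: (eq_box_integrable_ae mG E iF).
- exact: iF'.
rewrite -(eq_Rintegral_ae _ mG E); last exact: (measurable_Rintegral1 lam mJ mF).
exact: (Rfubini_in (measurable_box a b) mJ mF Foo).
Qed.

End lines.

End periodic_functions.

(** * Weak derivatives as integrals along segments *)

Section weak_derivatives.
Context {R : realType} {D : nat}.
Variables (a b : 'rV[R]_D).
Hypothesis ab : forall i, a ord0 i < b ord0 i.
Implicit Types (f g p q u v zeta : 'rV[R]_D -> R) (i : 'I_D) (s t : R).
Local Notation mu := (lebesgue_rV R D).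
Local Notation lam := (@lebesgue_measure R).
Local Notation I f := (\int[mu]_(x in box a b) f x).
Local Notation e i := (delta_mx ord0 i : 'rV[R]_D).

Lemma translate_smooth i s zeta : smooth zeta -> smooth (translate i s zeta).
Proof. exact: smooth_shift. Qed.

Lemma partial_translate i j s zeta :
  partial i (translate j s zeta) = translate j s (partial i zeta).
Proof. exact: partial_shift. Qed.

Lemma box_periodic_partial i zeta :
  box_periodic a b zeta -> box_periodic a b (partial i zeta).
Proof.
move=> pz j x; rewrite -[LHS]/(translate j _ _ x) -partial_translate.
by congr (partial i _ x); apply/funext => y; rewrite /translate pz.
Qed.

Lemma is_derive_line i zeta x s : smooth zeta ->
  is_derive s 1 (fun t => zeta (x + t *: e i)) (partial i zeta (x + s *: e i)).
Proof.
move=> sz.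
have E : (fun h : R => h^-1 *: (((fun t => zeta (x + t *: e i)) \o shift s) (h *: 1)
       - zeta (x + s *: e i))) =
    (fun h : R => h^-1 *: ((zeta \o shift (x + s *: e i)) (h *: e i)
       - zeta (x + s *: e i))).
  apply/funext => h /=; congr (_ *: (zeta _ - _)).
  by rewrite [h *: 1]mulr1 scalerDl addrCA.
split; first by rewrite /derivable E; exact: smooth_derivable.
by rewrite /derive E.
Qed.

Lemma is_derive_lineN i zeta x s : smooth zeta ->
  is_derive s 1 (fun t => - zeta (x - t *: e i)) (partial i zeta (x - s *: e i)).
Proof.
move=> sz.
have H : is_derive (- s) 1 (fun t => zeta (x + t *: e i)) (partial i zeta (x - s *: e i)).
  by have := is_derive_line i x (- s) sz; rewrite scaleNr.
have HN : is_derive s 1 (fun t : R => - t) (-1).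
  exact: (is_deriveN (is_derive_id s (1 : R))).
have := is_deriveN (@is_derive1_comp _ (fun t => zeta (x + t *: e i)) _ _ _ _ H HN).
rewrite mulrN1 opprK; congr (is_derive _ _ _ _).
by apply/funext => t; rewrite /GRing.opp/= scaleNr.
Qed.

Lemma continuous_line i f x : continuous f ->
  continuous (fun t : R => f (x - t *: e i)).
Proof.
move=> cf t; apply: (@continuous_comp R 'rV[R]_D R (fun t => x - t *: e i) f t);
  last exact: cf.
apply: (@continuousB _ 'rV[R]_D R (cst x) (fun t => t *: e i) t).
  exact: cst_continuous.
by apply: (@continuousZl _ _ R id); exact: cvg_id.
Qed.

(** Segments run backwards from [x] because a translation moved from a function onto its test
    function changes sign. Hence the primitive - zeta (x - t e_i). *)
Lemma FTC_line i s zeta x : 0 < s -> smooth zeta ->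
  lam.-integrable `]0, s[ (fun t => (partial i zeta (x - t *: e i))%:E) /\
  \int[lam]_(t in `]0, s[) partial i zeta (x - t *: e i) =
  zeta x - zeta (x - s *: e i).
Proof.
move=> s0 sz.
have cp := @continuous_line i _ x (smooth_continuous (smooth_partial i sz)).
have cz := @continuous_line i _ x (smooth_continuous sz).
have ic : lam.-integrable `[0, s] (fun t => (partial i zeta (x - t *: e i))%:E).
  apply: continuous_compact_integrable; first exact: segment_compact.
  exact: continuous_subspaceT.
have io : lam.-integrable `]0, s[ (fun t => (partial i zeta (x - t *: e i))%:E).
  apply: integrableS ic => //; exact: subset_itv_oo_cc.
split=> //.
have cN : continuous (fun t => - zeta (x - t *: e i)).
  by move=> t; apply: cvgN; exact: cz.
have := @continuous_FTC2 R (fun t => partial i zeta (x - t *: e i))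
  (fun t => - zeta (x - t *: e i)) 0 s s0.
move=> /(_ (continuous_subspaceT cp)) H.
rewrite /Rintegral.
have -> : (\int[lam]_(t in `]0%R, s[) (partial i zeta (x - t *: e i)%R)%:E =
  \int[lam]_(t in `[0%R, s]) (partial i zeta (x - t *: e i)%R)%:E)%E.
  rewrite integral_itv_bndo_bndc; last exact: (measurable_int lam io).
  rewrite integral_itv_obnd_cbnd//.
  apply: (measurable_int lam); apply: integrableS ic => //.
  exact: subset_itv_oc_cc.
rewrite H.
- by rewrite /= scale0r subr0 opprK addrC.
- split.
  + by move=> t _; have [] := is_derive_lineN i x t sz.
  + by apply: cvg_at_right_filter; exact: cN.
  + by apply: cvg_at_left_filter; exact: cN.
- move=> t _; rewrite derive1E.
  by have [_] := is_derive_lineN i x t sz.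
Qed.

(** Only L^1 is required: this is all that a product of two L^2 functions and its derivative
    provide. *)
Definition weak_deriv i f g := [/\ L1per a b f, L1per a b g & is_weak_partial a b i f g].

(** All translations are moved onto [zeta]. Weak differentiation against the translates of [zeta]
    turns the term with [g] into an integral of [f] against their derivatives along the segment, and
    the fundamental theorem of calculus for [zeta] sums these to the difference occurring in the
    first two terms. *)
Lemma translate_annihilates i f g s : 0 < s -> weak_deriv i f g ->
  annihilates_smooth a b (fun x => translate i s f x - f x - line_integral i s g x).
Proof.
move=> s0 [Lf Lg fg].
have [mf pf jf] := Lf; have [mg pg ig] := Lg.
have [mfs pfs ifs] := L1per_translate ab i s Lf.
have ng0 x : 0 <= `|g x| by [].
have Lng := L1per_norm Lg.
have [|iG _ _] := line_fubini ab (i := i) s0 (measurable_cst (1 : R)) Lg (L1per_cst ab 0) Lng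
  (fun=> lexx _) ng0.
  by move=> x t _ _; rewrite mul1r add0r.
have {}iG : box_integrable a b (line_integral i s g).
  by move: iG; under eq_fun do rewrite /= mul1r.
have mG := measurable_line_integral i s mg.
split.
- by apply: measurable_funB => //; exact: measurable_funB.
- by apply: box_integrableB => //; exact: box_integrableB.
move=> zeta sz pz; have [mz [M zM]] := smooth_bounded a b sz.
have M0 : 0 <= `|M| by [].
have zM' x : box a b x -> `|zeta x| <= `|M|.
  by move=> /zM /le_trans; apply; exact: ler_norm.
have szs t : smooth (translate i t zeta) by exact: translate_smooth.
have pzs t : box_periodic a b (translate i t zeta) by exact: box_periodic_translate.
have ifz t := L1perM_smooth (szs t) (pzs t) Lf.
have [_ _ ifsz] := L1perM_smooth sz pz (L1per_translate ab i s Lf).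
have [_ _ ifz0] := L1perM_smooth sz pz Lf.
have iGz := box_integrableM_bounded mG mz iG zM.
(* Since [zeta] is bounded on the box, the majorant needs only its part at the moved point, namely
   |M| |g|. *)
have [|_ iGt FG] := line_fubini ab (i := i) s0 mz Lg (L1per_cst ab 0)
    (L1perZ `|M| Lng) (fun=> lexx _) (fun x => mulr_ge0 M0 (ng0 x)).
  by move=> x t Bx _; rewrite add0r normrM ler_wpM2r// zM'.
under eq_Rintegral do rewrite mulrBl mulrBl.
rewrite RintegralB_box//; last first.
  by apply: box_integrableB.
rewrite RintegralB_box//.
have -> : I (fun x => translate i s f x * zeta x) =
    I (fun x => f x * translate i (- s) zeta x).
  rewrite -[RHS](Rintegral_translate ab i s (ifz (- s))).
  apply: eq_Rintegral => x _; rewrite /translate; congr (_ * zeta _).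
  by rewrite scaleNr addrK.
have -> : I (fun x => line_integral i s g x * zeta x) =
    \int[lam]_(t in `]0, s[) - I (fun x => f x * partial i zeta (x - t *: e i)).
  under eq_Rintegral do rewrite mulrC.
  rewrite FG; apply: eq_Rintegral => t _.
  have -> : I (fun x => f x * partial i zeta (x - t *: e i)) =
      I (fun x => f x * partial i (translate i (- t) zeta) x).
    by apply: eq_Rintegral => x _; rewrite partial_translate /translate scaleNr.
  rewrite (fg _ (szs (- t)) (pzs (- t))) opprK.
  rewrite -(Rintegral_translate ab i t (L1perM_smooth (szs (- t)) (pzs (- t)) Lg)).
  apply: eq_Rintegral => x _; rewrite /translate mulrC; congr (_ * zeta _).
  by rewrite scaleNr addrK.
pose F (z : 'rV[R]_D * measurableTypeR R) :=
  - (f z.1 * partial i zeta (z.1 - z.2 *: e i)).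
have sp := smooth_partial i sz.
have mF : measurable_fun setT F.
  apply: measurable_funN; apply: measurable_funM.
    exact: (measurableT_comp mf measurable_fst).
  rewrite (_ : (fun z => _) = (fun z : 'rV[R]_D * measurableTypeR R =>
     partial i zeta (z.1 + z.2 *: e i)) \o (fun z => (z.1, - z.2))); last first.
    by apply/funext => z /=; rewrite scaleNr.
  apply: measurableT_comp.
    apply: (measurableT_comp _ (measurable_shift2 i)).
    exact: (continuous_rV_measurable (smooth_continuous sp)).
  apply/measurable_fun_pairP; split; first exact: measurable_fst.
  exact: (measurable_funN (@measurable_snd _ _ _ _)).
(* Lowering the corner [a] by [s] in direction [i] keeps the backward segments from points of the
   box inside the box on which the bound holds. *)
have [M' zM''] := continuous_bounded_box (a - s *: e i) b (smooth_continuous sp).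
have Foo : (\int[mu]_(x in box a b) \int[lam]_(t in `]0%R, s[) `|F (x, t)|%:E < +oo)%E.
  apply: (@le_lt_trans _ _ (s * (I (fun x => `|M'| * `|f x|) + I (cst 0)))%:E);
    last exact: ltry.
  apply: (@line_majorant_lty _ _ _ _ ab i _ s0 F _ _ mF) => //.
  - by apply: L1perZ; exact: L1per_norm.
  - exact: L1per_cst.

  move=> x t Bx /andP[t0 ts]; rewrite /F/= addr0 normrN normrM mulrC ler_wpM2r//.
  apply: le_trans (ler_norm _); apply: zM'' => j.
  have := Bx j; rewrite !in_itv/= !mxE => /andP[x1 x2].
  have [ji|ji] := eqVneq j i; rewrite ?mulr1n ?mulr0n ?mulr1 ?mulr0 ?eqxx/=; last first.
    by rewrite !subr0 x1 x2.
  by apply/andP; split; lra.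
have mJ : measurable (`]0, s[%classic : set (measurableTypeR R)).
  exact: measurable_itv.
have Fub := @Rfubini_in _ _ _ _ _ mu lam _ _ _ (measurable_box a b) mJ mF Foo.
have -> : \int[lam]_(t in `]0, s[) - I (fun x => f x * partial i zeta (x - t *: e i)) =
    \int[lam]_(t in `]0, s[) I (fun x => F (x, t)).
  apply: eq_Rintegral => t _; rewrite -mulN1r -RintegralZ_box.
    by apply: eq_Rintegral => x _; rewrite mulN1r.
  have := L1perM_smooth (smooth_partial i (szs (- t)))
    (box_periodic_partial i (pzs (- t))) Lf.
  by move=> [_ _]; rewrite partial_translate /translate scaleNr.
rewrite -Fub.
have -> : I (fun x => \int[lam]_(t in `]0, s[) F (x, t)) =
    I (fun x => f x * translate i (- s) zeta x - f x * zeta x).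
  apply: eq_Rintegral => x _.
  have [ip Ep] := FTC_line i x s0 sz.
  rewrite /F /= -mulrBr.
  under eq_Rintegral do rewrite -mulNr.
  rewrite RintegralZl//.
  by rewrite Ep mulNr -mulrN opprB /translate scaleNr.
rewrite RintegralB_box; [by rewrite subrr|by have [] := ifz (- s)|exact: ifz0].
Qed.

Lemma weak_deriv_translate i f g s : 0 < s -> weak_deriv i f g ->
  (fun x => translate i s f x - f x) = line_integral i s g %[ae mu in box a b].
Proof.
move=> s0 fg; apply: filterS (annihilates_smooth_ae0 ab (translate_annihilates s0 fg)).
by move=> x /= H Bx; apply/eqP; rewrite -subr_eq0; apply/eqP; exact: H.
Qed.

End weak_derivatives.

(** * Integration by parts *)

Section integration_by_parts.
Context {R : realType} {D : nat}.
Variables (a b : 'rV[R]_D).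
Hypothesis ab : forall i, a ord0 i < b ord0 i.
Implicit Types (f g p q u v zeta : 'rV[R]_D -> R) (i : 'I_D) (s t : R).
Local Notation mu := (lebesgue_rV R D).
Local Notation lam := (@lebesgue_measure R).
Local Notation I f := (\int[mu]_(x in box a b) f x).

Definition L2_deriv i f g :=
  [/\ L2per a b f, L2per a b g & is_weak_partial a b i f g].

Lemma L2_deriv_weak i f g : L2_deriv i f g -> weak_deriv a b i f g.
Proof. by move=> [Lf Lg fg]; split=> //; exact: L2per_L1per. Qed.

Lemma normM_half (x y : R) : `|x * y| <= 2^-1 * x ^+ 2 + 2^-1 * y ^+ 2.
Proof.
rewrite ler_norml; apply/andP; split.
  by have := sqr_ge0 (x + y); nra.
by have := sqr_ge0 (x - y); nra.
Qed.

(** Young's inequality replaces Cauchy-Schwarz here, as only the order in [s] of the later bounds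
    matters. *)
Lemma norm_RintegralM f g : L2per a b f -> L2per a b g ->
  `|I (fun x => f x * g x)| <= 2^-1 * (I (fun x => f x ^+ 2) + I (fun x => g x ^+ 2)).
Proof.
move=> Lf Lg; have [mfg _ ifg] := L2perM_L1per Lf Lg.
have [mf2 _ if2] := L2per_sqr Lf; have [mg2 _ ig2] := L2per_sqr Lg.
apply: le_trans (le_normr_Rintegral (measurable_box a b) ifg) _.
rewrite -RintegralD_box// -RintegralZ_box; last exact: box_integrableD.
apply: (le_Rintegral (measurable_box a b)).
- exact: box_integrable_norm.
- exact/box_integrableZ/box_integrableD.
- by move=> x _; rewrite mulrDr; exact: normM_half.
Qed.

Let mJ s : measurable (`]0, s[%classic : set (measurableTypeR R)).
Proof. exact: measurable_itv. Qed.

Lemma Rintegral_cst_itv s (C : R) : 0 < s ->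
  lam.-integrable `]0, s[ (EFin \o cst C) /\
  \int[lam]_(t in `]0, s[) cst C t = s * C.
Proof.
move=> s0.
have lJ : lam `]0%R, s[%classic = s%:E.
  by rewrite lebesgue_measure_itv/= lte_fin s0 sube0.
split; last first.
  rewrite (Rintegral_cst lam (mJ s) C) mulrC; congr (_ * _).
  exact: (congr1 fine lJ).
apply/integrableP; split; first exact: (measurable_cst C%:E).
rewrite [ltLHS](_ : _ = (`|C| * s)%:E) ?ltry//.
by rewrite EFinM -lJ; exact: (integral_cst lam (mJ s) `|C|%:E).
Qed.

Lemma norm_Rintegral_itv s C (phi : R -> R) : 0 < s ->
  lam.-integrable `]0, s[ (EFin \o phi) ->
  (forall t, 0 < t < s -> `|phi t| <= C) ->
  `|\int[lam]_(t in `]0, s[) phi t| <= s * C.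
Proof.
move=> s0 iphi phiC; have [iC <-] := Rintegral_cst_itv C s0.
apply: le_trans (le_normr_Rintegral (mJ s) iphi) _.
apply: (le_Rintegral (mJ s)); [exact: integrable_norm|exact: iC|].
by move=> t; rewrite /= in_itv/=; exact: phiC.
Qed.

(** The difference of [f] is almost everywhere the segment integral of [f']. Fubini applies with
    Young's majorant for the product of [q] with a translate of [f']. *)
Lemma diff_fubini i s f f' q : 0 < s -> L2_deriv i f f' -> L2per a b q ->
  lam.-integrable `]0, s[
    (EFin \o (fun t => I (fun x => q x * translate i t f' x))) /\
  I (fun x => q x * (translate i s f x - f x)) =
  \int[lam]_(t in `]0, s[) I (fun x => q x * translate i t f' x).
Proof.
move=> s0 ff' Lq; have [Lf Lf' _] := ff'; have [mq pq iq] := Lq.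
have [mf pf _] := Lf; have [mf' pf' _] := Lf'.
have L1f' := L2per_L1per ab Lf'.
have [||| _ Iphi E] := line_fubini ab (i := i) s0 mq L1f'
    (L1perZ 2^-1 (L2per_sqr Lq)) (L1perZ 2^-1 (L2per_sqr Lf')).
- by move=> x; rewrite mulr_ge0 ?sqr_ge0.
- by move=> x; rewrite mulr_ge0 ?sqr_ge0.
- by move=> x t _ _; exact: normM_half.
split; first exact: Iphi.
rewrite -E; apply: eq_Rintegral_ae.
- apply: measurable_funM => //; apply: measurable_funB => //.
  exact: measurable_translate.
- by apply: measurable_funM => //; exact: measurable_line_integral.
have := weak_deriv_translate ab s0 (L2_deriv_weak ff').
by apply: filterS => x /= H Bx; rewrite H.
Qed.

Lemma norm_diff i s t f f' q : 0 < s -> L2_deriv i f f' -> L2per a b q ->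
  `|I (fun x => translate i t q x * (translate i s f x - f x))| <=
  s * (2^-1 * (I (fun x => f' x ^+ 2) + I (fun x => q x ^+ 2))).
Proof.
move=> s0 ff' Lq; have [_ Lf' _] := ff'.
have [iphi ->] := diff_fubini s0 ff' (L2per_translate ab i t Lq).
apply: norm_Rintegral_itv => // r _.
apply: le_trans (norm_RintegralM (L2per_translate ab i t Lq) (L2per_translate ab i r Lf')) _.
rewrite -[I (fun x => f' x ^+ 2)](Rintegral_translate ab i r (L2per_sqr Lf')).
rewrite -[I (fun x => q x ^+ 2)](Rintegral_translate ab i t (L2per_sqr Lq)).
by rewrite addrC.
Qed.

(** Because [g] is differentiable as well, the error is quadratic in [s], and no continuity of
    translations in L^2 is invoked. *)
Lemma diff_quotient i s f f' g g' : 0 < s -> L2_deriv i f f' -> L2_deriv i g g' ->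
  `|I (fun x => g x * (translate i s f x - f x)) - s * I (fun x => g x * f' x)| <=
  s * (s * (2^-1 * (I (fun x => g' x ^+ 2) + I (fun x => f' x ^+ 2)))).
Proof.
move=> s0 ff' gg'; have [_ Lf' _] := ff'; have [Lg Lg' _] := gg'.
have [iphi ->] := diff_fubini s0 ff' Lg.
set c := I (fun x => g x * f' x).
have [ic <-] := Rintegral_cst_itv c s0.
rewrite -(RintegralB (mJ s) iphi ic).
apply: norm_Rintegral_itv => //; first exact: (integrableB (mJ s) iphi ic).
move=> t /andP[t0 ts].
(* Replacing the integral of g f' by that of its translate leaves a difference of [g] only, against
   the translated [f']; by [norm_diff] this is of order [t]. *)
rewrite /c /= -(Rintegral_translate ab i t (L2perM_L1per Lg Lf')).
rewrite -RintegralB_box; last 2 first.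
- by have [] := L2perM_L1per Lg (L2per_translate ab i t Lf').
- by have [] := L2perM_L1per (L2per_translate ab i t Lg) (L2per_translate ab i t Lf').
rewrite -normrN -mulN1r -RintegralZ_box; last first.
  apply: box_integrableB.
    by have [] := L2perM_L1per Lg (L2per_translate ab i t Lf').
  by have [] := L2perM_L1per (L2per_translate ab i t Lg) (L2per_translate ab i t Lf').
have -> : I (fun x => -1 * (g x * translate i t f' x -
      translate i t (fun y => g y * f' y) x)) =
    I (fun x => translate i t f' x * (translate i t g x - g x)).
  by apply: eq_Rintegral => x _; rewrite /translate; ring.
apply: le_trans (norm_diff t t0 gg' Lf') _.
apply: ler_wpM2r; last exact: ltW.
by rewrite mulr_ge0// addr_ge0//; apply: Rintegral_ge0 => x _; exact: sqr_ge0.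
Qed.

(** The difference of f g under a translation by [s] has integral zero and splits into g times the
    difference of f, f times the difference of g, and the product of both differences. The first two
    are [s * c2] and [s * c1] up to order s^2, the third is of order s^2. Dividing by [s] and
    letting [s] tend to 0 gives c1 + c2 = 0. *)
Lemma L2_deriv_by_parts i f f' g g' : L2_deriv i f f' -> L2_deriv i g g' ->
  I (fun x => f x * g' x) = - I (fun x => f' x * g x).
Proof.
move=> ff' gg'; have [Lf Lf' _] := ff'; have [Lg Lg' _] := gg'.
set A := I (fun x => f' x ^+ 2); set B := I (fun x => g' x ^+ 2).
have A0 : 0 <= A by apply: Rintegral_ge0 => x _; exact: sqr_ge0.
have B0 : 0 <= B by apply: Rintegral_ge0 => x _; exact: sqr_ge0.
apply/eqP; rewrite -addr_eq0.
rewrite (_ : I (fun x => f' x * g x) = I (fun x => g x * f' x)); last first.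
  by apply: eq_Rintegral => x _; rewrite mulrC.
set c1 := I (fun x => f x * g' x); set c2 := I (fun x => g x * f' x).
(* Each of the three errors is at most s^2 (A + B) / 2, so the factor 3/2 would do; 2 leaves
   room. *)
have key s : 0 < s -> `|c1 + c2| <= s * (2 * (A + B)).
  move=> s0.
  have Lfs := L2per_translate ab i s Lf; have Lgs := L2per_translate ab i s Lg.
  have LfsB : L2per a b (fun x => translate i s f x - f x).
    by have := L2perD Lfs (L2perZ (-1) Lf); under eq_fun do rewrite mulN1r.
  have LgsB : L2per a b (fun x => translate i s g x - g x).
    by have := L2perD Lgs (L2perZ (-1) Lg); under eq_fun do rewrite mulN1r.
  have Q1 := diff_quotient s0 ff' gg'.
  have Q2 := diff_quotient s0 gg' ff'.
  have Q3 : `|I (fun x => (translate i s g x - g x) * (translate i s f x - f x))| <=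
      s * (s * (2^-1 * (B + A))).
    have [iphi ->] := diff_fubini s0 ff' LgsB.
    apply: norm_Rintegral_itv => // t _.
    under eq_Rintegral do rewrite mulrC.
    exact: norm_diff.
  have E : I (fun x => g x * (translate i s f x - f x)) +
      I (fun x => f x * (translate i s g x - g x)) +
      I (fun x => (translate i s g x - g x) * (translate i s f x - f x)) = 0.
    have [_ _ i1] := L2perM_L1per Lg LfsB.
    have [_ _ i2] := L2perM_L1per Lf LgsB.
    have [_ _ i3] := L2perM_L1per LgsB LfsB.
    have Lfg := L2perM_L1per Lf Lg; have [_ _ ifg] := Lfg.
    have [_ _ ifgs] := L1per_translate ab i s Lfg.
    rewrite -(RintegralD_box i1 i2) -(RintegralD_box (box_integrableD i1 i2) i3).
    transitivity (I (fun x => translate i s (fun y => f y * g y) x - f x * g x)).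
      by apply: eq_Rintegral => x _; rewrite /translate; ring.
    by rewrite RintegralB_box// Rintegral_translate// subrr.
  move: Q1 Q2 Q3 E; rewrite -/A -/B -/c1 -/c2.
  set x1 := I (fun x => g x * (translate i s f x - f x)).
  set x2 := I (fun x => f x * (translate i s g x - g x)).
  set x3 := I (fun x => (translate i s g x - g x) * (translate i s f x - f x)).
  move: x1 x2 x3 => x1 x2 x3 /ler_normlP[Q1 Q1'] /ler_normlP[Q2 Q2'].
  move=> /ler_normlP[Q3 Q3'] E.
  rewrite -(ler_pM2l s0) -[X in X * `|_|](gtr0_norm s0) -normrM ler_norml.
  by apply/andP; split; nra.
rewrite -normr_le0; apply/ler_addgt0Pl => eta eta0; rewrite addr0.
have K0 : 0 < 2 * (A + B) + 1 by lra.
apply: le_trans (key (eta / (2 * (A + B) + 1)) (divr_gt0 eta0 K0)) _.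
by rewrite mulrAC ler_pdivrMr// ler_pM2l//; lra.
Qed.

Lemma weak_partialM_smooth i g g' zeta : smooth zeta -> box_periodic a b zeta ->
  L2_deriv i g g' ->
  L2_deriv i (fun x => g x * zeta x) (fun x => g' x * zeta x + g x * partial i zeta x).
Proof.
move=> sz pz [Lg Lg' gg'].
have sp := smooth_partial i sz; have pp := box_periodic_partial i pz.
have Lgp : L2per a b (fun x => g x * partial i zeta x) by exact: L2perM_smooth.
have Lgz : L2per a b (fun x => g' x * zeta x) by exact: L2perM_smooth.
split; [exact: L2perM_smooth|exact: L2perD|].
move=> psi spsi ppsi.
have sM : smooth (fun x => zeta x * psi x) by exact: smoothM.
have pM : box_periodic a b (fun x => zeta x * psi x).
  by move=> j x; rewrite pz ppsi.
have [_ _ i1] := L1perM_smooth (smooth_partial i sM) (box_periodic_partial i pM)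
  (L2per_L1per ab Lg).
have [_ _ i2] := L1perM_smooth spsi ppsi (L2per_L1per ab Lgp).
have [_ _ i3] := L1perM_smooth spsi ppsi (L2per_L1per ab Lgz).
transitivity (I (fun x => g x * partial i (fun y => zeta y * psi y) x -
    g x * partial i zeta x * psi x)).
  by apply: eq_Rintegral => x _; rewrite partialM//; ring.
rewrite (RintegralB_box i1 i2) (gg' _ sM pM).
under [in RHS]eq_Rintegral do rewrite mulrDl.
rewrite (RintegralD_box i3 i2) opprD; congr (- _ - _).
by apply: eq_Rintegral => x _; rewrite mulrA.
Qed.

(** The test function is attached to [g]: the product g zeta is again in H^1 in direction [i], and
    integration by parts against [f] gives the product rule. *)
Lemma weak_derivM i f f' g g' : L2_deriv i f f' -> L2_deriv i g g' ->
  weak_deriv a b i (fun x => f x * g x) (fun x => f' x * g x + f x * g' x).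
Proof.
move=> ff' gg'; have [Lf Lf' _] := ff'; have [Lg Lg' _] := gg'.
have Lfg := L2perM_L1per Lf Lg.
have Lf'g := L2perM_L1per Lf' Lg; have Lfg' := L2perM_L1per Lf Lg'.
split=> //; first exact: L1perD.
move=> zeta sz pz.
have gz := weak_partialM_smooth sz pz gg'.
have [_ _ i1] := L1perM_smooth sz pz Lf'g.
have [_ _ i2] := L1perM_smooth sz pz Lfg'.
have [_ _ i3] := L1perM_smooth (smooth_partial i sz) (box_periodic_partial i pz) Lfg.
have H : I (fun x => f x * g' x * zeta x) + I (fun x => f x * g x * partial i zeta x) =
    - I (fun x => f' x * g x * zeta x).
  rewrite -(RintegralD_box i2 i3).
  transitivity (I (fun x => f x * (g' x * zeta x + g x * partial i zeta x))).
    by apply: eq_Rintegral => x _; rewrite mulrDr !mulrA.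
  rewrite (L2_deriv_by_parts ff' gz); congr (- _).
  by apply: eq_Rintegral => x _; rewrite mulrA.
transitivity (- (I (fun x => f' x * g x * zeta x) + I (fun x => f x * g' x * zeta x))).
  by lra.
congr (- _); rewrite -(RintegralD_box i1 i2).
by apply: eq_Rintegral => x _; rewrite mulrDl.
Qed.

End integration_by_parts.

(** * Embedding of H^1 into L^4 *)

Section line_integral_ereal.
Context {R : realType} {D : nat}.
Variables (a b : 'rV[R]_D).
Hypothesis ab : forall i, a ord0 i < b ord0 i.
Implicit Types (f g k : 'rV[R]_D -> R) (i : 'I_D) (s t : R).
Local Notation mu := (lebesgue_rV R D).
Local Notation lam := (@lebesgue_measure R).
Local Notation L i := (b ord0 i - a ord0 i).

(** The integral over a full period of the line through [x], kept extended because it may be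
    infinite on a null set. For periodic [k] it is constant along direction [i], which
    Ladyzhenskaya's argument exploits. *)
Definition line_total i k : 'rV[R]_D -> \bar R :=
  fun x => (\int[lam]_(t in `]0%R, (L i)[) (k (x + t *: delta_mx ord0 i)%R)%:E)%E.

Let L0 i : 0 < L i. Proof. by rewrite subr_gt0. Qed.

Let mJ s : measurable (`]0, s[%classic : set (measurableTypeR R)).
Proof. exact: measurable_itv. Qed.

Let measurable_line i k : measurable_fun setT k ->
  measurable_fun setT (fun z : 'rV[R]_D * measurableTypeR R =>
    (k (z.1 + z.2 *: delta_mx ord0 i))%:E).
Proof.
move=> mk; apply/measurable_EFinP.
exact: (measurableT_comp mk (measurable_shift2 i)).
Qed.

Lemma line_total_ge0 i k x : (forall x, 0 <= k x) -> (0 <= line_total i k x)%E.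
Proof. by move=> k0; apply: integral_ge0 => t _; rewrite lee_fin. Qed.

Lemma measurable_line_total i k : measurable_fun setT k -> (forall x, 0 <= k x) ->
  measurable_fun setT (line_total i k).
Proof.
move=> mk k0.
apply: (measurable_integral_in1 lam (mJ (L i)) (measurable_line i mk)) => z.
by rewrite lee_fin.
Qed.

Lemma line_total_shift i k s x : measurable_fun setT k -> (forall x, 0 <= k x) ->
  (forall x, k (x + L i *: delta_mx ord0 i) = k x) ->
  line_total i k (x + s *: delta_mx ord0 i) = line_total i k x.
Proof.
move=> mk k0 pk; rewrite /line_total.
have mkx : measurable_fun setT
    (fun t : measurableTypeR R => (k (x + t *: delta_mx ord0 i))%:E).
  exact: (measurableT_comp (measurable_line i mk) (measurable_pair1 x)).
have k0' t : (0 <= (k (x + t *: delta_mx ord0 i)%R)%:E)%E by rewrite lee_fin.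
have pk' t : (k (x + (t + (L i - 0)) *: delta_mx ord0 i))%:E =
    (k (x + t *: delta_mx ord0 i))%:E.
  by rewrite subr0 scalerDl addrA pk.
rewrite -[RHS](ge0_integral_periodic s (L0 i) mkx k0' pk').
by apply: eq_integral => t _; rewrite [t + s]addrC scalerDl addrA.
Qed.

Lemma integral_line_total i k : measurable_fun setT k -> (forall x, 0 <= k x) ->
  (forall x, k (x + L i *: delta_mx ord0 i) = k x) ->
  (\int[mu]_(x in box a b) line_total i k x =
   (L i)%:E * \int[mu]_(x in box a b) (k x)%:E)%E.
Proof.
move=> mk k0 pk.
have F0 (z : 'rV[R]_D * measurableTypeR R) :
  (0 <= (k (z.1 + z.2 *: delta_mx ord0 i)%R)%:E)%E by rewrite lee_fin.
rewrite /line_total.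
have /= -> := fubini_tonelli_in mu lam (measurable_box a b) (mJ (L i))
  (measurable_line i mk) F0.
transitivity (\int[lam]_(t in `]0%R, (L i)[)
    cst (\int[mu]_(x in box a b) (k x)%:E)%E t)%E.
  apply: eq_integral => t _.
  apply: (@integral_rV_translation _ _ a b (EFin \o k) i t (ab i)).
  - exact/measurable_EFinP.
  - by move=> x; rewrite /= lee_fin.
  - by move=> x; rewrite /= pk.
have lJ : lam (`]0%R, (L i)[%classic : set R) = (L i)%:E.
  by rewrite lebesgue_measure_itv/= lte_fin L0 sube0.
by rewrite muleC -lJ; exact: (integral_cst lam (mJ (L i))).
Qed.

(** The embedding of W^{1,1} into bounded functions on almost every line: |f(x)| is at most |f(x + t
    e_i)| plus the integral of |g| over the whole line, and averaging over [t] in a period gives the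
    claim. *)
Lemma weak_deriv_line_total i f g : weak_deriv a b i f g ->
  {ae mu, forall x, box a b x ->
    ((L i * `|f x|)%:E <= line_total i (fun y => `|f y| + L i * `|g y|)%R x)%E}.
Proof.
move=> fg; have [[mf pf jf] [mg pg ig] _] := fg.
have maf : measurable_fun setT (fun x => `|f x|) by exact: measurableT_comp.
have mag : measurable_fun setT (fun x => `|g x|) by exact: measurableT_comp.
pose ng y := `|g y|.
have g0 x : 0 <= ng x by exact: normr_ge0.
pose F (z : 'rV[R]_D * measurableTypeR R) := (line_total i ng z.1 +
  ((`|f (z.1 + z.2 *: delta_mx ord0 i)| - `|f z.1|)%R)%:E)%E.
have mF : measurable_fun setT F.
  apply: emeasurable_funD.
    exact: (measurableT_comp (measurable_line_total i mag g0) measurable_fst).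
  apply/measurable_EFinP; apply: measurable_funB.
    exact: (measurableT_comp maf (measurable_shift2 i)).
  exact: (measurableT_comp maf measurable_fst).
(* The inequality for fixed [t] is expressed as nonnegativity of a measurable [F], so that its
   exceptional set in (x, t) is measurable. Only finite quantities are subtracted in [F]. *)
pose P : set ('rV[R]_D * measurableTypeR R) := F @^-1` `[0%E, +oo[.
have mP : measurable P.
  by rewrite -[X in measurable X]setTI; apply: mF => //; exact: emeasurable_itv.
have hP t : `]0, (L i)[%classic t -> {ae mu, forall x, box a b x -> P (x, t)}.
  rewrite /= in_itv/= => /andP[t0 tL].
  apply: filterS (weak_deriv_translate ab t0 fg) => x /= E Bx.
  rewrite /P/= in_itv/= andbT /F/=.
  have {}E := E Bx.
  have le1 : (`|line_integral i t g x|%:E <= line_total i ng x)%E.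
    have mgx : measurable_fun setT
        (fun r : measurableTypeR R => (g (x + r *: delta_mx ord0 i))%:E).
      apply/measurable_EFinP; apply: (measurableT_comp mg).
      exact: (measurableT_comp (measurable_shift2 i) (measurable_pair1 x)).
    apply: (@le_trans _ _ `|\int[lam]_(r in `]0%R, t[)
        (g (x + r *: delta_mx ord0 i)%R)%:E|%E).
      rewrite /line_integral /Rintegral; case: (integral _ _ _) => //=.
        by rewrite normr0 leey.
      by rewrite normr0 leey.
    apply: le_trans (le_abse_integral lam (mJ t) (measurable_funTS mgx)) _.
    apply: (ge0_subset_integral lam (mJ t) (mJ (L i))) => //.
    - by apply: measurableT_comp => //; exact: measurable_funTS.
    - by apply: subset_itvl; rewrite bnd_simp ltW.
  apply: (@le_trans _ _ (`|line_integral i t g x|%:E +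
      (`|f (x + t *: delta_mx ord0 i)%R| - `|f x|)%R%:E)%E); last exact: leeD2r.
  rewrite -EFinD lee_fin -E /translate.
  have := ler_normB (f x) (f (x + t *: delta_mx ord0 i)).
  have := lerB_dist (f x) (f (x + t *: delta_mx ord0 i)).
  by rewrite distrC; lra.
(* From almost every [x] for each [t] to almost every [t] for almost every [x]; the latter can be
   integrated in [t]. *)
have := @ae_slice_swap _ _ _ _ _ mu lam _ _ P (measurable_box a b) (mJ (L i)) mP hP.
apply: filterS => x /= H Bx; have {}H := H Bx.
have mfx : measurable_fun setT
    (fun t : measurableTypeR R => `|f (x + t *: delta_mx ord0 i)|%:E).
  exact: (measurableT_comp (measurable_line i maf) (measurable_pair1 x)).
have mgx : measurable_fun setT
    (fun t : measurableTypeR R => `|g (x + t *: delta_mx ord0 i)|%:E).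
  exact: (measurableT_comp (measurable_line i mag) (measurable_pair1 x)).
have lJ : lam (`]0%R, (L i)[%classic : set R) = (L i)%:E.
  by rewrite lebesgue_measure_itv/= lte_fin L0 sube0.
set c := line_total i ng x in H.
have c0 : (0 <= c)%E by exact: line_total_ge0.
(* The total [c] of |g| does not depend on [t], so L c is the integral of [c] over a period. *)
have -> : line_total i (fun y => `|f y| + L i * `|g y|)%R x =
    (\int[lam]_(t in `]0%R, (L i)[) (`|f (x + t *: delta_mx ord0 i)%R|%:E + c))%E.
  have mc : measurable_fun `]0%R, (L i)[ (fun _ : measurableTypeR R => c).
    exact: measurable_cst.
  rewrite (ge0_integralD lam (mJ (L i)) (fun t _ => _) (measurable_funTS mfx)
    (fun _ _ => c0) mc); last by move=> t _.
  have -> : (\int[lam]_(t in `]0%R, (L i)[) c = (L i)%:E * c)%E.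
    by rewrite muleC -lJ; exact: (integral_cst lam (mJ (L i))).
  have L0' : (0 <= (L i)%:E)%E by rewrite lee_fin ltW.
  have ng0 (t : R) : (0 <= (ng (x + t *: delta_mx ord0 i)%R)%:E)%E by rewrite lee_fin.
  have Lng0 (t : R) : (0 <= (L i)%:E * (ng (x + t *: delta_mx ord0 i)%R)%:E)%E.
    by rewrite mule_ge0.
  rewrite /c /line_total.
  rewrite -(ge0_integralZl lam (mJ (L i)) (measurable_funTS mgx) (fun t _ => ng0 t) L0').
  rewrite -(ge0_integralD lam (mJ (L i)) (fun t _ => _) (measurable_funTS mfx)
    (fun t _ => Lng0 t)); first exact: eq_integral.
  - by move=> t _.
  - by apply: measurable_funTS; exact: emeasurable_funM.
have -> : (L i * `|f x|)%:E = (\int[lam]_(t in `]0%R, (L i)[) cst `|f x|%:E t)%E.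
  by rewrite EFinM muleC -lJ; apply/esym; exact: (integral_cst lam (mJ (L i))).
apply: (ae_ge0_le_integral (mJ (L i))).
- by move=> t _; rewrite lee_fin.
- exact: measurable_cst.
- by move=> t _; apply: adde_ge0.
- apply: emeasurable_funD; first exact: measurable_funTS.
  by apply: measurable_funTS; exact: measurable_cst.
apply: filterS H => t /= H Jt.
have := H Jt; rewrite /P/= in_itv/= andbT /F/= -/c EFinB addeA sube_ge0//.
by rewrite addeC.
Qed.

End line_integral_ereal.

Section slices.
Context {R : realType} {n : nat}.
Variables (a b : 'rV[R]_n.+1).

(** The exceptional set lies in a measurable null set, almost all of whose slices are null by
    Tonelli. *)
Lemma ae_rV_cons (P : set 'rV[R]_n.+1) :
  {ae lebesgue_rV R n.+1, forall x, box a b x -> P x} ->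
  {ae @lebesgue_measure R, forall y, `]a ord0 ord0, b ord0 ord0[%classic y ->
    {ae lebesgue_rV R n, forall v,
       box (rV_uncons a).2 (rV_uncons b).2 v -> P (rV_cons (y, v))}}.
Proof.
move=> [N [mN N0 PN]].
pose chi x : \bar R := (\1_N x)%:E.
have mchi : measurable_fun setT chi.
  by apply/measurable_EFinP; exact: measurable_indic.
have chi0 x : (0 <= chi x)%E by rewrite lee_fin.
have mchic : measurable_fun setT (chi \o @rV_cons R n).
  by apply: measurableT_comp => //; exact: measurable_rV_cons.
have I0 : (\int[lebesgue_rV R n.+1]_(x in box a b) chi x = 0)%E.
  rewrite integral_indic//; last exact: measurable_box.
  by apply: (subset_measure0 _ mN _ N0); [apply: measurableI => //;
    exact: measurable_box|exact: subIsetl].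
have mB := measurable_box (rV_uncons a).2 (rV_uncons b).2.
have mJ : measurable (`]a ord0 ord0, b ord0 ord0[%classic : set (measurableTypeR R)).
  exact: measurable_itv.
have : ae_eq (@lebesgue_measure R) `]a ord0 ord0, b ord0 ord0[%classic
    (fun y => \int[lebesgue_rV R n]_(v in box (rV_uncons a).2 (rV_uncons b).2)
       chi (rV_cons (y, v)))%E (cst 0%E).
  apply/ae_eq_integral_abs => //.
    apply: measurable_funTS; apply: (measurable_integral_in1 _ mB mchic).
    by move=> z; exact: chi0.
  rewrite -[RHS]I0 (integral_rV_cons a b mchi chi0).
  by apply: eq_integral => y _; rewrite gee0_abs//; exact: integral_ge0.
apply: filterS => y /= H Iy; have {}H := H Iy.
have : ae_eq (lebesgue_rV R n) (box (rV_uncons a).2 (rV_uncons b).2)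
    (fun v => chi (rV_cons (y, v))) (cst 0%E).
  apply/ae_eq_integral_abs => //.
    apply: measurable_funTS; exact: (measurableT_comp mchic (measurable_pair1 y)).
  by rewrite -[RHS]H; apply: eq_integral => v _; rewrite gee0_abs.
apply: filterS => v /= chiv Bv; apply: contrapT => nP.
have := chiv Bv; rewrite /chi indicE mem_set; first by move=> [] /eqP; rewrite oner_eq0.
apply: PN => /=; apply/not_implyP; split=> //.
exact/box_cons.
Qed.

End slices.

Lemma ge0_box_integrable (R : realType) D (a b : 'rV[R]_D) (f : 'rV[R]_D -> R) :
  measurable_fun setT f -> (forall x, 0 <= f x) ->
  (\int[lebesgue_rV R D]_(x in box a b) (f x)%:E < +oo)%E -> box_integrable a b f.
Proof.
move=> mf f0 foo; apply/integrableP; split.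
  by apply/measurable_EFinP; exact: measurable_funTS.
apply: le_lt_trans foo; rewrite le_eqVlt; apply/orP; left; apply/eqP.
by apply: eq_integral => x _; rewrite /= ger0_norm.
Qed.

Lemma lty_pmul2l (R : realType) (c r : R) (x : \bar R) :
  0 < c -> (c%:E * x <= r%:E -> x < +oo)%E.
Proof.
move=> c0; case: x => [x _|H|//]; first exact: ltry.
by move: H; rewrite gt0_muley// lte_fin.
Qed.

(** * Ladyzhenskaya's estimate in the plane *)

Section L4_plane.
Context {R : realType}.
Variables (a b : 'rV[R]_2).
Hypothesis ab : forall i, a ord0 i < b ord0 i.
Local Notation mu := (lebesgue_rV R 2).
Local Notation lam := (@lebesgue_measure R).
Local Notation L i := (b ord0 i - a ord0 i).
Local Notation i0 := (ord0 : 'I_2).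
Local Notation i1 := (lift ord0 ord0 : 'I_2).
Local Notation I f := (\int[mu]_(x in box a b) f x).
Local Notation J := (`]a ord0 i0, b ord0 i0[%classic : set (measurableTypeR R)).
Local Notation B := (box (rV_uncons a).2 (rV_uncons b).2).

Let L0 i : 0 < L i. Proof. by rewrite subr_gt0. Qed.

Let mJ : measurable J. Proof. exact: measurable_itv. Qed.

Let mB : measurable B. Proof. exact: measurable_box. Qed.

Let lJ : lam J = (L i0)%:E.
Proof.
have := @lebesgue_measure_itv R `]a ord0 i0, b ord0 i0[.
by rewrite /= lte_fin ab => ->.
Qed.

Let lB : lebesgue_rV R 1 B = (L i1)%:E.
Proof.
rewrite lebesgue_rV_box ?big_ord1 ?rV_uncons2E// => i.
by rewrite !rV_uncons2E.
Qed.

(** In the plane, a function constant along one axis depends on the other coordinate alone, so the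
    integral of the product factorizes. *)
Lemma integral_product_plane (P Q : 'rV[R]_2 -> \bar R) :
  measurable_fun setT P -> measurable_fun setT Q ->
  (forall x, 0 <= P x)%E -> (forall x, 0 <= Q x)%E ->
  (forall x s, P (x + s *: delta_mx ord0 i0) = P x) ->
  (forall x s, Q (x + s *: delta_mx ord0 i1) = Q x) ->
  ((L i0 * L i1)%:E * \int[mu]_(x in box a b) (P x * Q x) =
   (\int[mu]_(x in box a b) P x) * (\int[mu]_(x in box a b) Q x))%E.
Proof.
move=> mP mQ P0 Q0 sP sQ.
pose p (v : 'rV[R]_1) := P (rV_cons (0, v)).
pose q (y : R) := Q (rV_cons (y, 0)).
have PE y v : P (rV_cons (y, v)) = p v.
  by rewrite /p -[RHS](sP _ y) rV_cons_shift0 add0r.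
have QE y (v : 'rV[R]_1) : Q (rV_cons (y, v)) = q y.
  rewrite /q -[RHS](sQ _ (v ord0 ord0)) rV_cons_shiftS add0r.
  by congr (Q (rV_cons (y, _))); apply/rowP => j; rewrite !mxE !ord1 eqxx mulr1.
have mc := @measurable_rV_cons R 1.
have mp : measurable_fun setT p.
  exact: (measurableT_comp (measurableT_comp mP mc) (measurable_pair1 (0 : R))).
have mq : measurable_fun setT (q : measurableTypeR R -> \bar R).
  exact: (measurableT_comp (measurableT_comp mQ mc) (measurable_pair2 (0 : 'rV[R]_1))).
have p0 v : (0 <= p v)%E by exact: P0.
have q0 y : (0 <= q y)%E by exact: Q0.
have EP : (\int[mu]_(x in box a b) P x = (L i0)%:E *
    \int[lebesgue_rV R 1]_(v in B) p v)%E.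
  rewrite (integral_rV_cons a b mP P0).
  transitivity (\int[lam]_(y in J) cst (\int[lebesgue_rV R 1]_(v in B) p v)%E y)%E.
    by apply: eq_integral => y _; apply: eq_integral => v _; rewrite PE.
  by rewrite muleC -lJ; exact: (integral_cst lam mJ).
have EQ : (\int[mu]_(x in box a b) Q x = (L i1)%:E * \int[lam]_(y in J) q y)%E.
  rewrite (integral_rV_cons a b mQ Q0).
  rewrite -(ge0_integralZl lam mJ (measurable_funTS mq)); last 2 first.
  - by move=> y _.
  - by rewrite lee_fin ltW.
  apply: eq_integral => y _.
  transitivity (\int[lebesgue_rV R 1]_(v in B) cst (q y) v)%E.
    by apply: eq_integral => v _; rewrite QE.
  by rewrite muleC -lB; exact: (integral_cst _ mB).
have EPQ : (\int[mu]_(x in box a b) (P x * Q x) =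
    \int[lebesgue_rV R 1]_(v in B) p v * \int[lam]_(y in J) q y)%E.
  rewrite (integral_rV_cons a b (emeasurable_funM mP mQ)); last first.
    by move=> x; apply: mule_ge0.
  have I0 : (0 <= \int[lebesgue_rV R 1]_(v in B) p v)%E.
    by apply: integral_ge0 => v _.
  rewrite -(ge0_integralZl lam mJ (measurable_funTS mq)) //.
  apply: eq_integral => y _.
  rewrite muleC -(ge0_integralZl _ mB (measurable_funTS mp)) //.
  by apply: eq_integral => v _; rewrite PE QE muleC.
by rewrite EP EQ EPQ EFinM muleACA.
Qed.

(** A positive upper bound [K] stands in for the integral of u^2, so no division by zero can occur
    when the weight in Young's inequality is chosen. *)
Lemma Rintegral_cauchy_schwarz (u g : 'rV[R]_2 -> R) K : 0 < K ->
  measurable_fun setT u -> measurable_fun setT g ->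
  box_integrable a b (fun x => u x ^+ 2) -> box_integrable a b (fun x => g x ^+ 2) ->
  I (fun x => u x ^+ 2) <= K ->
  box_integrable a b (fun x => `|u x * g x|) /\
  I (fun x => `|u x * g x|) ^+ 2 <= K * I (fun x => g x ^+ 2).
Proof.
move=> K0 mu_ mg iu ig uK.
have iug : box_integrable a b (fun x => `|u x * g x|).
  apply: (le_box_integrable (g := fun x => 2^-1 * u x ^+ 2 + 2^-1 * g x ^+ 2)).
  - by apply: measurableT_comp => //; exact: measurable_funM.
  - by apply: box_integrableD; exact: box_integrableZ.
  - by move=> x _; rewrite normr_id; exact: normM_half.
split=> //; set X := I (fun x => `|u x * g x|); set G := I (fun x => g x ^+ 2).
have X0 : 0 <= X by apply: Rintegral_ge0.
have young t : 0 < t -> X <= t / 2 * K + (t^-1) / 2 * G.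
  move=> t0; apply: (@le_trans _ _ (t / 2 * I (fun x => u x ^+ 2) + t^-1 / 2 * G)).
    rewrite -!RintegralZ_box// -RintegralD_box; last 2 first.
    - exact: box_integrableZ.
    - exact: box_integrableZ.
    apply: (le_Rintegral (measurable_box a b)) => //.
      by apply: box_integrableD; exact: box_integrableZ.
    move=> x _; have [r r0 ->] : exists2 r, r != 0 & t = r ^+ 2.
      by exists (Num.sqrt t); rewrite ?sqr_sqrtr ?ltW// gt_eqF// sqrtr_gt0.
    have -> : u x * g x = (r * u x) * (r^-1 * g x) by field.
    apply: le_trans (normM_half _ _) _.
    by rewrite !exprMn exprVn; lra.
  by rewrite lerD2r ler_wpM2l// divr_ge0// ltW.
have [->|Xn0] := eqVneq X 0.
  have G0 : 0 <= G by apply: Rintegral_ge0 => x _; exact: sqr_ge0.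
  by rewrite expr0n/=; apply: mulr_ge0 => //; exact: ltW.
have Xp : 0 < X by rewrite lt_neqAle eq_sym Xn0.
(* With the weight X / K the first term of Young's bound is X / 2, which the left-hand side
   absorbs. *)
have := young (X / K) (divr_gt0 Xp K0).
have -> : X / K / 2 * K = X / 2 by field; rewrite gt_eqF.
have -> : (X / K)^-1 / 2 * G = K * G / (2 * X) by field; rewrite !gt_eqF.
move=> H; have : X / 2 <= K * G / (2 * X) by lra.
rewrite ler_pdivlMr ?mulr_gt0// expr2.
by have -> : X / 2 * (2 * X) = X * X by field.
Qed.

(** Up to the sides, u^2 is bounded by its line totals in both directions; their product bounds u^4
    and has a factorized integral. The form is dictated by its use on slices of a three-dimensional
    function: it assumes only the line inequalities, not weak differentiability on the slice, it
    admits infinite gradient integrals, and for fixed [K] its right-hand side is linear in them, so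
    that it can be integrated over the slices. *)
Lemma L4_slice (u : 'rV[R]_2 -> R) (g : 'I_2 -> 'rV[R]_2 -> R) K : 0 < K ->
  measurable_fun setT u -> (forall j, measurable_fun setT (g j)) ->
  box_periodic a b u -> (forall j, box_periodic a b (g j)) ->
  (forall j, {ae mu, forall x, box a b x -> ((L j * `|u x * u x|)%:E <=
    line_total a b j (fun y => `|u y * u y| + L j * `|g j y * u y + u y * g j y|)%R x)%E}) ->
  (\int[mu]_(x in box a b) (`|u x * u x|)%:E <= K%:E)%E ->
  ((L i0 * L i1)%:E * \int[mu]_(x in box a b) (u x ^+ 4)%:E <=
   (2 * K ^+ 2)%:E
   + (4 * K * L i0 ^+ 2)%:E * \int[mu]_(x in box a b) (g i0 x ^+ 2)%:E
   + (4 * K * L i1 ^+ 2)%:E * \int[mu]_(x in box a b) (g i1 x ^+ 2)%:E)%E.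
Proof.
move=> K0 mu_ mg pu pg ae_le uK.
have C0 j : 0 < 4 * K * L j ^+ 2 by rewrite mulr_gt0 ?mulr_gt0// exprn_gt0.
have G0 j : (0 <= \int[mu]_(x in box a b) (g j x ^+ 2)%:E)%E.
  by apply: integral_ge0 => x _; rewrite lee_fin sqr_ge0.
have iG j : (\int[mu]_(x in box a b) (g j x ^+ 2)%:E < +oo)%E ->
    box_integrable a b (fun x => g j x ^+ 2).
  apply: ge0_box_integrable; first exact: measurable_funX.
  by move=> x; exact: sqr_ge0.
(* If a gradient integral is infinite, so is the right-hand side; otherwise real-valued integrals
   can be used. *)
have [g0oo|] := ltP (\int[mu]_(x in box a b) (g i0 x ^+ 2)%:E)%E +oo%E; last first.
  rewrite leye_eq => /eqP ->.
  by rewrite gt0_muley ?lte_fin// addey// addye ?leey// -ltNye; apply: lt_le_trans (mule_ge0 _ _) => //; rewrite ltW// lte_fin.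
have [g1oo|] := ltP (\int[mu]_(x in box a b) (g i1 x ^+ 2)%:E)%E +oo%E; last first.
  rewrite leye_eq => /eqP ->; rewrite gt0_muley ?lte_fin// addey ?leey// -ltNye.
  by apply: (@lt_le_trans _ _ 0%E) => //; rewrite adde_ge0 ?mule_ge0// lee_fin ltW// mulr_gt0// exprn_gt0.
have igs j : box_integrable a b (fun x => g j x ^+ 2).
  by have [k|] := unliftP ord0 j => ->; [rewrite (ord1 k)|]; exact: iG.
have iu : box_integrable a b (fun x => u x ^+ 2).
  apply: ge0_box_integrable; first exact: measurable_funX.
    by move=> x; exact: sqr_ge0.
  apply: (@le_lt_trans _ _ K%:E); last exact: ltry.
  apply: le_trans uK; rewrite le_eqVlt; apply/orP; left; apply/eqP.
  by apply: eq_integral => x _; rewrite -expr2 ger0_norm// sqr_ge0.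
have IuK : I (fun x => u x ^+ 2) <= K.
  rewrite -lee_fin EFin_Rintegral_box//; apply: le_trans uK.
  rewrite le_eqVlt; apply/orP; left; apply/eqP.
  by apply: eq_integral => x _; rewrite /= -expr2 ger0_norm// sqr_ge0.
have CS j := Rintegral_cauchy_schwarz K0 mu_ (mg j) iu (igs j) IuK.
pose k j y := `|u y * u y| + L j * `|g j y * u y + u y * g j y|.
have mk j : measurable_fun setT (k j).
  apply: measurable_funD; first by apply: measurableT_comp => //; exact: measurable_funM.
  apply: measurable_funM => //; apply: measurableT_comp => //.
  by apply: measurable_funD; exact: measurable_funM.
have k0 j x : 0 <= k j x by rewrite addr_ge0// mulr_ge0// ltW.
have pk j x : k j (x + L j *: delta_mx ord0 j) = k j x by rewrite /k pu pg.
have kE j x : k j x = u x ^+ 2 + 2 * L j * `|u x * g j x|.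
  rewrite /k -expr2 ger0_norm ?sqr_ge0//; congr (_ + _).
  have -> : g j x * u x + u x * g j x = 2 * (u x * g j x) by ring.
  by rewrite normrM ger0_norm//; ring.
have ik j : box_integrable a b (k j).
  rewrite (_ : k j = fun x => u x ^+ 2 + 2 * L j * `|u x * g j x|); last exact/funext.
  by apply: box_integrableD => //; apply: box_integrableZ; exact: (CS j).1.
have Ik j : I (k j) ^+ 2 <= 2 * K ^+ 2 + 8 * L j ^+ 2 * (K * I (fun x => g j x ^+ 2)).
  have [iX hX] := CS j.
  have -> : I (k j) = I (fun x => u x ^+ 2) + 2 * L j * I (fun x => `|u x * g j x|).
    rewrite -RintegralZ_box// -RintegralD_box//; last exact: box_integrableZ.
    by apply: eq_Rintegral => x _; exact: kE.
  set X := I (fun x => `|u x * g j x|) in hX *.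
  set x := I (fun x => u x ^+ 2) in IuK *.
  have x0 : 0 <= x by apply: Rintegral_ge0 => z _; exact: sqr_ge0.
  have : (x + 2 * L j * X) ^+ 2 <= 2 * x ^+ 2 + 8 * L j ^+ 2 * X ^+ 2.
    by have := sqr_ge0 (x - 2 * L j * X); lra.
  move=> /le_trans; apply; apply: lerD.
    by rewrite ler_pM2l// lerXn2r// nnegrE ltW.
  by rewrite ler_wpM2l// mulr_ge0// sqr_ge0.
have M0 j x : (0 <= line_total a b j (k j) x)%E by exact: line_total_ge0.
have mM j : measurable_fun setT (line_total a b j (k j)).
  exact: measurable_line_total.
have LL : 0 < L i0 * L i1 by rewrite mulr_gt0.
have EM j : (\int[mu]_(x in box a b) line_total a b j (k j) x = (L j * I (k j))%:E)%E.
  by rewrite integral_line_total// EFinM EFin_Rintegral_box.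
have EMM : (\int[mu]_(x in box a b)
    (line_total a b i0 (k i0) x * line_total a b i1 (k i1) x) =
    (I (k i0) * I (k i1))%:E)%E.
  have := integral_product_plane (mM i0) (mM i1) (M0 i0) (M0 i1)
    (fun x s => line_total_shift ab s x (mk i0) (k0 i0) (pk i0))
    (fun x s => line_total_shift ab s x (mk i1) (k0 i1) (pk i1)).
  rewrite (EM i0) (EM i1) -EFinM mulrACA [in RHS]EFinM => H; apply/eqP; move/eqP: H.
  by rewrite !eq_le !lee_pmul2l// lte_fin.
have u40 x : (0 <= (u x ^+ 4)%:E)%E by rewrite lee_fin exprn_even_ge0.
have mu4 : measurable_fun (box a b) (fun x => (u x ^+ 4)%:E).
  by apply: measurable_funTS; apply/measurable_EFinP; exact: measurable_funX.
(* The product of the two integrals is at most half the sum of their squares. With [Ik] this yields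
   the constants 2 K^2 and 4 K L^2. *)
apply: (@le_trans _ _ (I (k i0) * I (k i1))%:E); last first.
  rewrite -!EFin_Rintegral_box// -!EFinM -!EFinD lee_fin.
  have := Ik i0; have := Ik i1; have := sqr_ge0 (I (k i0) - I (k i1)).
  by lra.
rewrite -EMM -(ge0_integralZl mu (measurable_box a b) mu4 (fun x _ => u40 x)); last first.
  by rewrite lee_fin ltW.
apply: (ae_ge0_le_integral (measurable_box a b)).
- by move=> x _; rewrite mule_ge0// lee_fin ltW.
- exact: emeasurable_funM.
- by move=> x _; apply: mule_ge0.
- by apply: measurable_funTS; exact: emeasurable_funM.
apply: filterS2 (ae_le i0) (ae_le i1) => x /= H0 H1 Bx.
apply: le_trans (lee_pmul _ _ (H0 Bx) (H1 Bx)); last 2 first.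
- by rewrite lee_fin mulr_ge0// ltW.
- by rewrite lee_fin mulr_ge0// ltW.
by rewrite -!EFinM lee_fin -expr2 ger0_norm ?sqr_ge0//; rewrite le_eqVlt; apply/orP; left; apply/eqP; ring.
Qed.

End L4_plane.

(** * From the plane to dimension 3 *)

Section L4_embedding.
Context {R : realType}.

Lemma L4_embedding2 (a b : 'rV[R]_2) (ab : forall i, a ord0 i < b ord0 i)
    (u : 'rV[R]_2 -> R) (g : 'I_2 -> 'rV[R]_2 -> R) :
  (forall i, L2_deriv a b i u (g i)) -> box_integrable a b (fun x => u x ^+ 4).
Proof.
move=> ug; have [[mu_ pu iu] _ _] := ug ord0.
have Lg i : L2per a b (g i) by have [] := ug i.
have mg i : measurable_fun setT (g i) by have [] := Lg i.
have pg i : box_periodic a b (g i) by have [] := Lg i.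
have ig i : box_integrable a b (fun x => g i x ^+ 2) by have [] := Lg i.
set I2 := \int[lebesgue_rV R 2]_(x in box a b) (u x ^+ 2).
have I20 : 0 <= I2 by apply: Rintegral_ge0 => x _; exact: sqr_ge0.
have K0 : 0 < I2 + 1 by lra.
have uK : (\int[lebesgue_rV R 2]_(x in box a b) (`|u x * u x|)%:E <= (I2 + 1)%:E)%E.
  apply: (@le_trans _ _ I2%:E); last by rewrite lee_fin; lra.
  rewrite EFin_Rintegral_box// le_eqVlt; apply/orP; left; apply/eqP.
  by apply: eq_integral => x _; rewrite -expr2 ger0_norm// sqr_ge0.
have := L4_slice ab K0 mu_ mg pu pg
  (fun j => weak_deriv_line_total ab (weak_derivM ab (ug j) (ug j))) uK.
rewrite -(EFin_Rintegral_box (ig ord0)) -(EFin_Rintegral_box (ig (lift ord0 ord0))).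
rewrite -!EFinM -!EFinD => H.
apply: ge0_box_integrable; first exact: measurable_funX.
  by move=> x; rewrite exprn_even_ge0.
by apply: lty_pmul2l H; rewrite mulr_gt0// subr_gt0.
Qed.

(** The derivative in direction [ord0] bounds the L^2 norms of almost all slices by one constant;
    the other two derivatives feed the planar estimate on each slice, which is then integrated over
    the first coordinate. *)
Lemma L4_embedding3 (a b : 'rV[R]_3) (ab : forall i, a ord0 i < b ord0 i)
    (u : 'rV[R]_3 -> R) (g : 'I_3 -> 'rV[R]_3 -> R) :
  (forall i, L2_deriv a b i u (g i)) -> box_integrable a b (fun x => u x ^+ 4).
Proof.
move=> ug; have [[mu_ pu iu] _ _] := ug ord0.
have Lg i : L2per a b (g i) by have [] := ug i.
have mg i : measurable_fun setT (g i) by have [] := Lg i.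
have pg i : box_periodic a b (g i) by have [] := Lg i.
have ig i : box_integrable a b (fun x => g i x ^+ 2) by have [] := Lg i.
set a2 := (rV_uncons a).2; set b2 := (rV_uncons b).2.
have ab2 i : a2 ord0 i < b2 ord0 i by rewrite !rV_uncons2E.
pose L i := b ord0 i - a ord0 i.
have L0 i : 0 < L i by rewrite subr_gt0.
pose J : set (measurableTypeR R) := `]a ord0 ord0, b ord0 ord0[%classic.
have mJ : measurable J by exact: measurable_itv.
have lJ : lebesgue_measure J = (L ord0)%:E.
  have := @lebesgue_measure_itv R `]a ord0 ord0, b ord0 ord0[.
  by rewrite /= lte_fin ab => ->.
have mB := measurable_box a2 b2.
pose k i y := `|u y * u y| + L i * `|g i y * u y + u y * g i y|.
have mk i : measurable_fun setT (k i).
  apply: measurable_funD; first by apply: measurableT_comp => //; exact: measurable_funM.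
  apply: measurable_funM => //; apply: measurableT_comp => //.
  by apply: measurable_funD; exact: measurable_funM.
have k0 i x : 0 <= k i x by rewrite addr_ge0// mulr_ge0// ltW.
have pk i j x : k i (x + L j *: delta_mx ord0 j) = k i x by rewrite /k pu pg.
have ik i : box_integrable a b (k i).
  have [_ _ i1] := L2perM_L1per (And3 mu_ pu iu) (And3 mu_ pu iu).
  have [_ _ i2] := L2perM_L1per (And3 mu_ pu iu) (Lg i).
  have [_ _ i3] := L2perM_L1per (Lg i) (And3 mu_ pu iu).
  apply: box_integrableD; first exact: box_integrable_norm.
  by apply: box_integrableZ; apply: box_integrable_norm; exact: box_integrableD.
have M0 i x : (0 <= line_total a b i (k i) x)%E by exact: line_total_ge0.
have mM i : measurable_fun setT (line_total a b i (k i)).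
  exact: measurable_line_total.
have mc := @measurable_rV_cons R 2.
have mslice (f : 'rV[R]_3 -> R) y : measurable_fun setT f ->
    measurable_fun setT (fun v => f (rV_cons (y, v))).
  by move=> mf; exact: (measurableT_comp (measurableT_comp mf mc) (measurable_pair1 y)).
(* the total of [k ord0] along the lines in direction [ord0] depends only on
   the slice coordinates, which bounds all the slice norms of [u] at once *)
pose Kc := (\int[lebesgue_rV R 2]_(v in box a2 b2)
  line_total a b ord0 (k ord0) (rV_cons (0%R, v)))%E.
have Kc0 : (0 <= Kc)%E by apply: integral_ge0 => v _; exact: M0.
have KcE y : (\int[lebesgue_rV R 2]_(v in box a2 b2)
    line_total a b ord0 (k ord0) (rV_cons (y, v)) = Kc)%E.
  apply: eq_integral => v _; rewrite -[y]add0r -rV_cons_shift0.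
  exact: (line_total_shift ab y _ (mk ord0) (k0 ord0) (pk ord0 ord0)).
have Kcoo : (Kc < +oo)%E.
  have : ((L ord0)%:E * Kc =
      (L ord0 * \int[lebesgue_rV R 3]_(x in box a b) k ord0 x)%:E)%E.
    rewrite EFinM (EFin_Rintegral_box (ik ord0)).
    rewrite -(integral_line_total ab (mk ord0) (k0 ord0) (pk ord0 ord0)).
    rewrite (integral_rV_cons a b (mM ord0) (M0 ord0)).
    transitivity (\int[lebesgue_measure]_(y in J) cst Kc y)%E.
      by rewrite muleC -lJ; apply/esym; exact: (integral_cst _ mJ).
    by apply: eq_integral => y _; rewrite KcE.
  move=> H.
  have := lexx (L ord0 * \int[lebesgue_rV R 3]_(x in box a b) k ord0 x)%:E.
  by rewrite -{1}H; exact: lty_pmul2l (L0 ord0).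
(* On almost every slice the integral of u^2 is at most Kc / L; adding 1 makes [K] positive, as the
   planar estimate requires. *)
pose K := fine Kc / L ord0 + 1.
have K0 : 0 < K by rewrite ltr_wpDl// divr_ge0// ?fine_ge0// ltW.
have c0 : 0 < L (lift ord0 ord0) * L (lift ord0 (lift ord0 ord0)) by rewrite mulr_gt0.
set c := _ * _ in c0.
pose G j y := (\int[lebesgue_rV R 2]_(v in box a2 b2)
  (g (lift ord0 j) (rV_cons (y, v)) ^+ 2)%:E)%E.
pose C (j : 'I_2) := 4 * K * L (lift ord0 j) ^+ 2.
have C0 j : 0 <= C j by rewrite mulr_ge0 ?sqr_ge0// mulr_ge0// ltW.
have G0 j y : (0 <= G j y)%E by apply: integral_ge0 => v _; rewrite lee_fin sqr_ge0.
have mg2 j : measurable_fun setT (fun x => (g (lift ord0 j) x ^+ 2)%:E).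
  by apply/measurable_EFinP; exact: measurable_funX.
have mG j : measurable_fun setT (G j : measurableTypeR R -> \bar R).
  apply: (measurable_integral_in1 _ mB (measurableT_comp (mg2 j) mc)) => z /=.
  by rewrite lee_fin sqr_ge0.
have slice : {ae @lebesgue_measure R, forall y, J y ->
    (c%:E * \int[lebesgue_rV R 2]_(v in box a2 b2) (u (rV_cons (y, v)) ^+ 4)%:E <=
     (2 * K ^+ 2)%:E + (C ord0)%:E * G ord0 y
     + (C (lift ord0 ord0))%:E * G (lift ord0 ord0) y)%E}.
  have H i := ae_rV_cons
    (weak_deriv_line_total ab (weak_derivM ab (ug i) (ug i))).
  have FF : Filter (almost_everywhere (@lebesgue_measure R)).
    exact: ae_filter_ringOfSetsType.
  have H2 : {ae @lebesgue_measure R, forall y, forall j : 'I_2, J y ->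
      {ae lebesgue_rV R 2, forall v, box a2 b2 v ->
        ((L (lift ord0 j) * `|u (rV_cons (y, v)) * u (rV_cons (y, v))|)%:E <=
         line_total a b (lift ord0 j) (k (lift ord0 j)) (rV_cons (y, v)))%E}}.
    apply: (@filterS2 _ _ FF) (H (lift ord0 ord0)) (H (lift ord0 (lift ord0 ord0))) => y H1 H2 j Jy.
    have [j'|] := unliftP ord0 j => ->; last exact: H1.
    by rewrite (ord1 j'); exact: H2.
  apply: (@filterS2 _ _ FF) (H ord0) H2 => y Hy0 Hy Jy.
  have Lj j : b2 ord0 j - a2 ord0 j = L (lift ord0 j) by rewrite !rV_uncons2E.
  have := @L4_slice _ a2 b2 ab2 (fun v => u (rV_cons (y, v)))
    (fun j v => g (lift ord0 j) (rV_cons (y, v))) K K0 (mslice u y mu_)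
    (fun j => mslice _ y (mg (lift ord0 j))).
  rewrite !Lj; apply.
  - by move=> j v; rewrite -rV_cons_shiftS Lj pu.
  - by move=> i j v; rewrite -rV_cons_shiftS Lj pg.
  (* Lines in the directions [lift ord0 j] stay in the slice, so the line totals of the slice are
     those of the full space. *)
  - move=> j; apply: filterS (Hy j Jy) => v Hv Bv; rewrite Lj.
    apply: le_trans (Hv Bv) _; rewrite le_eqVlt; apply/orP; left; apply/eqP.
    rewrite /line_total Lj; apply: eq_integral => t _.
    by rewrite -rV_cons_shiftS.
  have muu : measurable_fun setT (fun v : 'rV[R]_2 =>
      `|u (rV_cons (y, v)) * u (rV_cons (y, v))|).
    by apply: measurableT_comp => //; apply: measurable_funM; exact: mslice.
  have L00 : (0 <= (L ord0)%:E)%E by rewrite lee_fin ltW.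
  apply: (@le_trans _ _ (fine Kc / L ord0)%:E); last by rewrite lee_fin lerDl.
  rewrite -(@lee_pmul2l _ (L ord0)%:E)//; last by rewrite lte_fin.
  rewrite -EFinM mulrCA mulfV ?gt_eqF// mulr1 fineK ?ge0_fin_numE//.
  have muuE : measurable_fun (box a2 b2) (fun v : 'rV[R]_2 =>
      `|u (rV_cons (y, v)) * u (rV_cons (y, v))|%:E).
    by apply/measurable_EFinP; exact: measurable_funTS.
  have uu0 (v : 'rV[R]_2) : (0 <= `|u (rV_cons (y, v)) * u (rV_cons (y, v))|%:E)%E.
    by rewrite lee_fin.
  rewrite -(KcE y) -(ge0_integralZl _ mB muuE (fun v _ => uu0 v) L00).
  apply: (ae_ge0_le_integral mB).
  - by move=> v _; rewrite -EFinM lee_fin mulr_ge0// ltW.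
  - by apply: emeasurable_funM; [exact: measurable_cst|exact: muuE].
  - by move=> v _; exact: M0.
  - apply: measurable_funTS.
    exact: (measurableT_comp (measurableT_comp (mM ord0) mc) (measurable_pair1 y)).
  by apply: filterS (Hy0 Jy) => v Hv Bv; rewrite -EFinM; exact: Hv.
have mu4 : measurable_fun setT (fun x => (u x ^+ 4)%:E).
  by apply/measurable_EFinP; exact: measurable_funX.
have u40 x : (0 <= (u x ^+ 4)%:E)%E by rewrite lee_fin exprn_even_ge0.
have mu4c : measurable_fun setT (fun y : measurableTypeR R =>
    \int[lebesgue_rV R 2]_(v in box a2 b2) (u (rV_cons (y, v)) ^+ 4)%:E)%E.
  by apply: (measurable_integral_in1 _ mB (measurableT_comp mu4 mc)) => z; exact: u40.
apply: ge0_box_integrable; first exact: measurable_funX.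
  by move=> x; rewrite exprn_even_ge0.
have IG j : (\int[lebesgue_measure]_(y in J) ((C j)%:E * G j y) =
    (C j * \int[lebesgue_rV R 3]_(x in box a b) (g (lift ord0 j) x ^+ 2))%:E)%E.
  have g20 x : (0 <= (g (lift ord0 j) x ^+ 2)%:E)%E by rewrite lee_fin sqr_ge0.
  rewrite (ge0_integralZl _ mJ (measurable_funTS (mG j)) (fun y _ => G0 j y));
    last by rewrite lee_fin.
  rewrite EFinM (EFin_Rintegral_box (ig (lift ord0 j))).
  by rewrite (integral_rV_cons a b (mg2 j) g20).
have K20 : (0 <= (2 * K ^+ 2)%:E)%E by rewrite lee_fin mulr_ge0 ?sqr_ge0.
have mK : measurable_fun J (fun=> (2 * K ^+ 2)%:E) by exact: measurable_cst.
have CG0 j y : (0 <= (C j)%:E * G j y)%E by rewrite mule_ge0// lee_fin.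
have mCG j : measurable_fun J (fun y => (C j)%:E * G j y)%E.
  by apply: emeasurable_funM => //; exact: measurable_funTS.
apply: (@lty_pmul2l _ c (2 * K ^+ 2 * L ord0
  + C ord0 * \int[lebesgue_rV R 3]_(x in box a b) (g (lift ord0 ord0) x ^+ 2)
  + C (lift ord0 ord0) *
    \int[lebesgue_rV R 3]_(x in box a b) (g (lift ord0 (lift ord0 ord0)) x ^+ 2))) => //.
rewrite (integral_rV_cons a b mu4 u40).
rewrite -(ge0_integralZl _ mJ (measurable_funTS mu4c)); last 2 first.
- by move=> y _; apply: integral_ge0 => v _; exact: u40.
- by rewrite lee_fin ltW.
apply: (@le_trans _ _ (\int[lebesgue_measure]_(y in J)
  ((2 * K ^+ 2)%:E + (C ord0)%:E * G ord0 y
     + (C (lift ord0 ord0))%:E * G (lift ord0 ord0) y))%E).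
  apply: (ae_ge0_le_integral mJ) slice.
  - move=> y _; apply: mule_ge0; first by rewrite lee_fin ltW.
    by apply: integral_ge0 => v _; exact: u40.
  - by apply: emeasurable_funM => //; exact: measurable_funTS.
  - by move=> y _; rewrite !adde_ge0.
  - by apply: emeasurable_funD => //; exact: emeasurable_funD.
rewrite (ge0_integralD _ mJ (fun y _ => adde_ge0 K20 (CG0 ord0 y))
  (emeasurable_funD mK (mCG ord0)) (fun y _ => CG0 (lift ord0 ord0) y)
  (mCG (lift ord0 ord0))).
rewrite (ge0_integralD _ mJ (fun y _ => K20) mK (fun y _ => CG0 ord0 y) (mCG ord0)).
rewrite (IG ord0) (IG (lift ord0 ord0)) !EFinD.
rewrite (_ : (\int[lebesgue_measure]_(y in J) (2 * K ^+ 2)%:E =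
  (2 * K ^+ 2 * L ord0)%:E)%E) //.
transitivity ((2 * K ^+ 2)%:E * lebesgue_measure J)%E; last by rewrite lJ.
exact: (integral_cst _ mJ).
Qed.

Lemma L4_embedding D (hD : D = 2%N \/ D = 3%N) (a b : 'rV[R]_D)
    (ab : forall i, a ord0 i < b ord0 i)
    (u : 'rV[R]_D -> R) (g : 'I_D -> 'rV[R]_D -> R) :
  (forall i, L2_deriv a b i u (g i)) -> box_integrable a b (fun x => u x ^+ 4).
Proof.
by case: hD => ?; subst D; [exact: L4_embedding2|exact: L4_embedding3].
Qed.

End L4_embedding.

(** * Functions in H^2 *)

Section weak_partials.
Context {R : realType} {D : nat}.
Variables (a b : 'rV[R]_D).
Hypothesis ab : forall i, a ord0 i < b ord0 i.
Implicit Types (f g h phi psi zeta : 'rV[R]_D -> R) (i j : 'I_D).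
Local Notation mu := (lebesgue_rV R D).
Local Notation I f := (\int[mu]_(x in box a b) f x).

Lemma L2per_measurable f : L2per a b f -> measurable_fun setT f.
Proof. by case. Qed.

Lemma ae_eqM_smooth f g zeta : smooth zeta -> measurable_fun setT f ->
  measurable_fun setT g -> f = g %[ae mu in box a b] ->
  I (fun x => f x * zeta x) = I (fun x => g x * zeta x).
Proof.
move=> sz mf mg fg; have [mz _] := smooth_bounded a b sz.
apply: eq_Rintegral_ae; [exact: measurable_funM|exact: measurable_funM|].
by apply: filterS fg => x /= fg Bx; rewrite fg.
Qed.

Lemma eq_is_weak_partial i f g h : measurable_fun setT f -> measurable_fun setT g ->
  f = g %[ae mu in box a b] -> is_weak_partial a b i f h -> is_weak_partial a b i g h.
Proof.
move=> mf mg fg fh zeta sz pz; rewrite -(fh zeta sz pz).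
apply/esym; exact: ae_eqM_smooth (smooth_partial i sz) mf mg fg.
Qed.

Lemma is_weak_partial_unique i f g h : L2per a b g -> L2per a b h ->
  is_weak_partial a b i f g -> is_weak_partial a b i f h ->
  g = h %[ae mu in box a b].
Proof.
move=> Lg Lh fg fh.
have [mg pg ig] := L2per_L1per ab Lg; have [mh ph ih] := L2per_L1per ab Lh.
have : annihilates_smooth a b (fun x => g x - h x).
  split; [exact: measurable_funB|exact: box_integrableB|].
  move=> zeta sz pz.
  have [_ _ i1] := L1perM_smooth sz pz (L2per_L1per ab Lg).
  have [_ _ i2] := L1perM_smooth sz pz (L2per_L1per ab Lh).
  under eq_Rintegral do rewrite mulrBl.
  rewrite (RintegralB_box i1 i2).
  by apply/eqP; rewrite subr_eq0 -eqr_opp -(fg zeta sz pz) -(fh zeta sz pz).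
move=> /(annihilates_smooth_ae0 ab); apply: filterS => x /= H Bx.
by apply/eqP; rewrite -subr_eq0; apply/eqP; exact: H.
Qed.

(** Once some weak derivative in L^2 exists, [xget] returns one instead of its default 0; the two
    agree almost everywhere because smooth periodic functions separate integrable functions. *)
Lemma weak_partialP i f g : L2per a b g -> is_weak_partial a b i f g ->
  [/\ L2per a b (weak_partial a b i f),
      is_weak_partial a b i f (weak_partial a b i f) &
      weak_partial a b i f = g %[ae mu in box a b]].
Proof.
move=> Lg fg.
have [Lw fw] : L2per a b (weak_partial a b i f) /\
    is_weak_partial a b i f (weak_partial a b i f).
  rewrite /weak_partial; case: xgetP => [h _ //|/(_ g)]; by case.
by split=> //; exact: is_weak_partial_unique Lw Lg fw fg.
Qed.

(** This is equality everywhere: almost equal functions have the same set of weak derivatives, and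
    [xget] depends only on that set. *)
Lemma eq_weak_partial i f g : measurable_fun setT f -> measurable_fun setT g ->
  f = g %[ae mu in box a b] -> weak_partial a b i f = weak_partial a b i g.
Proof.
move=> mf mg fg; rewrite /weak_partial; congr xget; apply/seteqP.
have gf : g = f %[ae mu in box a b] by apply: filterS fg => x /= fg Bx; rewrite fg.
by split=> h /= [Lh fh]; split=> //; exact: (eq_is_weak_partial _ _ _ fh).
Qed.

Lemma L2_derivD i f f' g g' : L2_deriv a b i f f' -> L2_deriv a b i g g' ->
  L2_deriv a b i (fun x => f x + g x) (fun x => f' x + g' x).
Proof.
move=> [Lf Lf' ff'] [Lg Lg' gg']; split; [exact: L2perD|exact: L2perD|].
move=> zeta sz pz.
have sp := smooth_partial i sz; have pp := box_periodic_partial i pz.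
have [_ _ i1] := L1perM_smooth sp pp (L2per_L1per ab Lf).
have [_ _ i2] := L1perM_smooth sp pp (L2per_L1per ab Lg).
have [_ _ i3] := L1perM_smooth sz pz (L2per_L1per ab Lf').
have [_ _ i4] := L1perM_smooth sz pz (L2per_L1per ab Lg').
under eq_Rintegral do rewrite mulrDl.
rewrite (RintegralD_box i1 i2) (ff' _ sz pz) (gg' _ sz pz) -opprD; congr (- _).
by rewrite -(RintegralD_box i3 i4); apply: eq_Rintegral => x _; rewrite mulrDl.
Qed.

Lemma L2_derivZ i c f f' : L2_deriv a b i f f' ->
  L2_deriv a b i (fun x => c * f x) (fun x => c * f' x).
Proof.
move=> [Lf Lf' ff']; split; [exact: L2perZ|exact: L2perZ|].
move=> zeta sz pz.
have sp := smooth_partial i sz; have pp := box_periodic_partial i pz.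
have [_ _ i1] := L1perM_smooth sp pp (L2per_L1per ab Lf).
have [_ _ i3] := L1perM_smooth sz pz (L2per_L1per ab Lf').
under eq_Rintegral do rewrite -mulrA.
rewrite (RintegralZ_box _ i1) (ff' _ sz pz) mulrN; congr (- _).
by rewrite -(RintegralZ_box _ i3); apply: eq_Rintegral => x _; rewrite mulrA.
Qed.

Definition H2_derivs phi := forall i,
  L2_deriv a b i phi (weak_partial a b i phi) /\
  forall j, L2_deriv a b j (weak_partial a b i phi)
    (weak_partial a b j (weak_partial a b i phi)).

(** The nested existential witnesses of [Hper] can be exchanged for the chosen versions
    [weak_partial], in terms of which the energies are written. *)
Lemma H2perP phi : H2per a b phi <-> L2per a b phi /\ H2_derivs phi.
Proof.
split.
  move=> [Lphi Hphi]; split=> // i.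
  have [g pg [Lg Hg]] := Hphi i.
  have [Lw pw wg] := weak_partialP Lg pg.
  split; first by split.
  move=> j; have [h gh Lh] := Hg j.
  have gw : g = weak_partial a b i phi %[ae mu in box a b].
    by apply: filterS wg => x /= wg Bx; rewrite wg.
  have wh := eq_is_weak_partial (L2per_measurable Lg) (L2per_measurable Lw) gw gh.
  by have [] := weak_partialP Lh wh.
move=> [Lphi Hphi]; split=> // i; have [[_ Lw pw] Hw] := Hphi i.
exists (weak_partial a b i phi) => //; split=> // j.
by have [_ Lh wh] := Hw j; exists (weak_partial a b j (weak_partial a b i phi)).
Qed.

(** The choice of versions is not linear, so derivatives of a combination are combinations of
    derivatives only almost everywhere. *)
Lemma H2per_comb c d phi psi : H2per a b phi -> H2per a b psi ->
  [/\ H2per a b (fun x => c * phi x + d * psi x),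
      forall i, weak_partial a b i (fun x => c * phi x + d * psi x) =
        (fun x => c * weak_partial a b i phi x + d * weak_partial a b i psi x)
        %[ae mu in box a b] &
      forall i j, weak_partial a b j (weak_partial a b i (fun x => c * phi x + d * psi x)) =
        (fun x => c * weak_partial a b j (weak_partial a b i phi) x +
          d * weak_partial a b j (weak_partial a b i psi) x)
        %[ae mu in box a b]].
Proof.
move=> /H2perP[Lphi Hphi] /H2perP[Lpsi Hpsi].
have comb i f f' g g' : L2_deriv a b i f f' -> L2_deriv a b i g g' ->
    L2_deriv a b i (fun x => c * f x + d * g x) (fun x => c * f' x + d * g' x).
  by move=> ff' gg'; apply: L2_derivD; exact: L2_derivZ.
set chi := fun x => _.
have H1 i := comb i _ _ _ _ (Hphi i).1 (Hpsi i).1.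
have P1 i : [/\ L2per a b (weak_partial a b i chi),
    is_weak_partial a b i chi (weak_partial a b i chi) &
    weak_partial a b i chi = (fun x => c * weak_partial a b i phi x +
      d * weak_partial a b i psi x) %[ae mu in box a b]].
  by have [_ Lw pw] := H1 i; exact: weak_partialP.
have H2 i j := comb j _ _ _ _ ((Hphi i).2 j) ((Hpsi i).2 j).
have E i : (fun x => c * weak_partial a b i phi x + d * weak_partial a b i psi x) =
    weak_partial a b i chi %[ae mu in box a b].
  by have [_ _ E] := P1 i; apply: filterS E => x /= E Bx; rewrite E.
have P2 i j : [/\ L2per a b (weak_partial a b j (weak_partial a b i chi)),
    is_weak_partial a b j (weak_partial a b i chi)
      (weak_partial a b j (weak_partial a b i chi)) &
    weak_partial a b j (weak_partial a b i chi) =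
      (fun x => c * weak_partial a b j (weak_partial a b i phi) x +
        d * weak_partial a b j (weak_partial a b i psi) x) %[ae mu in box a b]].
  have [Lw Lw' pw] := H2 i j; have [Lc _ _] := P1 i.
  apply: weak_partialP Lw' _.
  exact: eq_is_weak_partial (L2per_measurable Lw) (L2per_measurable Lc) (E i) pw.
split.
- apply/H2perP; split; first by apply: L2perD; exact: L2perZ.
  move=> i; have [Lc pc _] := P1 i; split.
    by split=> //; apply: L2perD; exact: L2perZ.
  by move=> j; have [] := P2 i j.
- by move=> i; have [] := P1 i.
- by move=> i j; have [] := P2 i j.
Qed.

Lemma L2per_sum n (F : 'I_n -> 'rV[R]_D -> R) : (forall k, L2per a b (F k)) ->
  L2per a b (fun x => \sum_(k < n) F k x).
Proof.
elim: n F => [|n IH] F LF.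
  under eq_fun do rewrite big_ord0.
  split; [exact: measurable_cst|by []|].
  by under eq_fun do rewrite expr0n/=; exact: box_integrable0.
under eq_fun do rewrite big_ord_recl.
by apply: L2perD => //; apply: IH => k.
Qed.

(** * Powers of an H^2 function and its Laplacian under integration by parts *)

Section H2_integrability.
Hypothesis hD : D = 2%N \/ D = 3%N.
Variable phi : 'rV[R]_D -> R.
Hypothesis Hphi : H2per a b phi.
Local Notation d i := (weak_partial a b i phi).
Local Notation dd i := (weak_partial a b i (weak_partial a b i phi)).

Let Lphi : L2per a b phi. Proof. by case: Hphi. Qed.
Let Ld i : L2per a b (d i).
Proof. by have /H2perP[_ H] := Hphi; have [[]] := H i. Qed.

Let phi_d i : L2_deriv a b i phi (d i).
Proof. by have /H2perP[_ H] := Hphi; have [] := H i. Qed.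

Let d_dd i : L2_deriv a b i (d i) (dd i).
Proof. by have /H2perP[_ H] := Hphi; have [_] := H i; exact. Qed.

Let phi4 : box_integrable a b (fun x => phi x ^+ 4).
Proof. exact: (L4_embedding hD ab phi_d). Qed.

Let d4 i : box_integrable a b (fun x => d i x ^+ 4).
Proof.
have /H2perP[_ H] := Hphi.
exact: (L4_embedding hD ab (H i).2).
Qed.

Lemma H2per_sqr : L2per a b (fun x => phi x ^+ 2).
Proof.
have [mphi pphi _] := Lphi; split; first exact: measurable_funX.
  by move=> i x; rewrite pphi.
by under eq_fun do rewrite -exprM.
Qed.

Let d_sqr i : L2per a b (fun x => d i x ^+ 2).
Proof.
have [mphi pphi _] := Ld i; split; first exact: measurable_funX.
  by move=> j x; rewrite pphi.
by under eq_fun do rewrite -exprM.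
Qed.

(** The product rule only puts the derivative in L^1. The fourth powers of phi and of its derivative
    raise it to L^2, so that the embedding can be applied to phi^2. *)
Let phi_sqr_deriv i :
  L2_deriv a b i (fun x => phi x ^+ 2) (fun x => d i x * phi x + phi x * d i x).
Proof.
have [[mf pf _] [mg pg _] fg] := weak_derivM ab (phi_d i) (phi_d i).
split; [exact: H2per_sqr| |exact: fg].
split=> //; apply: (le_box_integrable (g := fun x => 2 * (phi x ^+ 4 + d i x ^+ 4))).
- exact: measurable_funX.
- by apply: box_integrableZ; exact: box_integrableD.
move=> x _; rewrite ger0_norm ?sqr_ge0//.
have := sqr_ge0 (phi x ^+ 2 - d i x ^+ 2).
by move: (phi x) (d i x) => y p; lra.
Qed.

Let phi8 : box_integrable a b (fun x => phi x ^+ 8).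
Proof.
have := L4_embedding hD ab phi_sqr_deriv.
by under eq_fun do rewrite -exprM.
Qed.

Lemma H2per_cube : L2per a b (fun x => phi x ^+ 3).
Proof.
have [mphi pphi _] := Lphi; split; first exact: measurable_funX.
  by move=> i x; rewrite pphi.
apply: (le_box_integrable (g := fun x => phi x ^+ 4 + phi x ^+ 8)).
- by apply: measurable_funX; exact: measurable_funX.
- exact: box_integrableD.
move=> x _; rewrite ger0_norm ?sqr_ge0//.
have := sqr_ge0 (phi x ^+ 2 - phi x ^+ 4).
have := sqr_ge0 (phi x ^+ 2); have := sqr_ge0 (phi x ^+ 4).
by move: (phi x) => y; lra.
Qed.

(** The square of the derivative is 9 phi^4 (d_i phi)^2, which phi^8 and the fourth power of d_i phi
    control. *)
Let phi_cube_deriv i :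
  L2_deriv a b i (fun x => phi x ^+ 3) (fun x => 3 * phi x ^+ 2 * d i x).
Proof.
have [[mf pf _] [mg pg _] fg] := weak_derivM ab (phi_sqr_deriv i) (phi_d i).
have E1 : (fun x => phi x ^+ 2 * phi x) = (fun x => phi x ^+ 3).
  by apply/funext => x; rewrite [RHS]exprSr.
have E2 : (fun x => (d i x * phi x + phi x * d i x) * phi x + phi x ^+ 2 * d i x) =
    (fun x => 3 * phi x ^+ 2 * d i x).
  by apply/funext => x; ring.
rewrite E1 in fg; rewrite E2 in fg mg pg.
split; [exact: H2per_cube| |exact: fg].
split=> //; apply: (le_box_integrable (g := fun x => 9 * (phi x ^+ 8 + d i x ^+ 4))).
- exact: measurable_funX.
- by apply: box_integrableZ; exact: box_integrableD.
move=> x _; rewrite ger0_norm ?sqr_ge0//.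
have := sqr_ge0 (phi x ^+ 4 - d i x ^+ 2); have := sqr_ge0 (phi x ^+ 4).
have := sqr_ge0 (d i x ^+ 2).
by move: (phi x) (d i x) => y p; lra.
Qed.

Lemma H2per_grad_sq : L2per a b (grad_sq a b phi).
Proof. exact: L2per_sum. Qed.

Lemma H2per_laplacian : L2per a b (laplacian a b phi).
Proof. by apply: L2per_sum => i; have [] := d_dd i. Qed.

Lemma integral_laplacian_by_parts f (df : 'I_D -> 'rV[R]_D -> R) :
  (forall i, L2_deriv a b i f (df i)) ->
  I (fun x => f x * laplacian a b phi x) = - \sum_(i < D) I (fun x => df i x * d i x).
Proof.
move=> fdf; rewrite -sumrN.
have Lf i : L2per a b f by have [] := fdf i.
transitivity (\sum_(i < D) I (fun x => f x * dd i x)); last first.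
  by apply: eq_bigr => i _; exact: (L2_deriv_by_parts ab (fdf i) (d_dd i)).
rewrite -Rintegral_sum_box.
  by apply: eq_Rintegral => x _; rewrite /laplacian mulr_sumr.
by move=> i; have [_ Ldd _] := d_dd i; have [] := L2perM_L1per (Lf i) Ldd.
Qed.

Lemma integral_cube_laplacian : I (fun x => phi x ^+ 3 * laplacian a b phi x) =
  - I (fun x => 3 * phi x ^+ 2 * grad_sq a b phi x).
Proof.
rewrite (integral_laplacian_by_parts phi_cube_deriv); congr (- _).
rewrite -Rintegral_sum_box.
  by apply: eq_Rintegral => x _; rewrite /grad_sq mulr_sumr; apply: eq_bigr => i _; ring.
by move=> i; have [_ Lc _] := phi_cube_deriv i; have [] := L2perM_L1per Lc (Ld i).
Qed.

Lemma integral_laplacian : I (fun x => phi x * laplacian a b phi x) =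
  - I (grad_sq a b phi).
Proof.
rewrite (integral_laplacian_by_parts phi_d); congr (- _).
rewrite -Rintegral_sum_box.
  by apply: eq_Rintegral => x _; rewrite /grad_sq; apply: eq_bigr => i _.
by move=> i; have [] := L2perM_L1per (Ld i) (Ld i).
Qed.

End H2_integrability.

End weak_partials.

(** * Convexity *)

Section pointwise_convexity.
Context {R : realType}.
Implicit Types (t x y z : R).

Lemma lerX_ge0 n x y : 0 <= x -> x <= y -> x ^+ n <= y ^+ n.
Proof. by move=> x0 xy; rewrite lerXn2r// nnegrE (le_trans x0). Qed.

Lemma sqr_conv t x y : t * x ^+ 2 + (1 - t) * y ^+ 2 - (t * x + (1 - t) * y) ^+ 2 =
  t * (1 - t) * (x - y) ^+ 2.
Proof. by ring. Qed.

Lemma sqr_conv_le t x y : 0 <= t <= 1 ->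
  (t * x + (1 - t) * y) ^+ 2 <= t * x ^+ 2 + (1 - t) * y ^+ 2.
Proof.
move=> /andP[t0 t1]; rewrite -subr_ge0 sqr_conv.
by rewrite mulr_ge0 ?sqr_ge0// mulr_ge0// subr_ge0.
Qed.

Lemma sqr_conv_lt t x y : 0 < t < 1 -> x != y ->
  (t * x + (1 - t) * y) ^+ 2 < t * x ^+ 2 + (1 - t) * y ^+ 2.
Proof.
move=> /andP[t0 t1] xy; rewrite -subr_gt0 sqr_conv.
apply: mulr_gt0; first by apply: mulr_gt0; rewrite ?subr_gt0.
by rewrite exprn_even_gt0//= subr_eq0.
Qed.

Lemma pow4_conv_le t x y : 0 <= t <= 1 ->
  (t * x + (1 - t) * y) ^+ 4 <= t * x ^+ 4 + (1 - t) * y ^+ 4.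
Proof.
move=> t01; rewrite -[4%N]/(2 * 2)%N !exprM.
apply: le_trans (sqr_conv_le _ _ t01).
exact: lerX_ge0 (sqr_ge0 _) (sqr_conv_le x y t01).
Qed.

Lemma pow4_conv_lt t x y : 0 < t < 1 -> x != y ->
  (t * x + (1 - t) * y) ^+ 4 < t * x ^+ 4 + (1 - t) * y ^+ 4.
Proof.
move=> t01 xy; have t01' : 0 <= t <= 1 by lra.
rewrite -[4%N]/(2 * 2)%N !exprM.
apply: lt_le_trans (sqr_conv_le _ _ t01').
have H := sqr_conv_lt t01 xy.
rewrite ltr_pXn2r// nnegrE ?sqr_ge0//.
exact: le_trans (sqr_ge0 _) (ltW H).
Qed.

Lemma cube_conv_le t x y : 0 <= t <= 1 -> 0 <= x -> 0 <= y ->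
  (t * x + (1 - t) * y) ^+ 3 <= t * x ^+ 3 + (1 - t) * y ^+ 3.
Proof.
move=> /andP[t0 t1] x0 y0; rewrite -subr_ge0.
have -> : t * x ^+ 3 + (1 - t) * y ^+ 3 - (t * x + (1 - t) * y) ^+ 3 =
    t * (1 - t) * (x - y) ^+ 2 * ((1 + t) * x + (2 - t) * y) by ring.
apply: mulr_ge0; first by rewrite mulr_ge0 ?sqr_ge0// mulr_ge0// subr_ge0.
by rewrite addr_ge0// mulr_ge0//; lra.
Qed.

Lemma pow6_conv_le t x y : 0 <= t <= 1 ->
  (t * x + (1 - t) * y) ^+ 6 <= t * x ^+ 6 + (1 - t) * y ^+ 6.
Proof.
move=> t01; rewrite -[6%N]/(2 * 3)%N !exprM.
apply: le_trans (cube_conv_le t01 (sqr_ge0 x) (sqr_ge0 y)).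
exact: lerX_ge0 (sqr_ge0 _) (sqr_conv_le x y t01).
Qed.

Lemma sum_sqr_ge0 n (p : 'I_n -> R) : 0 <= \sum_i p i ^+ 2.
Proof. by apply: sumr_ge0 => i _; exact: sqr_ge0. Qed.

Lemma sum_cauchy_schwarz n (p q : 'I_n -> R) :
  \sum_i p i * q i <= Num.sqrt (\sum_i p i ^+ 2) * Num.sqrt (\sum_i q i ^+ 2).
Proof.
set P := \sum_i p i ^+ 2; set Q := \sum_i q i ^+ 2.
have P0 : 0 <= P by exact: sum_sqr_ge0.
have Q0 : 0 <= Q by exact: sum_sqr_ge0.
set r := Num.sqrt P; set s := Num.sqrt Q.
have r0 : 0 <= r by exact: sqrtr_ge0.
have s0 : 0 <= s by exact: sqrtr_ge0.
have rP : r ^+ 2 = P by exact: sqr_sqrtr.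
have sQ : s ^+ 2 = Q by exact: sqr_sqrtr.
have zero (u v : 'I_n -> R) : \sum_i u i ^+ 2 = 0 -> \sum_i u i * v i = 0.
  move=> /eqP; rewrite psumr_eq0; last by move=> i _; exact: sqr_ge0.
  move=> /allP u0; apply: big1 => i _.
  by have := u0 i (mem_index_enum i); rewrite sqrf_eq0 => /eqP ->; rewrite mul0r.
have [r00|rn0] := eqVneq r 0.
  by rewrite zero ?r00 ?mul0r// -/P -rP r00 expr0n.
have [s00|sn0] := eqVneq s 0.
  under eq_bigr do rewrite mulrC.
  by rewrite zero ?s00 ?mulr0// -/Q -sQ s00 expr0n.
have rs : 0 < r * s by rewrite mulr_gt0// lt_neqAle eq_sym ?rn0 ?sn0.
have H : 0 <= \sum_i (s * p i - r * q i) ^+ 2 by exact: sum_sqr_ge0.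
have E : \sum_i (s * p i - r * q i) ^+ 2 =
    s ^+ 2 * P + r ^+ 2 * Q - 2 * (r * s) * \sum_i p i * q i.
  rewrite !mulr_sumr -big_split -sumrB; apply: eq_bigr => i _ /=; ring.
rewrite E -rP -sQ in H; rewrite -(ler_pM2l rs); lra.
Qed.

(** The squared triangle inequality for the Euclidean norm. It replaces the gradient by its length,
    so that the quartic part becomes a question about two real variables. *)
Lemma sum_sqr_conv n (p q : 'I_n -> R) t : 0 <= t <= 1 ->
  \sum_i (t * p i + (1 - t) * q i) ^+ 2 <=
  (t * Num.sqrt (\sum_i p i ^+ 2) + (1 - t) * Num.sqrt (\sum_i q i ^+ 2)) ^+ 2.
Proof.
move=> /andP[t0 t1].
have E : \sum_i (t * p i + (1 - t) * q i) ^+ 2 =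
   t ^+ 2 * (\sum_i p i ^+ 2) + (1 - t) ^+ 2 * (\sum_i q i ^+ 2) +
   2 * t * (1 - t) * \sum_i p i * q i.
  rewrite !mulr_sumr -!big_split; apply: eq_bigr => i _ /=; ring.
have := sum_cauchy_schwarz p q; rewrite {}E.
have := sqr_sqrtr (sum_sqr_ge0 p); have := sqr_sqrtr (sum_sqr_ge0 q).
move: (Num.sqrt _) (Num.sqrt _) => s r <- <-.
move: (\sum_i p i * q i) => c cs.
have tt : 0 <= t * (1 - t) by rewrite mulr_ge0// subr_ge0.
have := ler_wpM2l tt cs; lra.
Qed.

(* [y^4 + 3 y^2 r^2 + r^4 = ((y + r)^4 + (y - r)^4) / 4 + (y^4 + r^4) / 2] is
   jointly convex in [(y, r)] and nondecreasing in [r >= 0]. *)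
Lemma quartic_form_conv t y y' r r' S : 0 <= t <= 1 -> 0 <= r -> 0 <= r' ->
  0 <= S <= (t * r + (1 - t) * r') ^+ 2 ->
  let ym := t * y + (1 - t) * y' in
  ym ^+ 4 + 3 * ym ^+ 2 * S + S ^+ 2 <=
  t * (y ^+ 4 + 3 * y ^+ 2 * r ^+ 2 + (r ^+ 2) ^+ 2) +
  (1 - t) * (y' ^+ 4 + 3 * y' ^+ 2 * r' ^+ 2 + (r' ^+ 2) ^+ 2).
Proof.
move=> t01 r0 r'0 /andP[S0 Sr] /=; set ym := t * y + _; set rm := t * r + _ in Sr.
have H1 := pow4_conv_le (y + r) (y' + r') t01.
have H2 := pow4_conv_le (y - r) (y' - r') t01.
have H3 := pow4_conv_le y y' t01.
have H4 := pow4_conv_le r r' t01.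
have E1 : t * (y + r) + (1 - t) * (y' + r') = ym + rm by rewrite /ym /rm; ring.
have E2 : t * (y - r) + (1 - t) * (y' - r') = ym - rm by rewrite /ym /rm; ring.
rewrite E1 in H1; rewrite E2 in H2; rewrite -/ym in H3; rewrite -/rm in H4.
have H5 : S ^+ 2 <= (rm ^+ 2) ^+ 2 by exact: lerX_ge0.
have H6 : ym ^+ 2 * S <= ym ^+ 2 * rm ^+ 2 by rewrite ler_wpM2l// sqr_ge0.
move: ym rm H1 H2 H3 H4 H5 H6 {E1 E2 Sr} => ym rm H1 H2 H3 H4 H5 H6.
have : 4 * (ym ^+ 4 + 3 * ym ^+ 2 * rm ^+ 2 + (rm ^+ 2) ^+ 2) =
  (ym + rm) ^+ 4 + (ym - rm) ^+ 4 + 2 * (ym ^+ 4 + rm ^+ 4) by ring.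
have : 4 * (y ^+ 4 + 3 * y ^+ 2 * r ^+ 2 + (r ^+ 2) ^+ 2) =
  (y + r) ^+ 4 + (y - r) ^+ 4 + 2 * (y ^+ 4 + r ^+ 4) by ring.
have : 4 * (y' ^+ 4 + 3 * y' ^+ 2 * r' ^+ 2 + (r' ^+ 2) ^+ 2) =
  (y' + r') ^+ 4 + (y' - r') ^+ 4 + 2 * (y' ^+ 4 + r' ^+ 4) by ring.
move: ((ym + rm) ^+ 4) ((ym - rm) ^+ 4) ((y + r) ^+ 4) ((y - r) ^+ 4)
  ((y' + r') ^+ 4) ((y' - r') ^+ 4) H1 H2 => x1 x2 x3 x4 x5 x6 H1 H2 F1 F2 F3.
have G1 : t * (4 * (y ^+ 4 + 3 * y ^+ 2 * r ^+ 2 + (r ^+ 2) ^+ 2)) =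
  t * (x3 + x4 + 2 * (y ^+ 4 + r ^+ 4)) by congr (_ * _).
have G2 : (1 - t) * (4 * (y' ^+ 4 + 3 * y' ^+ 2 * r' ^+ 2 + (r' ^+ 2) ^+ 2)) =
  (1 - t) * (x5 + x6 + 2 * (y' ^+ 4 + r' ^+ 4)) by congr (_ * _).
lra.
Qed.

Section densities.
Variables (eps eta A : R).
Hypotheses (heps : 0 < eps) (heta : 0 < eta) (A1 : 1 <= A).

(** The density as a function of the values of phi, |grad phi|^2 and lap phi, which makes convexity
    a finite-dimensional statement. *)
Definition contractive_jet y S q :=
  eps ^- 2 / 2 * y ^+ 6 + (eps ^- 2 / 2 + eta / 2) * y ^+ 2
  + eps ^+ 2 / 2 * q ^+ 2 + A * (y ^+ 4 + S ^+ 2) + 3 * y ^+ 2 * S.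

Definition expansive_jet y S :=
  (eps ^- 2 + eta / 4) * y ^+ 4 + (1 + eta * eps ^+ 2 / 2) * S
  + A * (y ^+ 4 + S ^+ 2).

Lemma sum_sqr_conv_sqr n (p p' : 'I_n -> R) t : 0 <= t <= 1 ->
  \sum_i (t * p i + (1 - t) * p' i) ^+ 2 <=
    t * (\sum_i p i ^+ 2) + (1 - t) * (\sum_i p' i ^+ 2) /\
  (\sum_i (t * p i + (1 - t) * p' i) ^+ 2) ^+ 2 <=
    t * (\sum_i p i ^+ 2) ^+ 2 + (1 - t) * (\sum_i p' i ^+ 2) ^+ 2.
Proof.
move=> t01; set Sm := \sum_i _.
have Sm0 : 0 <= Sm by exact: sum_sqr_ge0.
have le1 : Sm <= t * (\sum_i p i ^+ 2) + (1 - t) * (\sum_i p' i ^+ 2).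
  apply: le_trans (sum_sqr_conv p p' t01) _.
  by apply: le_trans (sqr_conv_le _ _ t01) _; rewrite !sqr_sqrtr ?sum_sqr_ge0.
split=> //; apply: le_trans (sqr_conv_le _ _ t01).
exact: lerX_ge0.
Qed.

(** One unit of [A] goes with the mixed term into [quartic_form_conv], and the remaining A - 1
    multiplies separately convex terms. The convexity gap of y^2 is kept on the left instead of
    being discarded: strictness will come from it. *)
Lemma contractive_jet_conv n t y y' q q' (p p' : 'I_n -> R) : 0 <= t <= 1 ->
  contractive_jet (t * y + (1 - t) * y') (\sum_i (t * p i + (1 - t) * p' i) ^+ 2)
    (t * q + (1 - t) * q') + (eps ^- 2 / 2 + eta / 2) *
    (t * y ^+ 2 + (1 - t) * y' ^+ 2 - (t * y + (1 - t) * y') ^+ 2) <=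
  t * contractive_jet y (\sum_i p i ^+ 2) q +
  (1 - t) * contractive_jet y' (\sum_i p' i ^+ 2) q'.
Proof.
move=> t01.
have [_ HS] := sum_sqr_conv_sqr p p' t01.
have Sle := sum_sqr_conv p p' t01.
have S0 := sum_sqr_ge0 (fun i => t * p i + (1 - t) * p' i).
have H := @quartic_form_conv t y y' _ _ _ t01 (sqrtr_ge0 (\sum_i p i ^+ 2))
  (sqrtr_ge0 (\sum_i p' i ^+ 2)) (introT andP (conj S0 Sle)).
rewrite /= !sqr_sqrtr ?sum_sqr_ge0// in H.
have H6 := pow6_conv_le y y' t01.
have Hq := sqr_conv_le q q' t01.
have H4 := pow4_conv_le y y' t01.
have e2 : 0 < eps ^+ 2 by exact: exprn_gt0.
have c6 : 0 <= eps ^- 2 / 2 by rewrite divr_ge0// invr_ge0 ltW.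
have cq : 0 <= eps ^+ 2 / 2 by rewrite divr_ge0// ltW.
have cA : 0 <= A - 1 by rewrite subr_ge0.
have {}H6 := ler_wpM2l c6 H6.
have {}Hq := ler_wpM2l cq Hq.
have {}H4 := ler_wpM2l cA H4.
have {}HS := ler_wpM2l cA HS.
rewrite /contractive_jet.
move: (\sum_i (t * p i + (1 - t) * p' i) ^+ 2) (\sum_i p i ^+ 2) (\sum_i p' i ^+ 2)
  HS H {Sle S0} => Sm S S' HS H.
move: ((t * y + (1 - t) * y') ^+ 6) ((t * y + (1 - t) * y') ^+ 4)
  ((t * y + (1 - t) * y') ^+ 2) ((t * q + (1 - t) * q') ^+ 2) H6 Hq H4 HS H
  => m6 m4 m2 qm H6 Hq H4 HS H.
move: (eps ^- 2 / 2) (eps ^+ 2 / 2) H6 Hq {c6 cq cA} => c6 cq H6 Hq.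
lra.
Qed.

(** There is no mixed term, so each summand is convex by itself. The gap of A y^4 is kept to provide
    strictness. *)
Lemma expansive_jet_conv n t y y' (p p' : 'I_n -> R) : 0 <= t <= 1 ->
  expansive_jet (t * y + (1 - t) * y') (\sum_i (t * p i + (1 - t) * p' i) ^+ 2) +
    A * (t * y ^+ 4 + (1 - t) * y' ^+ 4 - (t * y + (1 - t) * y') ^+ 4) <=
  t * expansive_jet y (\sum_i p i ^+ 2) + (1 - t) * expansive_jet y' (\sum_i p' i ^+ 2).
Proof.
move=> t01.
have [HS1 HS] := sum_sqr_conv_sqr p p' t01.
have H4 := pow4_conv_le y y' t01.
have e2 : 0 < eps ^+ 2 by exact: exprn_gt0.
have e2' : 0 < eps ^- 2 by rewrite invr_gt0.
have c4 : 0 <= eps ^- 2 + eta / 4 by rewrite addr_ge0 ?divr_ge0// ltW.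
have cS : 0 <= 1 + eta * eps ^+ 2 / 2.
  by rewrite addr_ge0// divr_ge0// mulr_ge0// ltW.
have A0 : 0 <= A by exact: le_trans A1.
have {}H4 := ler_wpM2l c4 H4.
have {}HS1 := ler_wpM2l cS HS1.
have {}HS := ler_wpM2l A0 HS.
rewrite /expansive_jet.
move: (\sum_i (t * p i + (1 - t) * p' i) ^+ 2) (\sum_i p i ^+ 2) (\sum_i p' i ^+ 2)
  HS HS1 => Sm S S' HS HS1.
move: ((t * y + (1 - t) * y') ^+ 4) H4 HS HS1 => m4 H4 HS HS1.
move: (eps ^- 2 + eta / 4) (1 + eta * eps ^+ 2 / 2) H4 HS1 {c4 cS} => c4 cS H4 HS1.
lra.
Qed.

End densities.

End pointwise_convexity.

(** * Splitting of the energy and passage from pointwise to integrated convexity *)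

Section energies.
Context {R : realType} {D : nat}.
Hypothesis hD : D = 2%N \/ D = 3%N.
Variables (a b : 'rV[R]_D).
Hypothesis ab : forall i, a ord0 i < b ord0 i.
Variables (eps eta : R).
Hypotheses (heps : 0 < eps) (heta : 0 < eta).
Implicit Types (phi psi : 'rV[R]_D -> R).
Local Notation mu := (lebesgue_rV R D).
Local Notation I f := (\int[mu]_(x in box a b) f x).
Local Notation grad_sq := (grad_sq a b).
Local Notation laplacian := (laplacian a b).
Local Notation L1 := (L1per a b).

Section densities.
Variable phi : 'rV[R]_D -> R.
Hypothesis Hphi : H2per a b phi.

Let Lphi : L2per a b phi. Proof. by case: Hphi. Qed.
Let L2 := H2per_sqr ab hD Hphi.
Let L3 := H2per_cube ab hD Hphi.
Let Lg := H2per_grad_sq ab hD Hphi.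
Let Llap := H2per_laplacian ab Hphi.

Let L1_phi4 : L1 (fun x => phi x ^+ 4).
Proof. by have := L2per_sqr L2; under eq_fun do rewrite -exprM. Qed.

Let L1_phi6 : L1 (fun x => phi x ^+ 6).
Proof. by have := L2per_sqr L3; under eq_fun do rewrite -exprM. Qed.

Let L1_grad_sq : L1 (grad_sq phi).
Proof. exact: L2per_L1per. Qed.

Let L1_mixed : L1 (fun x => 3 * phi x ^+ 2 * grad_sq phi x).
Proof.
under eq_fun do rewrite -mulrA.
by apply: L1perZ; exact: L2perM_L1per.
Qed.

Let L1_quartic A : L1 (fun x => A * (phi x ^+ 4 + grad_sq phi x ^+ 2)).
Proof. by apply: L1perZ; apply: L1perD => //; exact: L2per_sqr. Qed.

Lemma L1per_fch_square : L1 (fch_square a b eps phi).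
Proof.
apply: L2per_sqr.
have -> : (fun x => phi x ^+ 3 - phi x - eps ^+ 2 * laplacian phi x) =
    (fun x => phi x ^+ 3 + (-1 * phi x + (- eps ^+ 2) * laplacian phi x)).
  by apply/funext => x; ring.
by apply: L2perD => //; apply: L2perD; exact: L2perZ.
Qed.

Lemma L1per_fch_cahn_hilliard : L1 (fch_cahn_hilliard a b eps phi).
Proof.
have -> : fch_cahn_hilliard a b eps phi = (fun x => 4^-1 * phi x ^+ 4 +
    (- 2^-1) * phi x ^+ 2 + eps ^+ 2 / 2 * grad_sq phi x).
  by apply/funext => x; rewrite /fch_cahn_hilliard mulNr.
by apply: L1perD; [apply: L1perD|]; apply: L1perZ => //; exact: L2per_sqr.
Qed.

Lemma L1per_contractive_density A : L1 (contractive_density a b eps eta A phi).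
Proof.
apply: (L1perD (L1perD (L1perD (L1perD _ _) _) (L1_quartic A)) L1_mixed);
  by apply: L1perZ => //; exact: L2per_sqr.
Qed.

Lemma L1per_expansive_density A : L1 (expansive_density a b eps eta A phi).
Proof. by apply: (L1perD (L1perD _ _) (L1_quartic A)); exact: L1perZ. Qed.

Lemma fch_energy_splitting A : fch_energy a b eps eta phi =
  contractive_energy a b eps eta A phi - expansive_energy a b eps eta A phi.
Proof.
have [_ _ jc] := L1per_contractive_density A.
have [_ _ je] := L1per_expansive_density A.
have [_ _ js] := L1per_fch_square; have [_ _ jh] := L1per_fch_cahn_hilliard.
have [_ _ jm] := L1_mixed; have [_ _ jg] := L1_grad_sq.
have [_ _ j3] := L2perM_L1per L3 Llap; have [_ _ j1] := L2perM_L1per Lphi Llap.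
have js' := box_integrableZ (eps ^- 2 / 2) js; have jh' := box_integrableZ eta jh.
have en0 : eps != 0 by rewrite gt_eqF.
rewrite /fch_energy /contractive_energy /expansive_energy -(RintegralB_box jc je).
rewrite -(RintegralZ_box _ js) -(RintegralZ_box _ jh) -(RintegralB_box js' jh').
(* Expanding the square leaves - phi^3 lap phi + phi lap phi, where the splitting has 3 phi^2 |grad
   phi|^2 - |grad phi|^2. Adding this integrand of integral zero makes the two sides agree
   pointwise. *)
have E0 : I (fun x => phi x ^+ 3 * laplacian phi x + 3 * phi x ^+ 2 * grad_sq phi x
    - (phi x * laplacian phi x + grad_sq phi x)) = 0.
  rewrite (RintegralB_box (box_integrableD j3 jm) (box_integrableD j1 jg)).
  rewrite (RintegralD_box j3 jm) (RintegralD_box j1 jg).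
  by rewrite (integral_cube_laplacian ab hD Hphi) (integral_laplacian ab Hphi) !addNr subr0.
rewrite -[LHS]addr0 -E0.
have jE := box_integrableB (box_integrableD j3 jm) (box_integrableD j1 jg).
rewrite -(RintegralD_box (box_integrableB js' jh') jE).
apply: eq_Rintegral => x _.
rewrite /fch_square /fch_cahn_hilliard /contractive_density /expansive_density.
by move: (phi x) (grad_sq phi x) (laplacian phi x) => y S q; field.
Qed.

End densities.

Lemma eq_grad_sq_laplacian phi psi : H2per a b phi -> H2per a b psi ->
  phi = psi %[ae mu in box a b] ->
  grad_sq phi = grad_sq psi /\ laplacian phi = laplacian psi.
Proof.
move=> [/L2per_measurable mphi _] [/L2per_measurable mpsi _] pp.
have E i := eq_weak_partial i mphi mpsi pp.
by split; apply/funext => x; apply: eq_bigr => i _; rewrite E.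
Qed.

Lemma comb_grad_sq_laplacian c d phi psi : H2per a b phi -> H2per a b psi ->
  let chi x := c * phi x + d * psi x in
  {ae mu, forall x, box a b x ->
    grad_sq chi x = \sum_i (c * weak_partial a b i phi x + d * weak_partial a b i psi x) ^+ 2 /\
    laplacian chi x = c * laplacian phi x + d * laplacian psi x}.
Proof.
move=> Hphi Hpsi chi; have [_ E1 E2] := H2per_comb ab c d Hphi Hpsi.
have FF : Filter (almost_everywhere mu) by exact: ae_filter_ringOfSetsType.
have F1 := filter_forall FF E1; have F2 := filter_forall FF (fun i => E2 i i).
apply: filterS2 F1 F2 => x F1 F2 Bx; split.
  by apply: eq_bigr => i _; rewrite (F1 i Bx).
rewrite /Defs.laplacian !mulr_sumr -big_split.
by apply: eq_bigr => i _; exact: (F2 i Bx).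
Qed.

(** Strictness is asked only at points where the two functions differ, and the null set may depend
    on [t], [phi] and [psi]. *)
Definition ae_strictly_convex (dens : ('rV[R]_D -> R) -> 'rV[R]_D -> R) :=
  forall t phi psi, 0 <= t <= 1 -> H2per a b phi -> H2per a b psi ->
  {ae mu, forall x, box a b x ->
    dens (fun y => t * phi y + (1 - t) * psi y) x <=
      t * dens phi x + (1 - t) * dens psi x /\
    (0 < t < 1 -> phi x != psi x ->
      dens (fun y => t * phi y + (1 - t) * psi y) x <
      t * dens phi x + (1 - t) * dens psi x)}.

Section strict_convexity.
Variable dens : ('rV[R]_D -> R) -> 'rV[R]_D -> R.
Hypothesis L1_dens : forall phi, H2per a b phi -> L1 (dens phi).
Hypothesis eq_dens : forall phi psi, H2per a b phi -> H2per a b psi ->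
  phi = psi %[ae mu in box a b] -> dens phi = dens psi %[ae mu in box a b].
Hypothesis dens_conv : ae_strictly_convex dens.
Local Notation J := (fun phi => I (dens phi)).

Lemma integral_H2_functional : H2_functional a b J.
Proof.
move=> phi psi Hphi Hpsi pp.
have [m1 _ _] := L1_dens Hphi; have [m2 _ _] := L1_dens Hpsi.
by apply: eq_Rintegral_ae => //; exact: eq_dens.
Qed.

(** The gap is nonnegative almost everywhere, so its integral is that of its absolute value; in this
    form nonnegativity is evident and vanishing of the integral forces the gap to vanish almost
    everywhere. *)
Let comb_integral t phi psi : 0 <= t <= 1 -> H2per a b phi -> H2per a b psi ->
  let chi x := t * phi x + (1 - t) * psi x in
  let gap x := t * dens phi x + (1 - t) * dens psi x - dens chi x in
  [/\ measurable_fun setT gap, box_integrable a b gap &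
      t * J phi + (1 - t) * J psi - J chi = I (fun x => `|gap x|)].
Proof.
move=> t01 Hphi Hpsi chi gap.
have [Hchi _ _] := H2per_comb ab t (1 - t) Hphi Hpsi.
have [_ _ j1] := L1_dens Hphi; have [_ _ j2] := L1_dens Hpsi.
have [_ _ jc] := L1_dens Hchi.
have [mgap _ jgap] : L1 gap.
  have -> : gap = (fun x => t * dens phi x + (1 - t) * dens psi x + (-1) * dens chi x).
    by apply/funext => x; rewrite mulN1r.
  by apply: L1perD; [apply: L1perD|]; apply: L1perZ; exact: L1_dens.
split=> //.
have jt1 := box_integrableZ t j1; have jt2 := box_integrableZ (1 - t) j2.
rewrite -(RintegralZ_box t j1) -(RintegralZ_box (1 - t) j2).
rewrite -(RintegralD_box jt1 jt2) -(RintegralB_box (box_integrableD jt1 jt2) jc).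
apply: eq_Rintegral_ae => //; first exact: measurableT_comp.
apply: filterS (dens_conv t01 Hphi Hpsi) => x H Bx.
by rewrite ger0_norm// subr_ge0; have [] := H Bx.
Qed.

Let convE (t : {i01 R}) (phi psi : convex_lmodType ('rV[R]_D -> R^o)) :
  conv t phi psi = (fun x => t%:num * phi x + (1 - t%:num) * psi x).
Proof. by []. Qed.

Lemma integral_H2_convex : H2_convex a b J.
Proof.
split; first exact: integral_H2_functional.
move=> t phi psi; rewrite !inE => Hphi Hpsi.
have t01 : 0 <= t%:num <= 1 by apply/andP.
have [_ _ E] := comb_integral t01 Hphi Hpsi.
by rewrite convRE convE -subr_ge0 E Rintegral_ge0.
Qed.

(** If the integrated gap were zero, the pointwise gap would vanish almost everywhere, and pointwise
    strictness would make the two functions equal almost everywhere. *)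
Lemma integral_H2_strictly_convex : H2_strictly_convex a b J.
Proof.
split; first exact: integral_H2_functional.
move=> t phi psi t01 Hphi Hpsi npp.
have t01' : 0 <= t%:num <= 1 by apply/andP.
have [mgap jgap E] := comb_integral t01' Hphi Hpsi.
rewrite convRE convE -subr_gt0 E lt_neqAle Rintegral_ge0// andbT.
apply/negP => /eqP I0; apply: npp.
set gap := fun x => _ in mgap jgap I0.
have me : measurable_fun (box a b) (EFin \o gap).
  by apply/measurable_EFinP; exact: measurable_funTS.
have : (\int[mu]_(x in box a b) `|(EFin \o gap) x|)%E = 0.
  by rewrite -[RHS]/(0%R%:E) I0 (EFin_Rintegral_box (box_integrable_norm jgap)).
move=> /(ae_eq_integral_abs mu (measurable_box a b) me).
have FF : Filter (almost_everywhere mu) by exact: ae_filter_ringOfSetsType.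
apply: filterS2 (dens_conv t01' Hphi Hpsi) => x /= H G Bx.
have [_ {}H] := H Bx; have [{}G] := G Bx.
by apply/eqP; apply: contraT => /(H t01); rewrite -subr_gt0 -/(gap x) G ltxx.
Qed.

End strict_convexity.

Section splitting.
Variable A : R.
Hypothesis A1 : 1 <= A.

Lemma contractive_density_conv : ae_strictly_convex (contractive_density a b eps eta A).
Proof.
move=> t phi psi t01 Hphi Hpsi; set dens := _ A.
apply: filterS (comb_grad_sq_laplacian t (1 - t) Hphi Hpsi) => x H Bx.
have [ES Eq] := H Bx.
have := @contractive_jet_conv R eps eta A heps A1 D t (phi x) (psi x) (laplacian phi x)
  (laplacian psi x) (fun i => weak_partial a b i phi x) (fun i => weak_partial a b i psi x) t01.
rewrite -ES -Eq => {}H; rewrite -[dens _ x]/(contractive_jet eps eta A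
  (t * phi x + (1 - t) * psi x) _ _).
have e2 : 0 < eps ^- 2 by rewrite invr_gt0 exprn_gt0.
have c0 : 0 < eps ^- 2 / 2 + eta / 2 by rewrite addr_gt0// divr_gt0.
split.
  apply: le_trans H; rewrite lerDl mulr_ge0 ?(ltW c0)// subr_ge0.
  exact: sqr_conv_le.
move=> t01' neq; apply: lt_le_trans H; rewrite ltrDl mulr_gt0// subr_gt0.
exact: sqr_conv_lt.
Qed.

Lemma expansive_density_conv : ae_strictly_convex (expansive_density a b eps eta A).
Proof.
move=> t phi psi t01 Hphi Hpsi; set dens := _ A.
apply: filterS (comb_grad_sq_laplacian t (1 - t) Hphi Hpsi) => x H Bx.
have [ES _] := H Bx.
have := expansive_jet_conv heps heta A1 (phi x) (psi x)
  (fun i => weak_partial a b i phi x) (fun i => weak_partial a b i psi x) t01.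
rewrite -ES => {}H; rewrite -[dens _ x]/(expansive_jet eps eta A
  (t * phi x + (1 - t) * psi x) _).
have A0 : 0 < A by exact: lt_le_trans A1.
split.
  apply: le_trans H; rewrite lerDl mulr_ge0 ?(ltW A0)// subr_ge0.
  exact: pow4_conv_le.
move=> t01' neq; apply: lt_le_trans H; rewrite ltrDl mulr_gt0// subr_gt0.
exact: pow4_conv_lt.
Qed.

Let eq_contractive_density phi psi : H2per a b phi -> H2per a b psi ->
  phi = psi %[ae mu in box a b] -> contractive_density a b eps eta A phi =
  contractive_density a b eps eta A psi %[ae mu in box a b].
Proof.
move=> Hphi Hpsi pp; have [ES Eq] := eq_grad_sq_laplacian Hphi Hpsi pp.
by apply: filterS pp => x /= pp Bx; rewrite /contractive_density ES Eq (pp Bx).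
Qed.

Let eq_expansive_density phi psi : H2per a b phi -> H2per a b psi ->
  phi = psi %[ae mu in box a b] -> expansive_density a b eps eta A phi =
  expansive_density a b eps eta A psi %[ae mu in box a b].
Proof.
move=> Hphi Hpsi pp; have [ES _] := eq_grad_sq_laplacian Hphi Hpsi pp.
by apply: filterS pp => x /= pp Bx; rewrite /expansive_density ES (pp Bx).
Qed.

Lemma contractive_energy_convex :
  H2_convex a b (contractive_energy a b eps eta A) /\
  H2_strictly_convex a b (contractive_energy a b eps eta A).
Proof.
have H1 phi (Hphi : H2per a b phi) := L1per_contractive_density Hphi A.
split.
  exact: (integral_H2_convex H1 eq_contractive_density contractive_density_conv).
exact: (integral_H2_strictly_convex H1 eq_contractive_density contractive_density_conv).
Qed.

Lemma expansive_energy_convex :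
  H2_convex a b (expansive_energy a b eps eta A) /\
  H2_strictly_convex a b (expansive_energy a b eps eta A).
Proof.
have H1 phi (Hphi : H2per a b phi) := L1per_expansive_density Hphi A.
split.
  exact: (integral_H2_convex H1 eq_expansive_density expansive_density_conv).
exact: (integral_H2_strictly_convex H1 eq_expansive_density expansive_density_conv).
Qed.

End splitting.

End energies.

Theorem corollary2p3 (R : realType) (D : nat) (hD : D = 2%N \/ D = 3%N)
    (a b : 'rV[R]_D) (hab : forall i, a ord0 i < b ord0 i)
    (eps eta : R) (heps : 0 < eps) (heta : 0 < eta) :
  [/\ forall phi, H2per a b phi ->
        box_integrable a b (fch_square a b eps phi) /\
        box_integrable a b (fch_cahn_hilliard a b eps phi),
      convex_splitting a b (fch_energy a b eps eta) &
      forall A : R,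
        (forall phi, H2per a b phi ->
           [/\ box_integrable a b (contractive_density a b eps eta A phi),
               box_integrable a b (expansive_density a b eps eta A phi) &
               fch_energy a b eps eta phi =
               contractive_energy a b eps eta A phi
               - expansive_energy a b eps eta A phi]) /\
        (1 <= A ->
           H2_strictly_convex a b (contractive_energy a b eps eta A) /\
           H2_strictly_convex a b (expansive_energy a b eps eta A))].
Proof.
split.
- move=> phi Hphi.
  have [_ _ js] := L1per_fch_square hD hab eps Hphi.
  by have [_ _ jh] := L1per_fch_cahn_hilliard hD hab eps Hphi.
(* The A terms cancel in the difference, so any A with 1 <= A gives a convex splitting; A = 1 is
   taken. *)
- exists (contractive_energy a b eps eta 1), (expansive_energy a b eps eta 1); split.
  + exact: (contractive_energy_convex hD hab heps heta (lexx 1)).1.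
  + exact: (expansive_energy_convex hD hab heps heta (lexx 1)).1.
  + by move=> phi Hphi; exact: fch_energy_splitting.
- move=> A; split=> [phi Hphi|A1].
    have [_ _ jc] := L1per_contractive_density hD hab eps eta Hphi A.
    have [_ _ je] := L1per_expansive_density hD hab eps eta Hphi A.
    by split=> //; exact: fch_energy_splitting.
  split.
    exact: (contractive_energy_convex hD hab heps heta A1).2.
  exact: (expansive_energy_convex hD hab heps heta A1).2.
Qed.
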